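(* (1) Let $f\in III\cup II_a\cup II_b\cup II_c$. (a) The following conditions are equivalent: (i) $H_f$ admits an odd Real structure; (ii) $f$ either has real coefficients and positive diagonal coefficients, or belongs to $II'_c$. (b) If one of these equivalent conditions is satisfied, any odd Real structure on $H_f$ is equivalent to the Real structure $\sigma_f$. (2) Let $f\in IV$ be given by $f(z,w)=(\alpha z,\alpha w)$, where $0<|\alpha|<1$. (a) The following conditions are equivalent: (i) $H_f$ admits an odd Real structure; (ii) $\alpha\in\mathbb{R}$. (b) If $\alpha\in(0,1)$, any odd Real structure on $H_f$ is equivalent to $\sigma_f$. If $\alpha\in(-1,0)$, any odd Real structure on $H_f$ is equivalent to $\mathfrak{s}_f$.
   Context: $W=\mathbb{C}^2\setminus\{0\}$. For a contraction $f:W\to W$ below, $H_f=W/\langle f\rangle$ is a primary Hopf surface, and $\mathrm{Aut}_h(\cdot)$ denotes the group of biholomorphisms. Classes of contractions: - $IV$: $f(z,w)=(\alpha z,\alpha w)$, $0<|\alpha|<1$; - $III$: $f(z,w)=(\delta^r z,\delta w)$, $r\in\mathbb{N}$, $r\ge 2$, $0<|\delta|<1$; - $II_a$: $f(z,w)=(\delta^r z+w^r,\delta w)$, $r\in\mathbb{N}$, $r\ge2$, $0<|\delta|<1$; - $II_b$: $f(z,w)=(\alpha z+w,\alpha w)$, $0<|\alpha|<1$; - $II_c$: $f(z,w)=(\alpha z,\delta w)$, $0<|\alpha|<1$, $0<|\delta|<1$, $\alpha\ne\delta^r$ for all $r\in\mathbb{N}$; - $II'_c\subset II_c$: $f(z,w)=(\alpha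 z,\bar\alpha w)$, $0<|\alpha|<1$, $\alpha\notin\mathbb{R}$. The diagonal coefficients of $f$ are the coefficient of $z$ in the first component and the coefficient of $w$ in the second component. A Real structure on a complex manifold is an anti-holomorphic involution. Any Real structure $\sigma$ on $H_f$ lifts to an anti-holomorphic automorphism $\hat\sigma$ of $W$ with $\hat\sigma^2=f^n$, where the parity of $n\in\mathbb{Z}$ depends only on $\sigma$; $\sigma$ is odd if there is a lift with $\hat\sigma^2=f$ (equivalently $n$ is odd). Two Real structures $\sigma,\sigma'$ on $H_f$ are equivalent if $\sigma'=g\circ\sigma\circ g^{-1}$ for some $g\in\mathrm{Aut}_h(H_f)$. Let $c(z,w)=(\bar z,\bar w)$, $c'(z,w)=(\bar w,\bar z)$, $J(z,w)=(-\bar w,\bar z)$. Definition of $\sigma_f$ when $f$ has real coefficients and positive diagonal coefficients: it is the odd Real structure on $H_f$ induced by $c\circ f^{1/2}$, where $f^{1/2}$ is the following square root of $f$: $(\alpha^{1/2}z,\alpha^{1/2}w)$ for $f\in IV$; $(\delta^{r/2}z,\delta^{1/2}w)$ for $f\in III$; $(\delta^{r/2}z+\frac12\delta^{-r/2}w^r,\delta^{1/2}w)$ for $f\in II_a$; $(\alpha^{1/2}z+\frac12\alpha^{-1/2}w,\alpha^{1/2}w)$ for $f\in II_b$; $(\alpha^{1/2}z,\delta^{1/2}w)$ for $f\in II_c$ (positive roots; in the cases $III$ and $II_a$ positivity of the diagonal coefficients includes $\delta>0$). Definition of $\sigma_f$ when $f\in II'_c$, $f(z,w)=(\alpha z,\bar\alpha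 w)$: choose a square root $\alpha^{1/2}$ of $\alpha$; $\sigma_f$ is induced by $c'\circ f^{1/2}$ with $f^{1/2}(z,w)=(\alpha^{1/2}z,\overline{\alpha^{1/2}}w)$. Definition of $\mathfrak{s}_f$ when $f(z,w)=(\alpha z,\alpha w)$ with $\alpha\in(-1,0)$: choose a square root $\alpha^{1/2}$ of $\alpha$; $\mathfrak{s}_f$ is the odd Real structure induced by $J\circ f^{1/2}$ with $f^{1/2}(z,w)=(\alpha^{1/2}z,\alpha^{1/2}w)$. *)

(* Defs.v *)
From Stdlib Require Import Reals ClassicalEpsilon.
From Coquelicot Require Import Coquelicot.
Open Scope C_scope.

Definition C2 : Type := (C * C)%type.

(** Membership in W = C^2 \ {0}. *)
Definition inW (p : C2) : Prop := p <> (RtoC 0, RtoC 0).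

(** * Holomorphic and anti-holomorphic maps on open subsets of C^2 *)

(** Complex (Frechet) differentiability at every point of [U]: the scalars are
    [C_AbsRing], so the differential is C-linear. *)
Definition holomorphic_on (U : C2 -> Prop) (g : C2 -> C2) : Prop :=
  forall p : C2, U p ->
    @ex_filterdiff C_AbsRing
      (prod_NormedModule C_AbsRing C_NormedModule C_NormedModule)
      (prod_NormedModule C_AbsRing C_NormedModule C_NormedModule)
      g (locally p).

Definition conj_c (p : C2) : C2 := (Cconj (fst p), Cconj (snd p)).
Definition conj_c' (p : C2) : C2 := (Cconj (snd p), Cconj (fst p)).
Definition conj_J (p : C2) : C2 := (- Cconj (snd p), Cconj (fst p)).

Definition antiholomorphic_on (U : C2 -> Prop) (g : C2 -> C2) : Prop :=
  holomorphic_on U (fun p => conj_c (g p)).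

(** Self-maps of W are represented by maps on C^2; the value at 0 is never
    used. *)
Definition antiholomorphic_aut_W (phi : C2 -> C2) : Prop :=
  exists psi : C2 -> C2,
    (forall p, inW p -> inW (phi p) /\ inW (psi p)) /\
    (forall p, inW p -> psi (phi p) = p /\ phi (psi p) = p) /\
    antiholomorphic_on inW phi /\ antiholomorphic_on inW psi.

(** * The quotient H_f = W / <f> *)

(** For a bijection [f] of W this says that [q = f^n p] for some integer [n]
    (the second disjunct gives the nonpositive [n]). *)
Definition orbit (f : C2 -> C2) (p q : C2) : Prop :=
  exists n : nat, q = Nat.iter n f p \/ p = Nat.iter n f q.

(** A point of H_f is an orbit, as a subset of W. *)
Definition Hopf (f : C2 -> C2) : Type :=
  { X : C2 -> Prop | exists p, inW p /\ X = orbit f p }.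

(** [mem X p]: the canonical projection W -> H_f sends [p] to [X]. *)
Definition mem {f : C2 -> C2} (X : Hopf f) (p : C2) : Prop := proj1_sig X p.

(** Open sets of W on which the projection W -> H_f is injective.  The inverses
    of these restrictions are the charts of the complex manifold H_f. *)
Definition chart_domain (f : C2 -> C2) (U : C2 -> Prop) : Prop :=
  @open (prod_UniformSpace C_UniformSpace C_UniformSpace) U /\
  (forall p, U p -> inW p) /\
  (forall p q, U p -> U q -> orbit f p q -> p = q).

(** [s] reads as [g] from the chart [U] to the chart [V]; in particular [s]
    sends the image of [U] in H_f into the image of [V]. *)
Definition chart_expression {f : C2 -> C2} (s : Hopf f -> Hopf f)
    (U V : C2 -> Prop) (g : C2 -> C2) : Prop :=
  forall q, U q -> V (g q) /\ (forall Y : Hopf f, mem Y q -> mem (s Y) (g q)).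

Definition holomorphic_map {f : C2 -> C2} (s : Hopf f -> Hopf f) : Prop :=
  forall (X : Hopf f) (p : C2), mem X p ->
    exists (U V : C2 -> Prop) (g : C2 -> C2),
      chart_domain f U /\ chart_domain f V /\ U p /\
      chart_expression s U V g /\ holomorphic_on U g.

Definition antiholomorphic_map {f : C2 -> C2} (s : Hopf f -> Hopf f) : Prop :=
  forall (X : Hopf f) (p : C2), mem X p ->
    exists (U V : C2 -> Prop) (g : C2 -> C2),
      chart_domain f U /\ chart_domain f V /\ U p /\
      chart_expression s U V g /\ antiholomorphic_on U g.

(** * Real structures on H_f *)

Definition real_structure {f : C2 -> C2} (s : Hopf f -> Hopf f) : Prop :=
  antiholomorphic_map s /\ (forall X, s (s X) = X).

Definition lifts {f : C2 -> C2} (phi : C2 -> C2) (s : Hopf f -> Hopf f) : Prop :=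
  forall (X : Hopf f) (p : C2), mem X p -> mem (s X) (phi p).

Definition odd_real_structure {f : C2 -> C2} (s : Hopf f -> Hopf f) : Prop :=
  real_structure s /\
  exists phi : C2 -> C2,
    antiholomorphic_aut_W phi /\ lifts phi s /\
    (forall p, inW p -> phi (phi p) = f p).

(** [h] is the inverse of the biholomorphism [g]. *)
Definition equivalent {f : C2 -> C2} (s s' : Hopf f -> Hopf f) : Prop :=
  exists g h : Hopf f -> Hopf f,
    holomorphic_map g /\ holomorphic_map h /\
    (forall X, h (g X) = X) /\ (forall X, g (h X) = X) /\
    (forall X, s' X = g (s (h X))).

(** The self-map of H_f induced by a self-map [phi] of W: the map lifted by
    [phi], which exists when [phi] commutes with [f] (see [induced_lifts]) and
    is unique since the orbits partition W. *)
Definition induced (f phi : C2 -> C2) : Hopf f -> Hopf f :=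
  epsilon (inhabits (fun X : Hopf f => X)) (lifts phi).

Lemma induced_lifts (f phi : C2 -> C2) :
  (forall p, inW p -> inW (phi p)) -> (forall p, phi (f p) = f (phi p)) ->
  lifts phi (induced f phi).
Proof.
intros HW Hc; unfold induced; apply epsilon_spec.
assert (Hn : forall n p, phi (Nat.iter n f p) = Nat.iter n f (phi p)).
{ induction n as [|n IH]; intros p; simpl; [easy | now rewrite Hc, IH]. }
exists (fun X : Hopf f =>
  let (p, Hp) return Hopf f :=
    constructive_indefinite_description _ (proj2_sig X) in
  exist _ (orbit f (phi p)) (ex_intro _ (phi p) (conj (HW p (proj1 Hp)) eq_refl))).
intros X q; unfold mem.
destruct (constructive_indefinite_description _ (proj2_sig X)) as [p [Wp E]].
simpl; rewrite E; intros [n [-> | ->]]; exists n; [left | right]; apply Hn.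
Qed.

(** * Contractions in normal form *)

Inductive contraction : Type :=
| IV (alpha : C)
| III (r : nat) (delta : C)
| IIa (r : nat) (delta : C)
| IIb (alpha : C)
| IIc (alpha delta : C).

Definition admissible (f : contraction) : Prop :=
  match f with
  | IV alpha | IIb alpha => (0 < Cmod alpha < 1)%R
  | III r delta | IIa r delta => (2 <= r)%nat /\ (0 < Cmod delta < 1)%R
  | IIc alpha delta =>
      (0 < Cmod alpha < 1)%R /\ (0 < Cmod delta < 1)%R /\
      forall r : nat, alpha <> delta ^ r
  end.

Definition map_of (f : contraction) (p : C2) : C2 :=
  let (z, w) := p in
  match f with
  | IV alpha => (alpha * z, alpha * w)
  | III r delta => (delta ^ r * z, delta * w)
  | IIa r delta => (delta ^ r * z + w ^ r, delta * w)
  | IIb alpha => (alpha * z + w, alpha * w)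
  | IIc alpha delta => (alpha * z, delta * w)
  end.

Definition in_IV (f : contraction) : Prop := exists alpha, f = IV alpha.

Definition in_IIc' (f : contraction) : Prop :=
  exists alpha, f = IIc alpha (Cconj alpha) /\ Im alpha <> 0%R.

(** The coefficients of [z] in the first component and of [w] in the second. *)
Definition diagonal_coefficients (f : contraction) : C * C :=
  match f with
  | IV alpha | IIb alpha => (alpha, alpha)
  | III r delta | IIa r delta => (delta ^ r, delta)
  | IIc alpha delta => (alpha, delta)
  end.

(** The nonzero coefficients of the polynomial map [map_of f] off the diagonal
    are all 1. *)
Definition has_real_coefficients (f : contraction) : Prop :=
  Im (fst (diagonal_coefficients f)) = 0%R /\
  Im (snd (diagonal_coefficients f)) = 0%R.

Definition Cpositive (a : C) : Prop := Im a = 0%R /\ (0 < Re a)%R.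

Definition has_positive_diagonal (f : contraction) : Prop :=
  Cpositive (fst (diagonal_coefficients f)) /\
  Cpositive (snd (diagonal_coefficients f)).

(** * The odd Real structures of the classification *)

(** The positive square root of a positive number. *)
Definition pos_sqrt (a : C) : C := RtoC (sqrt (Re a)).

(** The square root f^{1/2} for real coefficients and positive diagonal
    coefficients; delta^{r/2} is [pos_sqrt delta ^ r]. *)
Definition half (f : contraction) (p : C2) : C2 :=
  let (z, w) := p in
  match f with
  | IV alpha => (pos_sqrt alpha * z, pos_sqrt alpha * w)
  | III r delta => (pos_sqrt delta ^ r * z, pos_sqrt delta * w)
  | IIa r delta =>
      (pos_sqrt delta ^ r * z + / RtoC 2 * / (pos_sqrt delta ^ r) * w ^ r,
       pos_sqrt delta * w)
  | IIb alpha =>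
      (pos_sqrt alpha * z + / RtoC 2 * / pos_sqrt alpha * w, pos_sqrt alpha * w)
  | IIc alpha delta => (pos_sqrt alpha * z, pos_sqrt delta * w)
  end.

Definition sigma_f (f : contraction) : Hopf (map_of f) -> Hopf (map_of f) :=
  induced (map_of f) (fun p => conj_c (half f p)).

(** [beta] is the chosen square root of alpha, for [f] of type
    [IIc alpha (Cconj alpha)]. *)
Definition sigma_f' (f : contraction) (beta : C) :
    Hopf (map_of f) -> Hopf (map_of f) :=
  induced (map_of f) (fun p => conj_c' (beta * fst p, Cconj beta * snd p)).

(** [beta] is the chosen square root of alpha, for [f] of type [IV alpha]. *)
Definition frak_s_f (f : contraction) (beta : C) :
    Hopf (map_of f) -> Hopf (map_of f) :=
  induced (map_of f) (fun p => conj_J (beta * fst p, beta * snd p)).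

(* Main.v *)
(** An anti-holomorphic square root [phi] of [f] commutes with [f], so the
    components of [conj o phi] are holomorphic functions on W that are
    quasi-invariant under the contraction [f]; iterating [f] bounds their growth
    by a power of a norm contracted by [f]. On the lines [z = const] and
    [w = const] that avoid the origin they are entire of polynomial growth,
    hence polynomial by Liouville, and this makes them polynomial on W without
    any appeal to Hartogs. Comparing weights under [f] leaves very few monomials,
    and [phi o phi = f] then either contradicts the reality conditions or lets
    one conjugate [phi], by an explicit polynomial automorphism commuting with
    [f], to the standard square root.

    Liouville comes from Goursat's argument on rectangles applied to
    [g (a + e^zeta) e^(-zeta)], whose integral over a vertical period is
    [2 pi g'(a)]. *)
Require Import Defs.
From Stdlib Require Import Reals Lra Lia ClassicalEpsilon ProofIrrelevance
  FunctionalExtensionality PropExtensionality.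
From Coquelicot Require Import Coquelicot.
Open Scope C_scope.

(** The weight comparison is made on moduli: a monomial z^j w^l in a component of conj o phi must
    have a multiplier of the same modulus as an eigenvalue of f, and as both eigenvalues have
    modulus below 1, only a linear term and one pure power survive. The arguments then decide: phi o
    phi = f reads A conj A = a and D conj D = d, which forces positivity unless phi mixes the axes,
    as for II'_c and for homotheties. Types III, II_a and II_b form one family (d^k z + b w^k, d w)
    with b equal to 0 or 1. The term b w^k makes a component of conj o phi quasi-invariant only up
    to a multiple of w^k, hence the inhomogeneous term in the growth estimates. Conjugating phi to
    the standard root is a twisted problem, because constants pass through phi conjugated; it is
    solved by formulas of Hilbert 90 type, such as s = x + conj A, for which s A = x conj s when A
    conj A = x^2. A lift phi is controlled on W only, whereas the explicit maps satisfy their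
    identities on all of C^2; the hypotheses below are split accordingly. *)

Lemma Cmod_le_Rabs (z : C) : (Cmod z <= Rabs (Re z) + Rabs (Im z))%R.
Proof.
  replace z with (RtoC (Re z) + Ci * RtoC (Im z)) at 1
    by (destruct z; unfold RtoC, Ci, Cplus, Cmult; simpl; f_equal; ring).
  eapply Rle_trans; [apply Cmod_triangle|].
  rewrite Cmod_mult, Cmod_Ci, !Cmod_R; lra.
Qed.

Lemma Im_le_Cmod (z : C) : (Rabs (Im z) <= Cmod z)%R.
Proof.
  eapply Rle_trans; [|apply Rmax_Cmod]; apply Rmax_r.
Qed.

Lemma Cmod_minus_sym (z w : C) : Cmod (z - w) = Cmod (w - z).
Proof. rewrite <- Cmod_opp; f_equal; ring. Qed.

Lemma Cmod_triangle_minus (z w : C) : (Cmod z <= Cmod w + Cmod (z - w))%R.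
Proof.
  replace z with (w + (z - w)) at 1 by ring; apply Cmod_triangle.
Qed.

(** Replaces limit arguments. The test value is the distance divided by [2 * (Rabs K + 1)], so
    callers may use any constant [K] that their estimate produces. *)
Lemma Ceq_of_arbitrarily_close (z w : C) (K : R) :
  (forall eps, 0 < eps -> Cmod (z - w) <= K * eps)%R -> z = w.
Proof.
  intros H.
  assert (E : Cmod (z - w) = 0%R).
  { apply Rle_antisym; [|apply Cmod_ge_0].
    apply Rnot_lt_le; intros Hp.
    specialize (H (Cmod (z - w) / (2 * (Rabs K + 1)))%R).
    pose proof (Rabs_pos K). pose proof (Rle_abs K).
    assert (Hd : (0 < Cmod (z - w) / (2 * (Rabs K + 1)))%R)
      by (apply Rdiv_lt_0_compat; lra).
    specialize (H Hd).
    assert (Cmod (z - w) = Cmod (z - w) / (2 * (Rabs K + 1)) * (2 * (Rabs K + 1)))%R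
      by (field; lra).
    nra. }
  apply Cmod_eq_0 in E.
  replace z with (z - w + w) by ring; rewrite E; ring.
Qed.

(** * Complex derivatives *)

(** The increment form has no exceptional case [z = a]; Goursat's remainder estimate uses it as it
    stands. *)
Definition Cderiv (g : C -> C) (a l : C) : Prop :=
  forall eps : R, (0 < eps)%R -> exists del : R, (0 < del)%R /\
    forall z, (Cmod (z - a) < del)%R ->
      (Cmod (g z - g a - l * (z - a)) <= eps * Cmod (z - a))%R.

Definition entire (g : C -> C) : Prop := forall a, exists l, Cderiv g a l.

(** Imports the sum, product and chain rules. The module structure is that of the ring [C] over
    itself, whose balls are discs for [Cmod]. *)
Lemma Cderiv_is_derive (g : C -> C) (a l : C) :
  @is_derive C_AbsRing (AbsRing_NormedModule C_AbsRing) g a l <-> Cderiv g a l.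
Proof.
  split.
  - intros [_ H] eps He.
    destruct (H a (fun P HP => HP) (mkposreal eps He)) as [del Hd].
    exists del; split; [apply cond_pos|]; intros z Hz.
    specialize (Hd z Hz).
    replace (l * (z - a)) with ((z - a) * l) by ring. exact Hd.
  - intros H; split; [apply is_linear_scal_l|].
    intros x Hx; rewrite <- (is_filter_lim_locally_unique _ _ Hx); clear x Hx.
    intros [eps He]; destruct (H eps He) as [del [Hd Hd']].
    exists (mkposreal del Hd); intros z Hz; specialize (Hd' z Hz).
    replace (l * (z - a)) with ((z - a) * l) in Hd' by ring. exact Hd'.
Qed.

Lemma Cderiv_ext (f g : C -> C) (a l : C) :
  (forall z, f z = g z) -> Cderiv f a l -> Cderiv g a l.
Proof.
  intros E H eps He; destruct (H eps He) as [d [Hd H']].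
  exists d; split; [easy|]; intros z Hz; rewrite <- !E; auto.
Qed.

Lemma Cderiv_const (c a : C) : Cderiv (fun _ => c) a 0.
Proof. apply Cderiv_is_derive; apply (is_derive_const (V := AbsRing_NormedModule C_AbsRing)). Qed.

Lemma Cderiv_id (a : C) : Cderiv (fun z => z) a 1.
Proof. apply Cderiv_is_derive; apply (is_derive_id (K := C_AbsRing)). Qed.

Lemma Cderiv_plus (f g : C -> C) (a l m : C) :
  Cderiv f a l -> Cderiv g a m -> Cderiv (fun z => f z + g z) a (l + m).
Proof.
  intros Hf Hg; apply Cderiv_is_derive; apply Cderiv_is_derive in Hf, Hg.
  exact (is_derive_plus _ _ _ _ _ Hf Hg).
Qed.

Lemma Cderiv_mult (f g : C -> C) (a l m : C) :
  Cderiv f a l -> Cderiv g a m ->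
  Cderiv (fun z => f z * g z) a (l * g a + f a * m).
Proof.
  intros Hf Hg; apply Cderiv_is_derive; apply Cderiv_is_derive in Hf, Hg.
  exact (is_derive_mult _ _ _ _ _ Hf Hg Cmult_comm).
Qed.

Lemma Cderiv_comp (f g : C -> C) (a l m : C) :
  Cderiv f (g a) l -> Cderiv g a m -> Cderiv (fun z => f (g z)) a (l * m).
Proof.
  intros Hf Hg; apply Cderiv_is_derive; apply Cderiv_is_derive in Hf, Hg.
  rewrite Cmult_comm.
  exact (is_derive_comp _ _ _ _ _ Hf Hg).
Qed.

Lemma Cderiv_minus (f g : C -> C) (a l m : C) :
  Cderiv f a l -> Cderiv g a m -> Cderiv (fun z => f z - g z) a (l - m).
Proof.
  intros Hf Hg.
  replace (l - m) with (l + (0 * g a + (- (1)) * m)) by ring.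
  apply Cderiv_ext with (fun z => f z + (- (1)) * g z); [intros; ring|].
  apply Cderiv_plus; [easy|].
  apply (Cderiv_mult (fun _ => - (1)) g); [apply Cderiv_const | easy].
Qed.

Lemma Cderiv_continuous (g : C -> C) (a l : C) : Cderiv g a l ->
  forall eps, (0 < eps)%R -> exists del, (0 < del)%R /\
    forall z, (Cmod (z - a) < del)%R -> (Cmod (g z - g a) < eps)%R.
Proof.
  intros H eps He; destruct (H 1%R Rlt_0_1) as [d [Hd Hd']].
  pose proof (Cmod_ge_0 l).
  exists (Rmin d (eps / (Cmod l + 2))); split.
  { apply Rmin_pos; [easy|]; apply Rdiv_lt_0_compat; lra. }
  intros z Hz.
  assert (Hz1 : (Cmod (z - a) < d)%R) by (eapply Rlt_le_trans; [apply Hz|apply Rmin_l]).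
  assert (Hz2 : (Cmod (z - a) < eps / (Cmod l + 2))%R) by (eapply Rlt_le_trans; [apply Hz|apply Rmin_r]).
  specialize (Hd' z Hz1).
  pose proof (Cmod_triangle_minus (g z - g a) (l * (z - a))) as T.
  rewrite Cmod_mult in T.
  apply Rle_lt_trans with ((Cmod l + 1) * Cmod (z - a))%R; [lra|].
  assert (eps = (eps / (Cmod l + 2)) * (Cmod l + 2))%R by (field; lra).
  pose proof (Cmod_ge_0 (z - a)). nra.
Qed.

(** * Integrals of complex-valued functions of a real variable *)

Definition path_continuous (f : R -> C) : Prop :=
  forall t eps, (0 < eps)%R -> exists del, (0 < del)%R /\
    forall s, (Rabs (s - t) < del)%R -> (Cmod (f s - f t) < eps)%R.

Definition CInt (f : R -> C) (a b : R) : C :=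
  (RInt (fun t => Re (f t)) a b, RInt (fun t => Im (f t)) a b).

Lemma path_continuous_ex_RInt (f : R -> C) (a b : R) : path_continuous f ->
  ex_RInt (fun t => Re (f t)) a b /\ ex_RInt (fun t => Im (f t)) a b.
Proof.
  intros H; split; apply (@ex_RInt_continuous R_CompleteNormedModule);
  intros t _; apply continuity_pt_filterlim; intros eps He;
  destruct (H t eps He) as [d [Hd Hd']]; exists d; (split; [exact Hd|]);
  intros s [_ Hs]; specialize (Hd' s Hs); (eapply Rle_lt_trans; [|exact Hd']).
  - exact (re_le_Cmod (f s - f t)).
  - exact (Im_le_Cmod (f s - f t)).
Qed.

Lemma path_continuous_plus (f g : R -> C) : path_continuous f ->
  path_continuous g -> path_continuous (fun t => f t + g t).
Proof.
  intros Hf Hg t eps He.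
  destruct (Hf t (eps / 2)%R ltac:(lra)) as [d [Hd Hd']].
  destruct (Hg t (eps / 2)%R ltac:(lra)) as [e [He' He'']].
  exists (Rmin d e); split; [now apply Rmin_pos|]; intros s Hs.
  specialize (Hd' s (Rlt_le_trans _ _ _ Hs (Rmin_l _ _))).
  specialize (He'' s (Rlt_le_trans _ _ _ Hs (Rmin_r _ _))).
  replace (f s + g s - (f t + g t)) with ((f s - f t) + (g s - g t)) by ring.
  eapply Rle_lt_trans; [apply Cmod_triangle|]; lra.
Qed.

Lemma path_continuous_scal (k : C) (f : R -> C) : path_continuous f ->
  path_continuous (fun t => k * f t).
Proof.
  intros Hf t eps He. pose proof (Cmod_ge_0 k).
  destruct (Hf t (eps / (Cmod k + 1))%R ltac:(apply Rdiv_lt_0_compat; lra)) as [d [Hd Hd']].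
  exists d; split; [easy|]; intros s Hs; specialize (Hd' s Hs).
  replace (k * f s - k * f t) with (k * (f s - f t)) by ring.
  rewrite Cmod_mult.
  assert (eps = (eps / (Cmod k + 1)) * (Cmod k + 1))%R by (field; lra).
  pose proof (Cmod_ge_0 (f s - f t)). nra.
Qed.

Lemma CInt_ext (f g : R -> C) (a b : R) :
  (forall t, f t = g t) -> CInt f a b = CInt g a b.
Proof.
  intros H; unfold CInt; f_equal; apply RInt_ext; intros; now rewrite H.
Qed.

Lemma CInt_Chasles (f : R -> C) (a b c : R) : path_continuous f ->
  CInt f a b + CInt f b c = CInt f a c.
Proof.
  intros H.
  destruct (path_continuous_ex_RInt f a b H), (path_continuous_ex_RInt f b c H).
  apply injective_projections.
  - exact (RInt_Chasles (V := R_CompleteNormedModule) (fun t => Re (f t)) a b c ltac:(easy) ltac:(easy)).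
  - exact (RInt_Chasles (V := R_CompleteNormedModule) (fun t => Im (f t)) a b c ltac:(easy) ltac:(easy)).
Qed.

Lemma CInt_plus (f g : R -> C) (a b : R) : path_continuous f ->
  path_continuous g -> CInt (fun t => f t + g t) a b = CInt f a b + CInt g a b.
Proof.
  intros Hf Hg.
  destruct (path_continuous_ex_RInt f a b Hf), (path_continuous_ex_RInt g a b Hg).
  apply injective_projections.
  - exact (RInt_plus (V := R_CompleteNormedModule) (fun t => Re (f t)) (fun t => Re (g t)) a b ltac:(easy) ltac:(easy)).
  - exact (RInt_plus (V := R_CompleteNormedModule) (fun t => Im (f t)) (fun t => Im (g t)) a b ltac:(easy) ltac:(easy)).
Qed.

Lemma CInt_scal (k : C) (f : R -> C) (a b : R) : path_continuous f ->
  CInt (fun t => k * f t) a b = k * CInt f a b.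
Proof.
  intros Hf; destruct (path_continuous_ex_RInt f a b Hf) as [H1 H2].
  unfold CInt, Cmult at 3; simpl.
  f_equal.
  - rewrite (RInt_ext _ (fun t => minus (scal (Re k) (Re (f t))) (scal (Im k) (Im (f t))))).
    2:{ intros; destruct k, (f x); reflexivity. }
    rewrite (RInt_minus (V := R_CompleteNormedModule)) by now apply (ex_RInt_scal (V := R_NormedModule)).
    rewrite !(RInt_scal (V := R_CompleteNormedModule)) by easy. reflexivity.
  - rewrite (RInt_ext _ (fun t => plus (scal (Re k) (Im (f t))) (scal (Im k) (Re (f t))))).
    2:{ intros; destruct k, (f x); reflexivity. }
    rewrite (RInt_plus (V := R_CompleteNormedModule)) by now apply (ex_RInt_scal (V := R_NormedModule)).
    rewrite !(RInt_scal (V := R_CompleteNormedModule)) by easy. reflexivity.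
Qed.

(** The real and imaginary parts are bounded separately, which costs the factor 2 that reappears in
    [Cauchy_estimate]. *)
Lemma CInt_bound (f : R -> C) (a b M : R) : path_continuous f -> (a <= b)%R ->
  (forall t, (a <= t <= b)%R -> (Cmod (f t) <= M)%R) ->
  (Cmod (CInt f a b) <= 2 * (b - a) * M)%R.
Proof.
  intros Hf Hab HM; destruct (path_continuous_ex_RInt f a b Hf) as [H1 H2].
  eapply Rle_trans; [apply Cmod_le_Rabs|]; unfold CInt; simpl.
  assert (Rabs (RInt (fun t => Re (f t)) a b) <= (b - a) * M)%R.
  { apply abs_RInt_le_const; try easy; intros t Ht.
    eapply Rle_trans; [apply re_le_Cmod|auto]. }
  assert (Rabs (RInt (fun t => Im (f t)) a b) <= (b - a) * M)%R.
  { apply abs_RInt_le_const; try easy; intros t Ht.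
    eapply Rle_trans; [apply Im_le_Cmod|auto]. }
  lra.
Qed.

Lemma RInt_affine (p q a b : R) :
  RInt (fun x => p * x + q)%R a b = (p * (b * b - a * a) / 2 + q * (b - a))%R.
Proof.
  apply is_RInt_unique.
  replace (p * (b * b - a * a) / 2 + q * (b - a))%R with
    (minus (p * (b * b) / 2 + q * b) (p * (a * a) / 2 + q * a))%R
    by (unfold minus, plus, opp; simpl; field).
  apply (is_RInt_derive (V := R_CompleteNormedModule)
    (fun x => p * (x * x) / 2 + q * x)%R (fun x => p * x + q)%R).
  - intros x _; auto_derive; [easy|field].
  - intros x _. apply (ex_derive_continuous (V := R_NormedModule)).
    auto_derive; easy.
Qed.

(** * Cauchy's theorem on rectangles *)

(** Boundary integral taken counterclockwise: lower, right, upper, left side. *)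
Definition rect_integral (h : C -> C) (a b c d : R) : C :=
  CInt (fun x => h (x, c)) a b + Ci * CInt (fun y => h (b, y)) c d
  - CInt (fun x => h (x, d)) a b - Ci * CInt (fun y => h (a, y)) c d.

Definition Ccontinuous (h : C -> C) : Prop :=
  forall a eps, (0 < eps)%R -> exists del, (0 < del)%R /\
    forall z, (Cmod (z - a) < del)%R -> (Cmod (h z - h a) < eps)%R.

Lemma entire_continuous (h : C -> C) : entire h -> Ccontinuous h.
Proof. intros H a; destruct (H a) as [l Hl]; exact (Cderiv_continuous h a l Hl). Qed.

Lemma path_continuous_horizontal (h : C -> C) (y : R) : Ccontinuous h ->
  path_continuous (fun x => h (x, y)).
Proof.
  intros H t eps He; destruct (H (t, y) eps He) as [d [Hd Hd']].
  exists d; split; [easy|]; intros s Hs; apply Hd'.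
  eapply Rle_lt_trans; [apply Cmod_le_Rabs|]; simpl.
  replace (y + - y)%R with 0%R by ring; rewrite Rabs_R0; unfold Rminus in Hs; lra.
Qed.

Lemma path_continuous_vertical (h : C -> C) (x : R) : Ccontinuous h ->
  path_continuous (fun y => h (x, y)).
Proof.
  intros H t eps He; destruct (H (x, t) eps He) as [d [Hd Hd']].
  exists d; split; [easy|]; intros s Hs; apply Hd'.
  eapply Rle_lt_trans; [apply Cmod_le_Rabs|]; simpl.
  replace (x + - x)%R with 0%R by ring; rewrite Rabs_R0; unfold Rminus in Hs; lra.
Qed.

(** Allows Goursat's argument to discard the tangent part of the integrand. *)
Lemma rect_integral_affine (m n : C) (a b c d : R) :
  rect_integral (fun z => m * z + n) a b c d = 0.
Proof.
  destruct m as [m1 m2], n as [n1 n2].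
  unfold rect_integral, CInt; simpl.
  rewrite (RInt_ext (fun x => m1 * x - m2 * c + n1)%R (fun x => m1 * x + (n1 - m2 * c))%R) by (intros; simpl; ring).
  rewrite (RInt_ext (fun x => m1 * x - m2 * d + n1)%R (fun x => m1 * x + (n1 - m2 * d))%R) by (intros; simpl; ring).
  rewrite (RInt_ext (fun x => m1 * c + m2 * x + n2)%R (fun x => m2 * x + (n2 + m1 * c))%R) by (intros; simpl; ring).
  rewrite (RInt_ext (fun x => m1 * d + m2 * x + n2)%R (fun x => m2 * x + (n2 + m1 * d))%R) by (intros; simpl; ring).
  rewrite (RInt_ext (fun x => m1 * b - m2 * x + n1)%R (fun x => (- m2) * x + (n1 + m1 * b))%R) by (intros; simpl; ring).
  rewrite (RInt_ext (fun x => m1 * a - m2 * x + n1)%R (fun x => (- m2) * x + (n1 + m1 * a))%R) by (intros; simpl; ring).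
  rewrite (RInt_ext (fun x => m1 * x + m2 * b + n2)%R (fun x => m1 * x + (n2 + m2 * b))%R) by (intros; simpl; ring).
  rewrite (RInt_ext (fun x => m1 * x + m2 * a + n2)%R (fun x => m1 * x + (n2 + m2 * a))%R) by (intros; simpl; ring).
  rewrite !RInt_affine.
  apply injective_projections; simpl; field.
Qed.

Lemma rect_integral_plus (f g : C -> C) (a b c d : R) :
  Ccontinuous f -> Ccontinuous g ->
  rect_integral (fun z => f z + g z) a b c d =
  rect_integral f a b c d + rect_integral g a b c d.
Proof.
  intros Hf Hg; unfold rect_integral.
  rewrite !CInt_plus by (apply path_continuous_horizontal + apply path_continuous_vertical; easy).
  ring.
Qed.

Lemma rect_integral_split_x (h : C -> C) (a m b c d : R) : Ccontinuous h ->
  rect_integral h a b c d = rect_integral h a m c d + rect_integral h m b c d.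
Proof.
  intros H; unfold rect_integral.
  rewrite <- (CInt_Chasles (fun x => h (x, c)) a m b) by now apply path_continuous_horizontal.
  rewrite <- (CInt_Chasles (fun x => h (x, d)) a m b) by now apply path_continuous_horizontal.
  ring.
Qed.

Lemma rect_integral_split_y (h : C -> C) (a b c m d : R) : Ccontinuous h ->
  rect_integral h a b c d = rect_integral h a b c m + rect_integral h a b m d.
Proof.
  intros H; unfold rect_integral.
  rewrite <- (CInt_Chasles (fun x => h (a, x)) c m d) by now apply path_continuous_vertical.
  rewrite <- (CInt_Chasles (fun x => h (b, x)) c m d) by now apply path_continuous_vertical.
  ring.
Qed.

Lemma rect_integral_bound (h : C -> C) (a b c d M : R) : Ccontinuous h ->
  (a <= b)%R -> (c <= d)%R ->
  (forall x y, (a <= x <= b)%R -> (c <= y <= d)%R -> (Cmod (h (x, y)) <= M)%R) ->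
  (Cmod (rect_integral h a b c d) <= 4 * ((b - a) + (d - c)) * M)%R.
Proof.
  intros H Hab Hcd HM; unfold rect_integral.
  assert (B1 := CInt_bound (fun x => h (x, c)) a b M (path_continuous_horizontal h c H) Hab
    ltac:(intros; apply HM; lra)).
  assert (B2 := CInt_bound (fun x => h (x, d)) a b M (path_continuous_horizontal h d H) Hab
    ltac:(intros; apply HM; lra)).
  assert (B3 := CInt_bound (fun x => h (a, x)) c d M (path_continuous_vertical h a H) Hcd
    ltac:(intros; apply HM; lra)).
  assert (B4 := CInt_bound (fun x => h (b, x)) c d M (path_continuous_vertical h b H) Hcd
    ltac:(intros; apply HM; lra)).
  unfold Cminus.
  eapply Rle_trans; [apply Cmod_triangle|].
  eapply Rle_trans; [apply Rplus_le_compat_r; eapply Rle_trans;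
    [apply Cmod_triangle|apply Rplus_le_compat_r; apply Cmod_triangle]|].
  rewrite !Cmod_opp, !Cmod_mult, Cmod_Ci. lra.
Qed.

(** The integrals over the four quarters add up to the whole, so one of them has at least a quarter
    of its modulus. *)
Lemma rect_integral_bisect (h : C -> C) (a b c d : R) : Ccontinuous h ->
  (a <= b)%R -> (c <= d)%R ->
  exists a' b' c' d', (a <= a' <= b' /\ b' <= b)%R /\ (c <= c' <= d' /\ d' <= d)%R /\
    (b' - a' = (b - a) / 2)%R /\ (d' - c' = (d - c) / 2)%R /\
    (Cmod (rect_integral h a b c d) <= 4 * Cmod (rect_integral h a' b' c' d'))%R.
Proof.
  intros H Hab Hcd.
  set (m := ((a + b) / 2)%R). set (n := ((c + d) / 2)%R).
  assert (E : rect_integral h a b c d =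
    (rect_integral h a m c n + rect_integral h a m n d) +
    (rect_integral h m b c n + rect_integral h m b n d)).
  { rewrite (rect_integral_split_x h a m b) by easy.
    rewrite (rect_integral_split_y h a m c n d), (rect_integral_split_y h m b c n d) by easy.
    reflexivity. }
  assert (T : (Cmod (rect_integral h a b c d) <=
    Cmod (rect_integral h a m c n) + Cmod (rect_integral h a m n d) +
    (Cmod (rect_integral h m b c n) + Cmod (rect_integral h m b n d)))%R).
  { rewrite E. eapply Rle_trans; [apply Cmod_triangle|].
    apply Rplus_le_compat; apply Cmod_triangle. }
  set (I := Cmod (rect_integral h a b c d)) in *.
  destruct (Rle_dec I (4 * Cmod (rect_integral h a m c n))) as [L|L1];
    [exists a, m, c, n; unfold m, n in *; repeat split; lra|].
  destruct (Rle_dec I (4 * Cmod (rect_integral h a m n d))) as [L|L2];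
    [exists a, m, n, d; unfold m, n in *; repeat split; lra|].
  destruct (Rle_dec I (4 * Cmod (rect_integral h m b c n))) as [L|L3];
    [exists m, b, c, n; unfold m, n in *; repeat split; lra|].
  exists m, b, n, d; unfold m, n in *; repeat split; lra.
Qed.

Lemma nested_intervals (a b : nat -> R) :
  (forall n, (a n <= a (S n) <= b (S n) /\ b (S n) <= b n)%R) ->
  exists x, forall n, (a n <= x <= b n)%R.
Proof.
  intros H.
  assert (Ha : forall n m, (n <= m)%nat -> (a n <= a m)%R).
  { intros n m L; induction L; [lra|]. specialize (H m); lra. }
  assert (Hb : forall n m, (n <= m)%nat -> (b m <= b n)%R).
  { intros n m L; induction L; [lra|]. specialize (H m); lra. }
  assert (Hab : forall n m, (a n <= b m)%R).
  { intros n m. pose proof (H (max n m)) as H1.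
    pose proof (Ha n (S (max n m)) ltac:(lia)). pose proof (Hb m (S (max n m)) ltac:(lia)). lra. }
  destruct (completeness (fun y => exists n, y = a n)) as [x [Hx1 Hx2]].
  - exists (b O); intros y [n ->]; auto.
  - exists (a O); now exists O.
  - exists x; intros n; split.
    + apply Hx1; now exists n.
    + apply Hx2; intros y [m ->]; auto.
Qed.

Theorem Cauchy_rectangle (h : C -> C) (a b c d : R) : entire h ->
  (a <= b)%R -> (c <= d)%R -> rect_integral h a b c d = 0.
Proof.
  intros He Hab Hcd.
  assert (Hc := entire_continuous h He).
  (* Rectangles are bundled with their inequalities, so that bisection becomes a function on [Q]
     that can be iterated. *)
  set (Q := { q : R * R * R * R | (fst (fst (fst q)) <= snd (fst (fst q)))%R /\ (snd (fst q) <= snd q)%R }).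
  set (good := fun q q' : Q =>
    let '(a, b, c, d) := proj1_sig q in let '(a', b', c', d') := proj1_sig q' in
    (a <= a' <= b' /\ b' <= b)%R /\ (c <= c' <= d' /\ d' <= d)%R /\
    (b' - a' = (b - a) / 2)%R /\ (d' - c' = (d - c) / 2)%R /\
    (Cmod (rect_integral h a b c d) <= 4 * Cmod (rect_integral h a' b' c' d'))%R).
  assert (Hstep : forall q, exists q', good q q').
  { intros [[[[a0 b0] c0] d0] [L1 L2]]; simpl in L1, L2.
    destruct (rect_integral_bisect h a0 b0 c0 d0 Hc L1 L2) as (a' & b' & c' & d' & H).
    assert (L : (a' <= b')%R /\ (c' <= d')%R) by lra.
    exists (exist _ (a', b', c', d') L). exact H. }
  set (step := fun q => proj1_sig (constructive_indefinite_description _ (Hstep q))).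
  assert (Hstep' : forall q, good q (step q))
    by (intros q; unfold step; now destruct (constructive_indefinite_description _ (Hstep q))).
  set (q0 := exist _ (a, b, c, d) (conj Hab Hcd) : Q).
  set (q := fun n => Nat.iter n step q0).
  set (qa := fun n => fst (fst (fst (proj1_sig (q n))))).
  set (qb := fun n => snd (fst (fst (proj1_sig (q n))))).
  set (qc := fun n => snd (fst (proj1_sig (q n)))).
  set (qd := fun n => snd (proj1_sig (q n))).
  assert (Hq : forall n,
    (qa n <= qa (S n) <= qb (S n) /\ qb (S n) <= qb n)%R /\
    (qc n <= qc (S n) <= qd (S n) /\ qd (S n) <= qd n)%R /\
    (qb (S n) - qa (S n) = (qb n - qa n) / 2)%R /\ (qd (S n) - qc (S n) = (qd n - qc n) / 2)%R /\
    (Cmod (rect_integral h (qa n) (qb n) (qc n) (qd n)) <=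
      4 * Cmod (rect_integral h (qa (S n)) (qb (S n)) (qc (S n)) (qd (S n))))%R).
  { intros n. specialize (Hstep' (q n)).
    unfold good in Hstep'. change (step (q n)) with (q (S n)) in Hstep'.
    unfold qa, qb, qc, qd.
    destruct (proj1_sig (q n)) as [[[? ?] ?] ?], (proj1_sig (q (S n))) as [[[? ?] ?] ?].
    exact Hstep'. }
  destruct (nested_intervals qa qb ltac:(intros n; apply Hq)) as [x Hx].
  destruct (nested_intervals qc qd ltac:(intros n; apply Hq)) as [y Hy].
  set (S0 := ((b - a) + (d - c))%R).
  assert (Hsize : forall n, ((qb n - qa n) + (qd n - qc n) = S0 / 2 ^ n)%R /\
    (Cmod (rect_integral h a b c d) <= 4 ^ n * Cmod (rect_integral h (qa n) (qb n) (qc n) (qd n)))%R).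
  { induction n as [|n [IH1 IH2]].
    - change (qa 0%nat) with a; change (qb 0%nat) with b; change (qc 0%nat) with c; change (qd 0%nat) with d.
      unfold S0; simpl; split; [field|lra].
    - destruct (Hq n) as (_ & _ & E1 & E2 & E3). split.
      + rewrite E1, E2. simpl.
        replace (S0 / (2 * 2 ^ n))%R with (S0 / 2 ^ n / 2)%R by (field; apply pow_nonzero; lra).
        rewrite <- IH1; field.
      + simpl. assert (0 < 4 ^ n)%R by (apply pow_lt; lra). nra. }
  destruct (He (x, y)) as [l Hl].
  (* At level [n] the side lengths add up to [S0 / 2 ^ n] and the remainder is at most
     [eps * (S0 / 2 ^ n)]; the factor [4 ^ n] from the bisections cancels both powers of 2. *)
  apply (Ceq_of_arbitrarily_close _ _ (4 * S0 * S0)).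
  intros eps Heps; destruct (Hl eps Heps) as [del [Hdel Hl']].
  assert (HS0 : (0 <= S0)%R) by (unfold S0; lra).
  assert (Hn : exists n, (S0 / 2 ^ n < del)%R).
  { destruct (pow_lt_1_zero (/ 2) ltac:(rewrite Rabs_pos_eq; lra) (del / (S0 + 1)) ltac:(apply Rdiv_lt_0_compat; lra)) as [n Hn].
    exists n; specialize (Hn n (Nat.le_refl n)).
    rewrite pow_inv in Hn. rewrite Rabs_pos_eq in Hn by (left; apply Rinv_0_lt_compat, pow_lt; lra).
    unfold Rdiv at 1.
    assert (del = (del / (S0 + 1)) * (S0 + 1))%R by (field; lra).
    assert (0 < / 2 ^ n)%R by (apply Rinv_0_lt_compat, pow_lt; lra). nra. }
  destruct Hn as [n Hn]; destruct (Hsize n) as [E1 E2].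
  destruct (Hq n) as ((? & ?) & (? & ?) & _).
  replace (rect_integral h a b c d - 0) with (rect_integral h a b c d) by ring.
  eapply Rle_trans; [apply E2|].
  (* The remainder of [h] after its tangent at the limit point [(x, y)]; it has the same rectangle
     integrals as [h]. *)
  set (rho := fun z => h z + ((- l) * z + (l * (x, y) - h (x, y)))).
  assert (Haff : forall m k, Ccontinuous (fun z => m * z + k)).
  { intros m k; apply entire_continuous; intros u; eexists.
    apply Cderiv_plus; [apply Cderiv_mult; [apply Cderiv_const|apply Cderiv_id]|apply Cderiv_const]. }
  assert (Hrho : Ccontinuous rho).
  { apply entire_continuous; intros u. destruct (He u) as [l' Hl'']. eexists.
    apply Cderiv_plus; [exact Hl''|].
    apply Cderiv_plus; [apply Cderiv_mult; [apply Cderiv_const|apply Cderiv_id]|apply Cderiv_const]. }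
  assert (E : rect_integral h (qa n) (qb n) (qc n) (qd n) = rect_integral rho (qa n) (qb n) (qc n) (qd n)).
  { unfold rho; rewrite rect_integral_plus by auto. rewrite rect_integral_affine. ring. }
  rewrite E.
  assert (B : (Cmod (rect_integral rho (qa n) (qb n) (qc n) (qd n)) <=
     4 * ((qb n - qa n) + (qd n - qc n)) * (eps * (S0 / 2 ^ n)))%R).
  { apply rect_integral_bound; [easy|lra|lra|]. intros u v Hu Hv.
    assert (Hd : (Cmod ((u, v) - (x, y)) <= S0 / 2 ^ n)%R).
    { eapply Rle_trans; [apply Cmod_le_Rabs|]; simpl. rewrite <- E1.
      specialize (Hx n); specialize (Hy n).
      apply Rplus_le_compat; apply Rabs_le; lra. }
    assert (Hd2 : (Cmod ((u, v) - (x, y)) < del)%R) by lra.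
    specialize (Hl' (u, v) Hd2).
    replace (rho (u, v)) with (h (u, v) - h (x, y) - l * ((u, v) - (x, y))) by (unfold rho; ring).
    eapply Rle_trans; [apply Hl'|]. apply Rmult_le_compat_l; lra. }
  rewrite E1 in B.
  eapply Rle_trans; [apply Rmult_le_compat_l; [apply pow_le; lra|apply B]|].
  right.
  replace (4 ^ n)%R with (2 ^ n * 2 ^ n)%R by (rewrite <- Rpow_mult_distr; f_equal; lra).
  field. apply pow_nonzero; lra.
Qed.

(** * Cauchy's estimate *)

Definition Cexp (z : C) : C := (exp (Re z) * cos (Im z), exp (Re z) * sin (Im z))%R.

Lemma Cexp_plus (z w : C) : Cexp (z + w) = Cexp z * Cexp w.
Proof.
  destruct z as [x y], w as [u v]; unfold Cexp; simpl. rewrite exp_plus, cos_plus, sin_plus.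
  apply injective_projections; simpl; ring.
Qed.

Lemma Cmod_Cexp (z : C) : Cmod (Cexp z) = exp (Re z).
Proof.
  unfold Cmod, Cexp; simpl fst; simpl snd.
  replace ((exp (Re z) * cos (Im z)) ^ 2 + (exp (Re z) * sin (Im z)) ^ 2)%R
    with (Rsqr (exp (Re z))).
  - apply sqrt_Rsqr; left; apply exp_pos.
  - pose proof (sin2_cos2 (Im z)) as E. unfold Rsqr in *. nra.
Qed.

Lemma Cexp_opp (z : C) : Cexp z * Cexp (- z) = 1.
Proof.
  rewrite <- Cexp_plus. replace (z + - z) with (RtoC 0) by ring.
  unfold Cexp; simpl. rewrite exp_0, cos_0, sin_0.
  apply injective_projections; simpl; ring.
Qed.

Lemma real_increment (f : R -> R) (x l : R) : is_derive f x l ->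
  forall eps, (0 < eps)%R -> exists del, (0 < del)%R /\
    forall h, (Rabs h < del)%R -> (Rabs (f (x + h)%R - f x - l * h) <= eps * Rabs h)%R.
Proof.
  intros H eps He. apply is_derive_Reals in H.
  destruct (H eps He) as [d Hd]; exists d; split; [apply cond_pos|]; intros h Hh.
  destruct (Req_dec h 0) as [->|Hn].
  - rewrite Rplus_0_r, Rmult_0_r, Rabs_R0, Rmult_0_r, Rminus_diag, Rminus_0_r, Rabs_R0; lra.
  - specialize (Hd h Hn Hh).
    replace (f (x + h) - f x - l * h)%R with (((f (x + h) - f x) / h - l) * h)%R by (field; easy).
    rewrite Rabs_mult. apply Rmult_le_compat_r; [apply Rabs_pos|lra].
Qed.

(** Obtained from the real derivatives of exp, cos and sin at 0; the addition law then carries it to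
    every point. *)
Lemma Cderiv_Cexp_0 : Cderiv Cexp 0 1.
Proof.
  intros eps0 He0.
  (* The error terms below add up to at most [9 * eps * Cmod z]. The bound [1 / 2] serves to
     estimate [exp x - 1] by [2 * eps]. *)
  set (eps := Rmin (eps0 / 12) (1 / 2)).
  assert (He : (0 < eps)%R) by (apply Rmin_pos; lra).
  assert (He1 : (eps <= eps0 / 12)%R) by apply Rmin_l.
  assert (He2 : (eps <= 1 / 2)%R) by apply Rmin_r.
  destruct (real_increment exp 0 1 ltac:(apply is_derive_Reals; rewrite <- exp_0; apply derivable_pt_lim_exp) eps He) as [d1 [Hd1 E1]].
  destruct (real_increment cos 0 0 ltac:(apply is_derive_Reals; pose proof (derivable_pt_lim_cos 0) as D; rewrite sin_0, Ropp_0 in D; exact D) eps He) as [d2 [Hd2 E2]].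
  destruct (real_increment sin 0 1 ltac:(apply is_derive_Reals; rewrite <- cos_0; apply derivable_pt_lim_sin) eps He) as [d3 [Hd3 E3]].
  exists (Rmin (Rmin d1 d2) (Rmin d3 eps)); split; [apply Rmin_pos; apply Rmin_pos; easy|].
  intros z Hz. replace (z - 0) with z in * by ring.
  assert (Hx := re_le_Cmod z). assert (Hy := Im_le_Cmod z).
  pose proof (Rmin_l (Rmin d1 d2) (Rmin d3 eps)). pose proof (Rmin_r (Rmin d1 d2) (Rmin d3 eps)).
  pose proof (Rmin_l d1 d2). pose proof (Rmin_r d1 d2).
  pose proof (Rmin_l d3 eps). pose proof (Rmin_r d3 eps).
  destruct z as [x y]; simpl in Hx, Hy.
  specialize (E1 x ltac:(lra)). specialize (E2 y ltac:(lra)). specialize (E3 y ltac:(lra)).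
  rewrite Rplus_0_l in E1, E2, E3. rewrite exp_0 in E1; rewrite cos_0 in E2; rewrite sin_0 in E3.
  assert (Hex : (Rabs (exp x) <= 3)%R).
  { rewrite Rabs_pos_eq by (left; apply exp_pos). eapply Rle_trans; [|apply exp_le_3].
    pose proof (Rle_abs x).
    destruct (Rle_lt_or_eq_dec x 1 ltac:(lra)) as [Hlt| ->]; [left; now apply exp_increasing|lra]. }
  eapply Rle_trans; [apply Cmod_le_Rabs|].
  unfold Cexp; simpl. rewrite exp_0, cos_0, sin_0.
  match goal with |- (Rabs ?u + Rabs ?v <= _)%R =>
    replace u with (exp x * (cos y - 1 - 0 * y) + (exp x - 1 - 1 * x))%R by ring;
    replace v with (exp x * (sin y - 0 - 1 * y) + ((exp x - 1 - 1 * x) + x) * y)%R by ring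
  end.
  pose proof (Rabs_triang (exp x * (cos y - 1 - 0 * y)) (exp x - 1 - 1 * x)) as T1.
  pose proof (Rabs_triang (exp x * (sin y - 0 - 1 * y)) (((exp x - 1 - 1 * x) + x) * y)) as T2.
  pose proof (Rabs_triang (exp x - 1 - 1 * x) x) as T3.
  rewrite Rabs_mult in T1. rewrite !Rabs_mult in T2.
  set (A := Rabs (exp x - 1 - 1 * x)) in *. set (B := Rabs (exp x)) in *.
  set (A2 := Rabs (cos y - 1 - 0 * y)) in *. set (A3 := Rabs (sin y - 0 - 1 * y)) in *.
  set (A4 := Rabs (exp x - 1 - 1 * x + x)) in *.
  pose proof (Rabs_pos x); pose proof (Rabs_pos y).
  assert (0 <= A2)%R by apply Rabs_pos. assert (0 <= A3)%R by apply Rabs_pos.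
  assert (B * A2 <= 3 * (eps * Rabs y))%R by (apply Rmult_le_compat; try easy; apply Rabs_pos).
  assert (B * A3 <= 3 * (eps * Rabs y))%R by (apply Rmult_le_compat; try easy; apply Rabs_pos).
  assert (A4 * Rabs y <= (2 * eps) * Rabs y)%R by (apply Rmult_le_compat_r; nra).
  set (M := Cmod (x, y)) in *. nra.
Qed.

Lemma Cderiv_Cexp (a : C) : Cderiv Cexp a (Cexp a).
Proof.
  apply Cderiv_ext with (fun z => Cexp a * Cexp (z - a)).
  { intros z; rewrite <- Cexp_plus; f_equal; ring. }
  replace (Cderiv (fun z => Cexp a * Cexp (z - a)) a (Cexp a)) with
    (Cderiv (fun z => Cexp a * Cexp (z - a)) a (0 * Cexp (a - a) + Cexp a * (1 * (1 - 0))))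
    by (f_equal; ring).
  apply (Cderiv_mult (fun _ => Cexp a) (fun z => Cexp (z - a))); [apply Cderiv_const|].
  apply (Cderiv_comp Cexp (fun z => z - a)).
  - replace (a - a) with (RtoC 0) by ring. apply Cderiv_Cexp_0.
  - apply Cderiv_minus; [apply Cderiv_id|apply Cderiv_const].
Qed.

(** Under z = a + exp zeta the Cauchy integrand g(z) dz / (z - a)^2 becomes this function times d
    zeta. Circles about [a] turn into vertical segments, where the rectangle theorem applies. *)
Lemma entire_comp_Cexp (g : C -> C) (a : C) : entire g ->
  entire (fun z => g (a + Cexp z) * Cexp (- z)).
Proof.
  intros Hg z. destruct (Hg (a + Cexp z)) as [l Hl]. eexists.
  apply (Cderiv_mult (fun z => g (a + Cexp z)) (fun z => Cexp (- z))).
  - apply (Cderiv_comp g (fun z => a + Cexp z)); [exact Hl|].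
    apply Cderiv_plus; [apply Cderiv_const|apply Cderiv_Cexp].
  - apply (Cderiv_comp Cexp (fun z => - z)); [apply Cderiv_Cexp|].
    apply Cderiv_ext with (fun z => (- (1)) * z); [intros; ring|].
    apply (Cderiv_mult (fun _ => - (1)) (fun z => z)); [apply Cderiv_const|apply Cderiv_id].
Qed.

(** Here [s] is the logarithm of the radius, and the constant factor i of d zeta is left out. *)
Definition circle_integral (g : C -> C) (a : C) (s : R) : C :=
  CInt (fun t => g (a + Cexp (s, t)) * Cexp (- (s, t))) 0 (2 * PI).

(** The integrand has period 2 pi i, so the horizontal sides of the rectangle cancel and the
    vertical ones must agree. *)
Lemma circle_integral_const (g : C -> C) (a : C) (s s' : R) : entire g ->
  (s <= s')%R -> circle_integral g a s = circle_integral g a s'.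
Proof.
  intros Hg Hs. unfold circle_integral.
  assert (HPI : (0 <= 2 * PI)%R) by (pose proof PI_RGT_0; lra).
  pose proof (Cauchy_rectangle _ s s' 0 (2 * PI) (entire_comp_Cexp g a Hg) Hs HPI) as E.
  unfold rect_integral in E.
  rewrite (CInt_ext (fun x => g (a + Cexp (x, (2 * PI)%R)) * Cexp (- (x, (2 * PI)%R)))
    (fun x => g (a + Cexp (x, 0%R)) * Cexp (- (x, 0%R)))) in E.
  2:{ intros x. unfold Cexp; simpl.
      rewrite !cos_neg, !sin_neg, cos_2PI, sin_2PI, cos_0, sin_0. reflexivity. }
  (* Multiplying the vanishing rectangle integral by [- Ci] isolates the difference of the vertical
     sides. *)
  match type of E with ?A + Ci * ?B - ?A - Ci * ?D = _ =>
    replace B with ((- Ci) * (A + Ci * B - A - Ci * D) + D) end.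
  - rewrite E; ring.
  - match goal with |- - Ci * (?A + Ci * ?B - ?A - Ci * ?D) + ?D = _ =>
      transitivity (- (Ci * Ci) * (B - D) + D); [ring|] end.
    replace (Ci * Ci) with (- (1)) by (apply injective_projections; simpl; ring). ring.
Qed.

(** The radius may be shrunk. On a small circle g(a + exp zeta) is g(a) + l exp zeta up to a small
    error; after multiplication by exp(-zeta) the first term integrates to 0 over a period and the
    second to 2 pi l. *)
Lemma circle_integral_derive (g : C -> C) (a l : C) (s : R) : entire g ->
  Cderiv g a l -> circle_integral g a s = 2 * PI * l.
Proof.
  intros Hg Hl.
  pose proof PI_RGT_0 as HPI.
  apply (Ceq_of_arbitrarily_close _ _ (4 * PI)).
  intros eps He; destruct (Hl eps He) as [d [Hd Hd']].
  (* A radius below [d], and at most the given one so that [circle_integral_const] applies. *)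
  set (s' := Rmin s (ln (d / 2))).
  rewrite <- (circle_integral_const g a s' s Hg (Rmin_l _ _)).
  assert (Hs' : (exp s' < d)%R).
  { apply Rle_lt_trans with (d / 2)%R; [|lra].
    rewrite <- (exp_ln (d / 2)) by lra.
    destruct (Rle_lt_or_eq_dec _ _ (Rmin_r s (ln (d / 2)))) as [H|H];
      [left; now apply exp_increasing | unfold s'; rewrite H; lra]. }
  assert (Hexp : entire (fun z => Cexp (- z))).
  { intros z; eexists. apply (Cderiv_comp Cexp (fun z => - z)); [apply Cderiv_Cexp|].
    apply Cderiv_ext with (fun z => (- (1)) * z); [intros; ring|].
    apply (Cderiv_mult (fun _ => - (1)) (fun z => z)); [apply Cderiv_const|apply Cderiv_id]. }
  assert (Pexp : path_continuous (fun t => Cexp (- (s', t)))).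
  { exact (path_continuous_vertical _ s' (entire_continuous _ Hexp)). }
  assert (Ph : path_continuous (fun t => g (a + Cexp (s', t)) * Cexp (- (s', t)))).
  { exact (path_continuous_vertical _ s' (entire_continuous _ (entire_comp_Cexp g a Hg))). }
  assert (Pc : forall k : C, path_continuous (fun _ => k)).
  { intros k t e He'; exists 1%R; split; [lra|]; intros.
    replace (k - k) with (RtoC 0) by ring. rewrite Cmod_0; easy. }
  assert (E1 : CInt (fun t => Cexp (- (s', t))) 0 (2 * PI) = 0).
  { unfold CInt, Cexp; simpl. apply injective_projections; simpl.
    - etransitivity.
      + apply is_RInt_unique, (is_RInt_derive (V := R_CompleteNormedModule) (fun x => - (exp (- s') * sin (- x)))%R).
        * intros; auto_derive; [easy|ring].
        * intros; apply (ex_derive_continuous (V := R_NormedModule)); auto_derive; easy.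
      + rewrite !sin_neg, sin_2PI, sin_0. unfold minus, plus, opp; simpl; ring.
    - etransitivity.
      + apply is_RInt_unique, (is_RInt_derive (V := R_CompleteNormedModule) (fun x => exp (- s') * cos (- x))%R).
        * intros; auto_derive; [easy|ring].
        * intros; apply (ex_derive_continuous (V := R_NormedModule)); auto_derive; easy.
      + rewrite !cos_neg, cos_2PI, cos_0. unfold minus, plus, opp; simpl; ring. }
  assert (E2 : CInt (fun _ => l) 0 (2 * PI) = 2 * PI * l).
  { unfold CInt. rewrite !RInt_const. destruct l.
    apply injective_projections; simpl; unfold scal; simpl; unfold mult; simpl; ring. }
  assert (E3 : circle_integral g a s' - 2 * PI * l =
    CInt (fun t => g (a + Cexp (s', t)) * Cexp (- (s', t)) + (- g a * Cexp (- (s', t)) + (- (1)) * l)) 0 (2 * PI)).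
  { rewrite CInt_plus; [|easy|apply path_continuous_plus; [now apply path_continuous_scal|apply path_continuous_scal; apply Pc]].
    rewrite CInt_plus; [|now apply path_continuous_scal|apply path_continuous_scal; apply Pc].
    rewrite !CInt_scal by auto.
    rewrite E1, E2. unfold circle_integral. ring. }
  rewrite E3.
  replace (4 * PI * eps)%R with (2 * (2 * PI - 0) * eps)%R by ring.
  apply CInt_bound; [|lra|].
  { apply path_continuous_plus; [easy|]; apply path_continuous_plus; apply path_continuous_scal; auto. }
  intros t _.
  pose proof (Cmod_Cexp (s', t)) as M. simpl in M.
  specialize (Hd' (a + Cexp (s', t))).
  replace (a + Cexp (s', t) - a) with (Cexp (s', t)) in Hd' by ring.
  rewrite M in Hd'. specialize (Hd' Hs').
  pose proof (Cexp_opp (s', t)) as E.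
  replace (g (a + Cexp (s', t)) * Cexp (- (s', t)) + (- g a * Cexp (- (s', t)) + - (1) * l))
    with ((g (a + Cexp (s', t)) - g a - l * Cexp (s', t)) * Cexp (- (s', t))).
  2:{ transitivity (g (a + Cexp (s', t)) * Cexp (- (s', t)) - g a * Cexp (- (s', t)) - l * (Cexp (s', t) * Cexp (- (s', t)))); [ring|].
      rewrite E; ring. }
  rewrite Cmod_mult, (Cmod_Cexp (- (s', t))). simpl Re.
  assert (Hinv : (exp s' * exp (- s') = 1)%R) by (rewrite <- exp_plus, Rplus_opp_r; apply exp_0).
  pose proof (exp_pos (- s')).
  apply Rle_trans with (eps * exp s' * exp (- s'))%R; [apply Rmult_le_compat_r; lra|].
  right; rewrite Rmult_assoc, Hinv; ring.
Qed.

Theorem Cauchy_estimate (g : C -> C) (a l : C) (r M : R) : entire g ->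
  Cderiv g a l -> (0 < r)%R ->
  (forall z, Cmod (z - a) = r -> (Cmod (g z) <= M)%R) ->
  (Cmod l <= 2 * M / r)%R.
Proof.
  intros Hg Hl Hr HM. pose proof PI_RGT_0 as HPI.
  pose proof (circle_integral_derive g a l (ln r) Hg Hl) as E.
  assert (B : (Cmod (circle_integral g a (ln r)) <= 2 * (2 * PI - 0) * (M / r))%R).
  { apply CInt_bound; [|lra|].
    - exact (path_continuous_vertical _ _ (entire_continuous _ (entire_comp_Cexp g a Hg))).
    - intros t _. rewrite Cmod_mult, (Cmod_Cexp (- (ln r, t))). simpl Re.
      rewrite exp_Ropp, exp_ln by easy. unfold Rdiv.
      apply Rmult_le_compat_r; [left; now apply Rinv_0_lt_compat|].
      apply HM. replace (a + Cexp (ln r, t) - a) with (Cexp (ln r, t)) by ring.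
      rewrite Cmod_Cexp; simpl. now apply exp_ln. }
  rewrite E, !Cmod_mult, !Cmod_R, (Rabs_pos_eq 2), (Rabs_pos_eq PI) in B by lra.
  replace (2 * M / r)%R with (2 * (M / r))%R by (field; lra).
  nra.
Qed.

(** * Polynomials *)

Fixpoint peval (c : nat -> C) (n : nat) (z : C) : C :=
  match n with
  | O => c O
  | S m => peval c m z + c (S m) * z ^ S m
  end.

Lemma peval_ext (c c' : nat -> C) (n : nat) (z : C) :
  (forall j, (j <= n)%nat -> c j = c' j) -> peval c n z = peval c' n z.
Proof.
  induction n as [|n IH]; intros H; simpl; [now apply H|].
  rewrite IH, (H (S n)) by auto; easy.
Qed.

Lemma peval_plus (c c' : nat -> C) (n : nat) (z : C) :
  peval (fun j => c j + c' j) n z = peval c n z + peval c' n z.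
Proof. induction n as [|n IH]; simpl; [easy|rewrite IH; ring]. Qed.

Lemma peval_scal (k : C) (c : nat -> C) (n : nat) (z : C) :
  peval (fun j => k * c j) n z = k * peval c n z.
Proof. induction n as [|n IH]; simpl; [easy|rewrite IH; ring]. Qed.

Lemma peval_dilate (k : C) (c : nat -> C) (n : nat) (z : C) :
  peval c n (k * z) = peval (fun j => c j * k ^ j) n z.
Proof.
  induction n as [|n IH]; [simpl; ring|].
  cbn [peval]. rewrite IH, Cpow_mult_l; ring.
Qed.

Lemma peval_0 (c : nat -> C) (n : nat) : peval c n 0 = c O.
Proof. induction n as [|n IH]; simpl; [easy|rewrite IH; ring]. Qed.

Lemma peval_high_zero (c : nat -> C) (n m : nat) (z : C) : (n <= m)%nat ->
  (forall j, (n < j <= m)%nat -> c j = 0) -> peval c m z = peval c n z.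
Proof.
  intros L; induction L as [|m L IH]; intros H; [easy|].
  simpl. rewrite IH, (H (S m)) by (intros; try apply H; lia). ring.
Qed.

Lemma peval_pad (c : nat -> C) (n m : nat) : (n <= m)%nat ->
  exists c', forall z, peval c' m z = peval c n z.
Proof.
  intros L; exists (fun j => if (j <=? n)%nat then c j else 0); intros z.
  rewrite (peval_high_zero _ n m) by
    (try easy; intros j [Hj _]; now rewrite (proj2 (Nat.leb_gt _ _) Hj)).
  apply peval_ext; intros j Hj; now rewrite (proj2 (Nat.leb_le _ _) Hj).
Qed.

Lemma peval_monomial (k : C) (m n : nat) (z : C) : (m <= n)%nat ->
  peval (fun j => if (j =? m)%nat then k else 0) n z = k * z ^ m.
Proof.
  intros L. rewrite (peval_high_zero _ m n z L).
  2:{ intros j [Hj _]; destruct (Nat.eqb_spec j m); [lia|easy]. }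
  destruct m as [|m]; [simpl; ring|].
  cbn [peval]. rewrite Nat.eqb_refl.
  rewrite (peval_ext _ (fun _ => 0 * 0)).
  - rewrite peval_scal; ring.
  - intros j Hj; destruct (Nat.eqb_spec j (S m)); [lia|ring].
Qed.

(** [P] plays the role of a linear subspace of functions of a parameter; in the applications these
    are null functions, convergent sequences, or polynomials in the other variable. *)
Lemma peval_closed {X : Type} (P : (X -> C) -> Prop) :
  (forall f g, P f -> P g -> P (fun x => f x + g x)) ->
  (forall k f, P f -> P (fun x => k * f x)) ->
  forall n (A : nat -> X -> C) z, (forall j, (j <= n)%nat -> P (A j)) ->
  P (fun x => peval (fun j => A j x) n z).
Proof.
  intros Hp Hs n A z; induction n as [|n IH]; intros H; simpl; [now apply H|].
  apply (Hp (fun x => peval (fun j => A j x) n z)); [apply IH; auto|].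
  replace (fun x => A (S n) x * (z * z ^ n)) with (fun x => z ^ S n * A (S n) x)
    by (apply functional_extensionality; intros; simpl; ring).
  apply Hs; auto.
Qed.

Lemma pow2_neq (j n : nat) : (j < n)%nat -> RtoC 2 ^ j - RtoC 2 ^ n <> 0.
Proof.
  intros H E. rewrite <- !RtoC_pow in E. apply (f_equal Re) in E. simpl in E.
  assert (2 ^ j < 2 ^ n)%R by (apply Rlt_pow; [lra|easy]). lra.
Qed.

(** The dilation [p(z) -> p(2z) - 2^n p(z)] kills the coefficient of [z^n], so
    every coefficient is a linear combination of values of [p]. *)
Lemma peval_coefficients {X : Type} (P : (X -> C) -> Prop) :
  (forall f g, P f -> P g -> P (fun x => f x + g x)) ->
  (forall k f, P f -> P (fun x => k * f x)) ->
  forall n (A : nat -> X -> C),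
  (forall z : C, z <> 0 -> P (fun x => peval (fun j => A j x) n z)) ->
  forall j, (j <= n)%nat -> P (A j).
Proof.
  intros Hp Hs.
  assert (H2 : RtoC 2 <> 0) by (intros E; apply RtoC_inj in E; lra).
  assert (H1 : RtoC 1 <> 0) by (intros E; apply RtoC_inj in E; lra).
  induction n as [|n IH]; intros A H.
  { intros j Hj; replace j with O by lia. exact (H 1 H1). }
  assert (HA : forall j, (j <= n)%nat -> P (A j)).
  { intros j Hj.
    set (B := fun j x => (RtoC 2 ^ j - RtoC 2 ^ S n) * A j x).
    assert (HB : P (B j)).
    { apply (IH B); [|easy]. intros z Hz.
      replace (fun x => peval (fun j => B j x) n z) with
        (fun x => peval (fun j => A j x) (S n) (2 * z) + (- RtoC 2 ^ S n) * peval (fun j => A j x) (S n) z).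
      - apply Hp; [|apply Hs]; apply H; [|easy].
        now apply Cmult_neq_0.
      - apply functional_extensionality; intros x. rewrite peval_dilate.
        rewrite <- peval_scal, <- peval_plus. cbn [peval].
        rewrite (peval_ext _ (fun j => B j x)) by (intros; unfold B; ring).
        ring. }
    replace (A j) with (fun x => / (RtoC 2 ^ j - RtoC 2 ^ S n) * B j x); [now apply Hs|].
    apply functional_extensionality; intros x; unfold B. field. apply pow2_neq; lia. }
  intros j Hj. destruct (Nat.eq_dec j (S n)) as [ ->|Hn]; [|apply HA; lia].
  replace (A (S n)) with (fun x => peval (fun j => A j x) (S n) 1 + (- (1)) * peval (fun j => A j x) n 1).
  - apply Hp; [now apply H|]. apply Hs. now apply peval_closed.
  - apply functional_extensionality; intros x. cbn [peval]. rewrite Cpow_1_l. ring.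
Qed.

(** Agreement is asked only off 0, because the coordinate lines through the origin are missing among
    the slices of W. *)
Lemma peval_unique (c c' : nat -> C) (n : nat) :
  (forall z : C, z <> 0 -> peval c n z = peval c' n z) ->
  forall j, (j <= n)%nat -> c j = c' j.
Proof.
  intros H j Hj.
  assert (E : c j + (- (1)) * c' j = 0).
  { apply (peval_coefficients (X := unit) (fun f => f tt = 0)) with
      (n := n) (A := fun j _ => c j + (- (1)) * c' j); [| |intros z Hz|easy].
    - intros f g -> ->; ring.
    - intros k f ->; ring.
    - rewrite peval_plus, peval_scal, (H z Hz). ring. }
  replace (c j) with (c j + - (1) * c' j + c' j) by ring. rewrite E; ring.
Qed.

Lemma Cderiv_pow (n : nat) (a : C) : Cderiv (fun z => z ^ S n) a (RtoC (INR (S n)) * a ^ n).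
Proof.
  induction n as [|n IH].
  - apply Cderiv_ext with (fun z => z); [intros; ring|].
    replace (RtoC (INR 1) * a ^ 0) with (RtoC 1) by (simpl; ring). apply Cderiv_id.
  - replace (RtoC (INR (S (S n))) * a ^ S n) with (1 * a ^ S n + a * (RtoC (INR (S n)) * a ^ n)).
    + exact (Cderiv_mult (fun z => z) (fun z => z ^ S n) a _ _ (Cderiv_id a) IH).
    + rewrite (S_INR (S n)), RtoC_plus. simpl Cpow; ring.
Qed.

Lemma Cderiv_peval (c : nat -> C) (n : nat) (a : C) :
  Cderiv (peval c (S n)) a (peval (fun j => RtoC (INR (S j)) * c (S j)) n a).
Proof.
  induction n as [|n IH].
  - apply Cderiv_ext with (fun z => c O + c 1%nat * z); [intros; simpl; ring|].
    replace (peval (fun j => RtoC (INR (S j)) * c (S j)) 0 a) with (0 + (0 * a + c 1%nat * 1)) by (simpl; ring).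
    apply (Cderiv_plus (fun _ => c O)); [apply Cderiv_const|].
    apply (Cderiv_mult (fun _ => c 1%nat) (fun z => z)); [apply Cderiv_const|apply Cderiv_id].
  - change (peval c (S (S n))) with (fun z => peval c (S n) z + c (S (S n)) * z ^ S (S n)).
    replace (peval (fun j => RtoC (INR (S j)) * c (S j)) (S n) a) with
      (peval (fun j => RtoC (INR (S j)) * c (S j)) n a + (0 * a ^ S (S n) + c (S (S n)) * (RtoC (INR (S (S n))) * a ^ S n))).
    + apply Cderiv_plus; [exact IH|].
      apply (Cderiv_mult (fun _ => c (S (S n))) (fun z => z ^ S (S n))); [apply Cderiv_const|apply Cderiv_pow].
    + cbn [peval]; ring.
Qed.

(** * Entire functions of polynomial growth are polynomials *)

(** The real mean value theorem for t -> Re (g (z + t h)) on the unit interval. *)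
Lemma Re_increment (g g' : C -> C) (z h : C) (K : R) :
  (forall a, Cderiv g a (g' a)) ->
  (forall t, (0 <= t <= 1)%R -> (Cmod (g' (z + RtoC t * h)%C) <= K)%R) ->
  (Rabs (Re (g (z + h)%C) - Re (g z)) <= Cmod h * K)%R.
Proof.
  intros Hg HK.
  set (u := fun t : R => Re (g (z + RtoC t * h))).
  assert (Hd : forall t, derivable_pt_lim u t (Re (g' (z + RtoC t * h) * h))).
  { intros t eps He. pose proof (Cmod_ge_0 h) as Hh.
    destruct (Hg (z + RtoC t * h) (eps / (2 * (Cmod h + 1)))%R ltac:(apply Rdiv_lt_0_compat; lra)) as [d [Hd Hd']].
    exists (mkposreal (d / (Cmod h + 1)) ltac:(apply Rdiv_lt_0_compat; lra)); simpl.
    intros s Hs Hs'. unfold u.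
    specialize (Hd' (z + RtoC (t + s) * h)).
    replace (z + RtoC (t + s) * h - (z + RtoC t * h)) with (RtoC s * h) in Hd' by (rewrite RtoC_plus; ring).
    rewrite Cmod_mult, Cmod_R in Hd'.
    assert (Hlt : (Rabs s * Cmod h < d)%R).
    { assert (d = d / (Cmod h + 1) * (Cmod h + 1))%R by (field; lra).
      pose proof (Rabs_pos s). pose proof (Rabs_pos_lt s Hs). nra. }
    specialize (Hd' Hlt).
    pose proof (re_le_Cmod (g (z + RtoC (t + s) * h) - g (z + RtoC t * h) - g' (z + RtoC t * h) * (RtoC s * h))) as L.
    set (w := g (z + RtoC (t + s) * h)) in *. set (v := g (z + RtoC t * h)) in *. set (l := g' (z + RtoC t * h)) in *.
    replace (Re (w - v - l * (RtoC s * h))) with (((Re w - Re v) / s - Re (l * h)) * s)%R in L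
      by (destruct w, v, l, h; simpl; field; easy).
    rewrite Rabs_mult in L.
    assert (Hs0 := Rabs_pos_lt s Hs).
    apply Rmult_lt_reg_r with (Rabs s); [easy|].
    eapply Rle_lt_trans; [apply L|]. eapply Rle_lt_trans; [apply Hd'|].
    assert (Ee : (eps = eps / (2 * (Cmod h + 1)) * (2 * (Cmod h + 1)))%R) by (field; lra).
    set (e := (eps / (2 * (Cmod h + 1)))%R) in *.
    assert (0 < e)%R by (apply Rdiv_lt_0_compat; lra).
    rewrite Ee. nra. }
  destruct (MVT_cor2 u (fun t => Re (g' (z + RtoC t * h) * h)) 0 1 Rlt_0_1 (fun t _ => Hd t)) as [t [E Ht]].
  unfold u in E. replace (z + RtoC 1 * h) with (z + h) in E by ring.
  replace (z + RtoC 0 * h) with z in E by ring.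
  rewrite E, Rminus_0_r, Rmult_1_r.
  eapply Rle_trans; [apply re_le_Cmod|]. rewrite Cmod_mult, Rmult_comm.
  apply Rmult_le_compat_l; [apply Cmod_ge_0|apply HK; lra].
Qed.

(** [Re_increment] is applied to [g] and to [- Ci * g], whose real part is the imaginary part of
    [g]; hence the factor 2. *)
Lemma Cmod_increment (g g' : C -> C) (z h : C) (K : R) :
  (forall a, Cderiv g a (g' a)) ->
  (forall t, (0 <= t <= 1)%R -> (Cmod (g' (z + RtoC t * h)%C) <= K)%R) ->
  (Cmod (g (z + h)%C - g z)%C <= 2 * Cmod h * K)%R.
Proof.
  intros Hg HK.
  pose proof (Re_increment g g' z h K Hg HK) as H1.
  assert (H2 : (Rabs (Re ((- Ci) * g (z + h)%C) - Re ((- Ci) * g z)) <= Cmod h * K)%R).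
  { apply (Re_increment (fun z => - Ci * g z) (fun z => 0 * g z + - Ci * g' z)).
    - intros a. apply (Cderiv_mult (fun _ => - Ci) g); [apply Cderiv_const|apply Hg].
    - intros t Ht. replace (0 * g (z + RtoC t * h) + - Ci * g' (z + RtoC t * h)) with (- Ci * g' (z + RtoC t * h)) by ring.
      rewrite Cmod_mult, Cmod_opp, Cmod_Ci, Rmult_1_l; auto. }
  eapply Rle_trans; [apply Cmod_le_Rabs|].
  destruct (g (z + h)) as [x y], (g z) as [x' y']; simpl in *.
  replace (- (0) * x - - (1) * y - (- (0) * x' - - (1) * y'))%R with (y + - y')%R in H2 by ring.
  unfold Rminus in H1. lra.
Qed.

Definition seq_limit (u : nat -> C) (l : C) : Prop :=
  forall eps, (0 < eps)%R -> exists N, forall m, (N <= m)%nat -> (Cmod (u m - l) < eps)%R.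

Lemma seq_limit_plus (u v : nat -> C) (l k : C) : seq_limit u l -> seq_limit v k ->
  seq_limit (fun m => u m + v m) (l + k).
Proof.
  intros Hu Hv eps He.
  destruct (Hu (eps / 2)%R ltac:(lra)) as [N HN]. destruct (Hv (eps / 2)%R ltac:(lra)) as [N' HN'].
  exists (max N N'); intros m Hm. specialize (HN m ltac:(lia)). specialize (HN' m ltac:(lia)).
  replace (u m + v m - (l + k)) with ((u m - l) + (v m - k)) by ring.
  eapply Rle_lt_trans; [apply Cmod_triangle|]; lra.
Qed.

Lemma seq_limit_scal (k : C) (u : nat -> C) (l : C) : seq_limit u l ->
  seq_limit (fun m => k * u m) (k * l).
Proof.
  intros Hu eps He. pose proof (Cmod_ge_0 k).
  destruct (Hu (eps / (Cmod k + 1))%R ltac:(apply Rdiv_lt_0_compat; lra)) as [N HN].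
  exists N; intros m Hm; specialize (HN m Hm).
  replace (k * u m - k * l) with (k * (u m - l)) by ring. rewrite Cmod_mult.
  assert (eps = eps / (Cmod k + 1) * (Cmod k + 1))%R by (field; lra).
  pose proof (Cmod_ge_0 (u m - l)). nra.
Qed.

Lemma seq_limit_unique (u : nat -> C) (l k : C) : seq_limit u l -> seq_limit u k -> l = k.
Proof.
  intros Hu Hk; apply (Ceq_of_arbitrarily_close _ _ 2); intros eps He.
  destruct (Hu eps He) as [N HN]. destruct (Hk eps He) as [N' HN'].
  specialize (HN (max N N') ltac:(lia)). specialize (HN' (max N N') ltac:(lia)).
  replace (l - k) with ((u (max N N') - k) - (u (max N N') - l)) by ring.
  unfold Cminus at 1. eapply Rle_trans; [apply Cmod_triangle|]. rewrite Cmod_opp. lra.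
Qed.

Lemma seq_limit_peval (A : nat -> nat -> C) (l : nat -> C) (n : nat) (z : C) :
  (forall j, (j <= n)%nat -> seq_limit (A j) (l j)) ->
  seq_limit (fun m => peval (fun j => A j m) n z) (peval l n z).
Proof.
  induction n as [|n IH]; intros H; simpl; [now apply H|].
  apply seq_limit_plus; [apply IH; auto|].
  replace (fun m => A (S n) m * (z * z ^ n)) with (fun m => z ^ S n * A (S n) m)
    by (apply functional_extensionality; intros; simpl; ring).
  rewrite (Cmult_comm (l (S n))). apply seq_limit_scal; auto.
Qed.

Lemma Cderiv_seq_limit (g : C -> C) (z l : C) : Cderiv g z l ->
  seq_limit (fun m => / RtoC (/ INR (S m)) * (g (z + RtoC (/ INR (S m))) - g z)) l.
Proof.
  intros H eps He. destruct (H (eps / 2)%R ltac:(lra)) as [d [Hd Hd']].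
  destruct (archimed_cor1 d Hd) as [N [HN HN0]].
  exists N; intros m Hm.
  assert (Hm0 : (0 < / INR (S m))%R) by (apply Rinv_0_lt_compat, lt_0_INR; lia).
  assert (Hlt : (/ INR (S m) < d)%R).
  { eapply Rle_lt_trans; [|apply HN]. apply Rinv_le_contravar; [now apply lt_0_INR|apply le_INR; lia]. }
  set (h := (/ INR (S m))%R) in *.
  assert (Hh : RtoC h <> 0) by (intros E; apply RtoC_inj in E; lra).
  specialize (Hd' (z + RtoC h)). replace (z + RtoC h - z) with (RtoC h) in Hd' by ring.
  rewrite Cmod_R, Rabs_pos_eq in Hd' by lra. specialize (Hd' Hlt).
  replace (/ RtoC h * (g (z + RtoC h) - g z) - l) with (/ RtoC h * (g (z + RtoC h) - g z - l * RtoC h)) by (field; easy).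
  rewrite Cmod_mult, Cmod_inv, Cmod_R, Rabs_pos_eq by (easy || lra).
  apply Rle_lt_trans with (/ h * (eps / 2 * h))%R.
  - apply Rmult_le_compat_l; [left; now apply Rinv_0_lt_compat|easy].
  - replace (/ h * (eps / 2 * h))%R with (eps / 2)%R by (field; lra). lra.
Qed.

(** Induction on the growth exponent. By Cauchy's estimate the derivative grows one degree less,
    hence so does each difference g(z + h) - g(z); these are visibly entire, so the induction
    hypothesis makes them polynomials of degree at most n. Their quotients by h = 1 / (m + 1)
    converge to g', and so do their coefficients, since these are fixed linear combinations of
    values. Thus g' is a polynomial, and g is its antiderivative. *)
Theorem Liouville_polynomial (n : nat) (g : C -> C) (K : R) : entire g ->
  (forall z, (Cmod (g z) <= K * (1 + Cmod z) ^ n)%R) ->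
  exists c, forall z, g z = peval c n z.
Proof.
  revert g K; induction n as [|n IH]; intros g K Hg HK;
  assert (Hg' : exists g', forall a, Cderiv g a (g' a))
    by (exists (fun a => proj1_sig (constructive_indefinite_description _ (Hg a)));
        intros a; apply proj2_sig);
  destruct Hg' as [g' Hg'].
  - assert (Z : forall a, g' a = 0).
    { intros a. apply (Ceq_of_arbitrarily_close _ _ (2 * K)). intros eps He.
      replace (g' a - 0) with (g' a) by ring.
      replace (2 * K * eps)%R with (2 * K / (/ eps))%R by (field; lra).
      apply (Cauchy_estimate g a); [easy|apply Hg'|now apply Rinv_0_lt_compat|].
      intros z _. specialize (HK z). simpl in HK. lra. }
    exists (fun _ => g 0); intros z; simpl.
    pose proof (Cmod_increment g g' 0 z 0 Hg' ltac:(intros; rewrite Z, Cmod_0; lra)) as E.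
    apply (Ceq_of_arbitrarily_close _ _ 0). intros eps _.
    replace (0 + z) with z in E by ring. lra.
  - assert (HK0 : (0 <= K)%R).
    { specialize (HK 0). rewrite Cmod_0, Rplus_0_r, pow1 in HK. pose proof (Cmod_ge_0 (g 0)). lra. }
    assert (B' : forall a, (Cmod (g' a) <= (2 * K * 2 ^ S n) * (1 + Cmod a) ^ n)%R).
    { intros a. pose proof (Cmod_ge_0 a) as Ha. set (r := (1 + Cmod a)%R) in *.
      assert (Hr : (0 < r)%R) by (unfold r; lra).
      (* On the circle of radius r = 1 + |a| about a, one has 1 + |z| <= 2 r. *)
      replace (2 * K * 2 ^ S n * r ^ n)%R with (2 * (K * (2 * r) ^ S n) / r)%R
        by (rewrite Rpow_mult_distr; simpl; field; lra).
      apply (Cauchy_estimate g a); [easy|apply Hg'|easy|].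
      intros z Hz. eapply Rle_trans; [apply HK|].
      apply Rmult_le_compat_l; [easy|]. apply pow_incr.
      pose proof (Cmod_ge_0 z). pose proof (Cmod_triangle_minus z a).
      split; [lra|]. rewrite Hz in *. unfold r in *; lra. }
    assert (D : forall h, exists c, forall z, g (z + h) - g z = peval c n z).
    { intros h. apply (IH (fun z => g (z + h) - g z) (2 * Cmod h * (2 * K * 2 ^ S n * (1 + Cmod h) ^ n))%R).
      - intros a. destruct (Hg (a + h)) as [l1 H1]. destruct (Hg a) as [l2 H2].
        eexists; apply Cderiv_minus; [|exact H2].
        apply (Cderiv_comp g (fun z => z + h)); [exact H1|].
        apply Cderiv_plus; [apply Cderiv_id|apply Cderiv_const].
      - intros z.
        replace (2 * Cmod h * (2 * K * 2 ^ S n * (1 + Cmod h) ^ n) * (1 + Cmod z) ^ n)%R with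
          (2 * Cmod h * (2 * K * 2 ^ S n * ((1 + Cmod h) * (1 + Cmod z)) ^ n))%R
          by (rewrite Rpow_mult_distr; ring).
        apply (Cmod_increment g g'); [easy|]. intros t Ht.
        eapply Rle_trans; [apply B'|]. apply Rmult_le_compat_l.
        { apply Rmult_le_pos; [lra|apply pow_le; lra]. }
        apply pow_incr. pose proof (Cmod_ge_0 (z + RtoC t * h)). split; [lra|].
        pose proof (Cmod_triangle z (RtoC t * h)) as T. rewrite Cmod_mult, Cmod_R, (Rabs_pos_eq t) in T by lra.
        pose proof (Cmod_ge_0 h). pose proof (Cmod_ge_0 z). nra. }
    assert (Hc : exists c : nat -> nat -> C, forall m z, g (z + RtoC (/ INR (S m))) - g z = peval (c m) n z).
    { exists (fun m => proj1_sig (constructive_indefinite_description _ (D (RtoC (/ INR (S m)))))).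
      intros m; apply proj2_sig. }
    destruct Hc as [c Hc].
    set (A := fun j m => / RtoC (/ INR (S m)) * c m j).
    assert (HA : forall z, (fun m => peval (fun j => A j m) n z) =
      fun m => / RtoC (/ INR (S m)) * (g (z + RtoC (/ INR (S m))) - g z)).
    { intros z; apply functional_extensionality; intros m. unfold A. rewrite peval_scal, Hc; easy. }
    assert (L : forall j, (j <= n)%nat -> exists l, seq_limit (A j) l).
    { apply (peval_coefficients (fun u => exists l, seq_limit u l)).
      - intros u v [l Hl] [k Hk]; exists (l + k); now apply seq_limit_plus.
      - intros k u [l Hl]; exists (k * l); now apply seq_limit_scal.
      - intros z _. rewrite HA. exists (g' z). now apply Cderiv_seq_limit. }
    assert (L' : exists l : nat -> C, forall j, (j <= n)%nat -> seq_limit (A j) (l j)).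
    { exists (fun j => epsilon (inhabits (RtoC 0)) (seq_limit (A j))).
      intros j Hj; apply epsilon_spec; auto. }
    destruct L' as [l Hl].
    assert (E : forall z, g' z = peval l n z).
    { intros z. apply (seq_limit_unique (fun m => peval (fun j => A j m) n z)).
      - rewrite HA. now apply Cderiv_seq_limit.
      - now apply seq_limit_peval. }
    (* The termwise antiderivative of [g'] that agrees with [g] at 0; the difference has derivative
       0 and is therefore constant. *)
    set (q := fun j => match j with O => g 0 | S i => / RtoC (INR (S i)) * l i end).
    exists q. intros z.
    assert (Hq : forall a, Cderiv (peval q (S n)) a (g' a)).
    { intros a. rewrite E.
      rewrite (peval_ext l (fun j => RtoC (INR (S j)) * q (S j))); [apply Cderiv_peval|].
      intros j _. unfold q. field. intros E0. apply RtoC_inj in E0. now apply not_0_INR in E0. }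
    pose proof (Cmod_increment (fun z => g z - peval q (S n) z) (fun a => g' a - g' a) 0 z 0) as F.
    assert (F' := F ltac:(intros; now apply Cderiv_minus) ltac:(intros; right; rewrite <- Cmod_0; f_equal; ring)).
    cbv beta in F'. rewrite peval_0 in F'. replace (0 + z) with z in F' by ring.
    apply (Ceq_of_arbitrarily_close _ _ 0). intros eps _.
    replace (g z - peval q (S n) z - (g 0 - q O)) with (g z - peval q (S n) z) in F' by (unfold q; ring).
    lra.
Qed.

(** * Triangular contractions *)

(** Common shape of all five types of contraction, and of their inverses. *)
Definition tri (a b : C) (k : nat) (d : C) (p : C2) : C2 :=
  (a * fst p + b * snd p ^ k, d * snd p).

(** The exponent [k] puts w^k on the same footing as z, so that a small [e] absorbs the shear b w^k
    of a triangular contraction. *)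
Definition wnorm (e : R) (k : nat) (p : C2) : R :=
  (e * Cmod (fst p) + Cmod (snd p) ^ k)%R.

Lemma inW_alt (p : C2) : inW p <-> fst p <> 0 \/ snd p <> 0.
Proof.
  unfold inW; destruct p as [z w]; simpl; split.
  - intros H. destruct (excluded_middle_informative (z = 0)) as [->|Hz]; [|now left].
    right; intros ->; now apply H.
  - intros [H|H] E; injection E; auto.
Qed.

Lemma wnorm_pos (e : R) (k : nat) (p : C2) : (0 < e)%R -> inW p -> (0 < wnorm e k p)%R.
Proof.
  intros He Hp; apply inW_alt in Hp; unfold wnorm.
  pose proof (Cmod_ge_0 (fst p)). pose proof (pow_le _ k (Cmod_ge_0 (snd p))).
  destruct Hp as [Hp|Hp]; apply Cmod_gt_0 in Hp; [nra|].
  pose proof (pow_lt _ k Hp). nra.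
Qed.

Lemma wnorm_inW (e : R) (k : nat) (p : C2) : (1 <= k)%nat -> (0 < wnorm e k p)%R -> inW p.
Proof.
  intros Hk H E; subst p; unfold wnorm in H; simpl in H.
  rewrite Cmod_0 in H. destruct k; [lia|]. simpl in H. lra.
Qed.

(** The upper bound expresses contraction; the lower one keeps a single step from jumping across the
    compact shell used in [growth]. *)
Lemma tri_contracts (a b : C) (k : nat) (d : C) :
  (0 < Cmod a < 1)%R -> (0 < Cmod d < 1)%R -> (1 <= k)%nat ->
  exists e rho rho' : R, (0 < e)%R /\ (0 < rho < 1)%R /\ (0 < rho')%R /\
    forall p, (rho' * wnorm e k p <= wnorm e k (tri a b k d p) <= rho * wnorm e k p)%R.
Proof.
  intros Ha Hd Hk.
  pose proof (Cmod_ge_0 b) as Hb.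
  (* Chosen so that the shear adds at most (1 - |d|) / 2 to the coefficient |d|^k <= |d| of |w|^k,
     leaving at most (1 + |d|) / 2. *)
  set (e := ((1 - Cmod d) / (2 * (Cmod b + 1)))%R).
  assert (He : (0 < e)%R) by (apply Rdiv_lt_0_compat; lra).
  assert (Heb : (e * Cmod b <= (1 - Cmod d) / 2)%R).
  { assert ((1 - Cmod d) / 2 = e * (Cmod b + 1))%R by (unfold e; field; lra). nra. }
  assert (Hdk : (0 < Cmod d ^ k <= Cmod d)%R).
  { split; [apply pow_lt; lra|]. destruct k as [|k]; [lia|]. simpl.
    assert (Cmod d ^ k <= 1)%R by (rewrite <- (pow1 k); apply pow_incr; lra). nra. }
  (* Solving for z and w in terms of the image bounds the norm by [M] times the norm of the image;
     [M] is the sum of the two coefficients that occur. *)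
  set (M := (/ Cmod a + (e * Cmod b / Cmod a + 1) / Cmod d ^ k)%R).
  assert (Ha' : (0 < / Cmod a)%R) by (apply Rinv_0_lt_compat; lra).
  assert (Hd' : (0 < / Cmod d ^ k)%R) by (apply Rinv_0_lt_compat; lra).
  assert (Hba : (0 <= e * Cmod b / Cmod a)%R) by (unfold Rdiv; apply Rmult_le_pos; nra).
  assert (HM : (0 < M)%R) by (unfold M, Rdiv at 1; nra).
  exists e, (Rmax (Cmod a) ((1 + Cmod d) / 2)), (/ M)%R; repeat split; try easy.
  - eapply Rlt_le_trans; [|apply Rmax_l]; lra.
  - apply Rmax_lub_lt; lra.
  - now apply Rinv_0_lt_compat.
  - apply Rmult_le_reg_l with M; [easy|].
    rewrite <- Rmult_assoc, Rinv_r, Rmult_1_l by lra.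
    unfold wnorm, tri; simpl. rewrite Cmod_mult, Rpow_mult_distr.
    set (w := (Cmod (snd p) ^ k)%R).
    assert (Hw : (0 <= w)%R) by (apply pow_le, Cmod_ge_0).
    set (z' := a * fst p + b * snd p ^ k).
    assert (Hz : (Cmod (fst p) <= / Cmod a * (Cmod z' + Cmod b * w))%R).
    { assert (E : (Cmod a * Cmod (fst p) <= Cmod z' + Cmod b * w)%R).
      { rewrite <- Cmod_mult. unfold w. rewrite <- Cmod_pow, <- Cmod_mult.
        replace (a * fst p) with (z' + - (b * snd p ^ k)) by (unfold z'; ring).
        eapply Rle_trans; [apply Cmod_triangle|]. rewrite Cmod_opp. lra. }
      apply Rmult_le_reg_l with (Cmod a); [easy|].
      rewrite <- Rmult_assoc, Rinv_r, Rmult_1_l by lra. exact E. }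
    set (w' := (Cmod d ^ k * w)%R).
    assert (Ew : w = (/ Cmod d ^ k * w')%R) by (unfold w'; field; lra).
    assert (Hw' : (0 <= w')%R) by (unfold w'; nra).
    pose proof (Cmod_ge_0 z') as Hz'.
    assert (Hz2 : (e * Cmod (fst p) <= e * (/ Cmod a * (Cmod z' + Cmod b * w)))%R) by (apply Rmult_le_compat_l; lra).
    apply Rle_trans with (/ Cmod a * (e * Cmod z') + (e * Cmod b / Cmod a + 1) / Cmod d ^ k * w')%R.
    + rewrite Ew in Hz2 |- *. unfold Rdiv.
      replace (e * (/ Cmod a * (Cmod z' + Cmod b * (/ Cmod d ^ k * w'))))%R with
        (/ Cmod a * (e * Cmod z') + e * Cmod b * / Cmod a * / Cmod d ^ k * w')%R in Hz2 by ring.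
      lra.
    + unfold M. assert (0 <= (e * Cmod b / Cmod a + 1) / Cmod d ^ k)%R by (unfold Rdiv at 1; nra).
      assert (0 <= e * Cmod z')%R by nra. nra.
  - unfold wnorm, tri; simpl. rewrite Cmod_mult, Rpow_mult_distr.
    set (w := (Cmod (snd p) ^ k)%R).
    assert (Hw : (0 <= w)%R) by (apply pow_le, Cmod_ge_0).
    pose proof (Cmod_triangle (a * fst p) (b * snd p ^ k)) as T.
    rewrite !Cmod_mult, Cmod_pow in T. fold w in T.
    pose proof (Rmax_l (Cmod a) ((1 + Cmod d) / 2)). pose proof (Rmax_r (Cmod a) ((1 + Cmod d) / 2)).
    set (r := Rmax (Cmod a) ((1 + Cmod d) / 2)) in *.
    pose proof (Cmod_ge_0 (fst p)) as Hz.
    assert (Hz2 : (e * Cmod (a * fst p + b * snd p ^ k) <= e * (Cmod a * Cmod (fst p) + Cmod b * w))%R) by (apply Rmult_le_compat_l; lra).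
    assert (Cmod a * (e * Cmod (fst p)) <= r * (e * Cmod (fst p)))%R by (apply Rmult_le_compat_r; nra).
    assert ((e * Cmod b + Cmod d ^ k) * w <= r * w)%R by (apply Rmult_le_compat_r; lra).
    lra.
Qed.

(** * Growth of functions that are quasi-invariant under a contraction *)

Definition continuous_on_W (h : C2 -> C) : Prop :=
  forall p, inW p -> forall eps, (0 < eps)%R -> exists del, (0 < del)%R /\
    forall q, (Cmod (fst q - fst p) < del)%R -> (Cmod (snd q - snd p) < del)%R ->
    (Cmod (h q - h p) < eps)%R.

(** Compactness of a box in R^4 containing the shell. The box also contains the origin, where [h] is
    uncontrolled, so the origin receives a neighbourhood that misses the shell. *)
Lemma bounded_on_shell (h : C2 -> C) (e : R) (k : nat) (eta : R) :
  continuous_on_W h -> (0 < e)%R -> (1 <= k)%nat -> (0 < eta)%R ->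
  exists M, forall p, (eta <= wnorm e k p <= 1)%R -> (Cmod (h p) <= M)%R.
Proof.
  intros Hh He Hk Heta.
  set (pt := fun t : Compactness.Tn 4 R => ((fst t, fst (snd t)), (fst (snd (snd t)), fst (snd (snd (snd t))))) : C2).
  (* If both coordinates have modulus below [d0], the norm is at most [(e + 1) * d0], hence below
     [eta]. *)
  set (d0 := Rmin (1 / 4) (eta / (4 * (e + 1)))).
  assert (Hd0 : (0 < d0)%R) by (apply Rmin_pos; [lra|apply Rdiv_lt_0_compat; lra]).
  assert (Hdel : forall t, exists del, (0 < del)%R /\
    ((forall q, (Cmod (fst q - fst (pt t)) < del)%R -> (Cmod (snd q - snd (pt t)) < del)%R ->
       (Cmod (h q - h (pt t)) < 1)%R) \/ (pt t = (RtoC 0, RtoC 0) /\ del = d0))).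
  { intros t. destruct (excluded_middle_informative (inW (pt t))) as [W|W].
    - destruct (Hh _ W 1%R Rlt_0_1) as [del [H1 H2]]. exists del; auto.
    - exists d0; split; [easy|]. right; split; [|easy]. now apply NNPP. }
  (* Half of [del], because the compactness statement measures real coordinates and [Cmod] is
     bounded by the sum of two of them. *)
  set (delta := fun t => let (del, H) := constructive_indefinite_description _ (Hdel t) in
     mkposreal (del / 2) ltac:(destruct H; lra)).
  assert (Hdelta : forall t,
    ((forall q, (Cmod (fst q - fst (pt t)) < 2 * delta t)%R -> (Cmod (snd q - snd (pt t)) < 2 * delta t)%R ->
       (Cmod (h q - h (pt t)) < 1)%R) \/ (pt t = (RtoC 0, RtoC 0) /\ (2 * delta t = d0)%R))).
  { intros t; unfold delta. destruct (constructive_indefinite_description _ (Hdel t)) as [del [H1 H2]]; simpl.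
    replace (2 * (del / 2))%R with del by field. exact H2. }
  set (B := (/ e + 1)%R).
  assert (HB : (0 < / e)%R) by now apply Rinv_0_lt_compat.
  pose proof (NNPP _ (Compactness.compactness_list 4 (- B, (- B, (- B, (- B, tt))))%R (B, (B, (B, (B, tt)))) delta)) as [l Hl].
  assert (HM : exists M, forall t, List.In t l -> (Cmod (h (pt t)) <= M)%R).
  { clear Hl. induction l as [|t l [M IH]].
    - exists 0%R; intros t [].
    - exists (Rmax (Cmod (h (pt t))) M); intros t' [<-|H']; [apply Rmax_l|].
      eapply Rle_trans; [now apply IH|apply Rmax_r]. }
  destruct HM as [M HM]. exists (M + 1)%R.
  intros [[x y] [u v]] [P1 P2].
  assert (P1' := P1). assert (P2' := P2). unfold wnorm in P1', P2'. cbn [fst snd] in P1', P2'.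
  set (z := (x, y) : C) in *. set (w := (u, v) : C) in *.
  pose proof (Cmod_ge_0 z) as Gz. pose proof (Cmod_ge_0 w) as Gw.
  pose proof (pow_le _ k Gw) as Gwk.
  assert (Hz : (Cmod z <= B)%R).
  { assert (e * Cmod z <= 1)%R by lra. unfold B.
    assert (Cmod z = / e * (e * Cmod z))%R by (field; lra). nra. }
  assert (Hw : (Cmod w <= B)%R).
  { unfold B. assert (Cmod w <= 1)%R; [|lra].
    apply Rnot_lt_le; intros G. assert (1 ^ k < Cmod w ^ k)%R; [|rewrite pow1 in *; nra].
    destruct k as [|k]; [lia|].
    apply Rlt_le_trans with (Cmod w ^ 1)%R; [rewrite pow1; lra|]. apply Rle_pow; [lra|lia]. }
  pose proof (re_le_Cmod z). pose proof (Im_le_Cmod z). pose proof (re_le_Cmod w). pose proof (Im_le_Cmod w).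
  unfold z, w in *; simpl in *.
  destruct (Hl (x, (y, (u, (v, tt))))) as [t [Ht1 [_ Ht2]]].
  { assert (G : forall r, (Rabs r <= B -> - B <= r <= B)%R)
      by (intros r Hr; now apply Rabs_le_between).
    simpl; repeat split; apply G; lra. }
  destruct t as [t1 [t2 [t3 [t4 []]]]]. simpl in Ht2. destruct Ht2 as (C1 & C2 & C3 & C4 & _).
  set (t := (t1, (t2, (t3, (t4, tt)))) : Compactness.Tn 4 R) in *.
  assert (D1 : (Cmod ((x, y) - fst (pt t)) < 2 * delta t)%R).
  { eapply Rle_lt_trans; [apply Cmod_le_Rabs|]. unfold pt, t; simpl. unfold Rminus in *.  fold t. lra. }
  assert (D2 : (Cmod ((u, v) - snd (pt t)) < 2 * delta t)%R).
  { eapply Rle_lt_trans; [apply Cmod_le_Rabs|]. unfold pt, t; simpl. unfold Rminus in *.  fold t. lra. }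
  destruct (Hdelta t) as [E|[E1 E2]].
  - specialize (E (x, y, (u, v)) D1 D2). specialize (HM t Ht1).
    eapply Rle_trans; [apply (Cmod_triangle_minus _ (h (pt t)))|]. apply Rplus_le_compat; [exact HM|]. left; exact E.
  - exfalso. rewrite E1 in D1, D2. rewrite E2 in D1, D2. simpl fst in D1. simpl snd in D2.
    assert (Em : forall c : C, c - 0 = c) by (intros; ring). rewrite Em in D1, D2.
    assert (d0 <= 1 / 4)%R by apply Rmin_l.
    assert (L : (d0 <= eta / (4 * (e + 1)))%R) by apply Rmin_r.
    assert (Cmod (u, v) ^ k <= d0)%R.
    { destruct k as [|k]; [lia|]. simpl.
      assert (Cmod (u, v) ^ k <= 1)%R by (rewrite <- (pow1 k); apply pow_incr; lra).
      pose proof (pow_le _ k Gw). nra. }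
    assert (eta = eta / (4 * (e + 1)) * (4 * (e + 1)))%R by (field; lra).
    nra.
Qed.

(** A point of large norm is moved by [f] towards the unit shell, and each step costs a factor [L]
    but gains [rho ^ m]. The exponent is independent of [eta], only [K] depends on it: [eta] will be
    the distance of a slice from the origin, and the degree must be the same on all slices. *)
Lemma growth (f : C2 -> C2) (h : C2 -> C) (e : R) (k : nat) (rho rho' L C0 : R) (m0 : nat) :
  continuous_on_W h -> (0 < e)%R -> (1 <= k)%nat -> (0 < rho < 1)%R -> (0 < rho')%R ->
  (forall p, (rho' * wnorm e k p <= wnorm e k (f p) <= rho * wnorm e k p)%R) ->
  (0 <= L)%R -> (0 <= C0)%R ->
  (forall p, inW p -> (Cmod (h p) <= L * Cmod (h (f p)) + C0 * Cmod (snd p) ^ k)%R) ->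
  exists m, (m0 <= m)%nat /\ forall eta, (0 < eta)%R -> exists K, (0 <= K)%R /\
    forall p, (eta <= wnorm e k p)%R -> (Cmod (h p) <= K * wnorm e k p ^ m)%R.
Proof.
  intros Hh He Hk Hr Hr' Hf HL HC Hq.
  destruct (pow_lt_1_zero rho ltac:(rewrite Rabs_pos_eq; lra) (/ (2 * (L + 1))) ltac:(apply Rinv_0_lt_compat; lra)) as [m1 Hm1].
  (* [m1] gives [L * rho ^ m <= / 2]; exponent at least 1 lets the m-th power of a norm above 1
     dominate |w|^k; [m0] is a degree requested by the caller. *)
  set (m := max (max m0 m1) 1). exists m. split; [lia|].
  assert (HLm : (L * rho ^ m <= / 2)%R).
  { specialize (Hm1 m ltac:(lia)).
    assert (0 < rho ^ m)%R by (apply pow_lt; lra). rewrite Rabs_pos_eq in Hm1 by lra.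
    assert (/ 2 = / (2 * (L + 1)) * (L + 1))%R by (field; lra). nra. }
  intros eta0 Heta0.
  (* With [eta <= rho'], a point of norm above 1 has an image of norm at least [eta], to which the
     induction hypothesis applies. *)
  set (eta := Rmin (Rmin eta0 rho') 1).
  assert (Heta : (0 < eta)%R) by (apply Rmin_pos; [apply Rmin_pos; lra|lra]).
  assert (Eeta : (eta <= eta0)%R /\ (eta <= rho')%R /\ (eta <= 1)%R).
  { unfold eta. pose proof (Rmin_l (Rmin eta0 rho') 1). pose proof (Rmin_r (Rmin eta0 rho') 1).
    pose proof (Rmin_l eta0 rho'). pose proof (Rmin_r eta0 rho'). lra. }
  destruct (bounded_on_shell h e k eta Hh He Hk Heta) as [M HM].
  assert (Hem : (0 < eta ^ m)%R) by now apply pow_lt.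
  (* The first summand settles the shell; the second makes the inhomogeneous term at most half of
     the bound, the other half being [L * rho ^ m <= / 2]. *)
  set (K := (Rabs M / eta ^ m + 2 * C0)%R).
  assert (HMe : (0 <= Rabs M / eta ^ m)%R).
  { apply Rmult_le_pos; [apply Rabs_pos|left; now apply Rinv_0_lt_compat]. }
  exists K. split; [unfold K; lra|].
  assert (Main : forall n p, (eta <= wnorm e k p)%R -> (rho ^ n * wnorm e k p <= 1)%R ->
     (Cmod (h p) <= K * wnorm e k p ^ m)%R).
  { assert (Base : forall p, (eta <= wnorm e k p)%R -> (wnorm e k p <= 1)%R ->
      (Cmod (h p) <= K * wnorm e k p ^ m)%R).
    { intros p H1 H2. specialize (HM p (conj H1 H2)). pose proof (Rle_abs M).
      assert (eta ^ m <= wnorm e k p ^ m)%R by (apply pow_incr; lra).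
      assert (Rabs M = Rabs M / eta ^ m * eta ^ m)%R by (field; lra).
      unfold K. nra. }
    induction n as [|n IH]; intros p H1 H2.
    - apply Base; simpl in H2; lra.
    - destruct (Rle_dec (wnorm e k p) 1) as [H3|H3]; [now apply Base|].
      assert (H4 : (1 < wnorm e k p)%R) by lra.
      assert (Wp : inW p) by (apply (wnorm_inW e k); [easy|lra]).
      destruct (Hf p) as [F1 F2].
      assert (H5 : (eta <= wnorm e k (f p))%R) by nra.
      assert (H6 : (rho ^ n * wnorm e k (f p) <= 1)%R).
      { simpl in H2. assert (0 < rho ^ n)%R by (apply pow_lt; lra). nra. }
      specialize (IH (f p) H5 H6). specialize (Hq p Wp).
      assert (N1 : (wnorm e k (f p) ^ m <= rho ^ m * wnorm e k p ^ m)%R).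
      { rewrite <- Rpow_mult_distr. apply pow_incr. lra. }
      assert (N2 : (Cmod (snd p) ^ k <= wnorm e k p ^ m)%R).
      { apply Rle_trans with (wnorm e k p ^ 1)%R; [|apply Rle_pow; [lra|lia]].
        rewrite pow_1. unfold wnorm. pose proof (Cmod_ge_0 (fst p)). nra. }
      assert (N0 : (0 <= wnorm e k p ^ m)%R) by (apply pow_le; lra).
      assert (HK : (2 * C0 <= K)%R) by (unfold K; lra).
      set (N := (wnorm e k p ^ m)%R) in *.
      assert (K * wnorm e k (f p) ^ m <= K * (rho ^ m * N))%R by (apply Rmult_le_compat_l; [unfold K; lra|easy]).
      assert (L * Cmod (h (f p)) <= L * (K * (rho ^ m * N)))%R by (apply Rmult_le_compat_l; lra).
      assert (C0 * Cmod (snd p) ^ k <= C0 * N)%R by (apply Rmult_le_compat_l; lra).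
      assert (L * (K * (rho ^ m * N)) <= / 2 * (K * N))%R.
      { replace (L * (K * (rho ^ m * N)))%R with ((L * rho ^ m) * (K * N))%R by ring.
        apply Rmult_le_compat_r; [apply Rmult_le_pos; [unfold K; lra|easy]|easy]. }
      assert (2 * C0 * N <= K * N)%R by (apply Rmult_le_compat_r; lra).
      lra. }
  intros p Hp.
  destruct (pow_lt_1_zero rho ltac:(rewrite Rabs_pos_eq; lra) (/ wnorm e k p) ltac:(apply Rinv_0_lt_compat; lra)) as [n Hn].
  specialize (Hn n ltac:(lia)). apply (Main n); [lra|].
  rewrite Rabs_pos_eq in Hn by (apply pow_le; lra).
  apply Rmult_le_reg_r with (/ wnorm e k p)%R; [apply Rinv_0_lt_compat; lra|].
  rewrite Rmult_assoc, Rinv_r by lra. lra.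
Qed.

Definition poly2 (c : nat -> nat -> C) (n : nat) (p : C2) : C :=
  peval (fun j => peval (c j) n (snd p)) n (fst p).

(** Only the slices on which the function is entire are used, so that no
    extension across the origin is needed. *)
Theorem quasi_invariant_is_polynomial (a b d : C) (k m0 : nat) (h : C2 -> C) (L C0 : R) :
  (0 < Cmod a < 1)%R -> (0 < Cmod d < 1)%R -> (1 <= k)%nat ->
  continuous_on_W h ->
  (forall w, w <> RtoC 0 -> entire (fun z => h (z, w))) ->
  (forall z, z <> RtoC 0 -> entire (fun w => h (z, w))) ->
  (0 <= L)%R -> (0 <= C0)%R ->
  (forall p, inW p -> (Cmod (h p) <= L * Cmod (h (tri a b k d p)) + C0 * Cmod (snd p) ^ k)%R) ->
  exists n c, (m0 <= n)%nat /\ forall p, inW p -> h p = poly2 c n p.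
Proof.
  intros Ha Hd Hk Hh Hz Hw HL HC Hq.
  destruct (tri_contracts a b k d Ha Hd Hk) as (e & rho & rho' & He & Hr & Hr' & Hf).
  destruct (growth (tri a b k d) h e k rho rho' L C0 m0 Hh He Hk Hr Hr' Hf HL HC Hq) as (m & Hm & G).
  (* On a line z = const the norm grows like |w|^k, so its m-th power gives degree [k * m] in w. *)
  set (n := (k * m)%nat).
  assert (Hmn : (m <= n)%nat) by (unfold n; nia).
  assert (Sz : forall w, w <> RtoC 0 -> exists c, forall z, h (z, w) = peval c n z).
  { intros w Hw0. pose proof (Cmod_gt_0 w) as [P _]. specialize (P Hw0).
    assert (Pk : (0 < Cmod w ^ k)%R) by now apply pow_lt.
    destruct (G (Cmod w ^ k)%R Pk) as (K & HK & HG).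
    destruct (Liouville_polynomial m (fun z => h (z, w)) (K * (e + Cmod w ^ k) ^ m) (Hz w Hw0)) as [c Hc].
    - intros z. pose proof (Cmod_ge_0 z).
      eapply Rle_trans; [apply HG; unfold wnorm; simpl; nra|].
      rewrite Rmult_assoc. apply Rmult_le_compat_l; [easy|].
      rewrite <- Rpow_mult_distr. apply pow_incr. unfold wnorm; simpl. split; nra.
    - destruct (peval_pad c m n Hmn) as [c' Hc']. exists c'; intros z; rewrite Hc'; apply Hc. }
  assert (Sw : forall z, z <> RtoC 0 -> exists c, forall w, h (z, w) = peval c n w).
  { intros z Hz0. pose proof (Cmod_gt_0 z) as [P _]. specialize (P Hz0).
    destruct (G (e * Cmod z)%R ltac:(nra)) as (K & HK & HG).
    apply (Liouville_polynomial n (fun w => h (z, w)) (K * (e * Cmod z + 1) ^ m) (Hw z Hz0)).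
    intros w. pose proof (Cmod_ge_0 w) as Gw. pose proof (pow_le _ k Gw).
    eapply Rle_trans; [apply HG; unfold wnorm; simpl; nra|].
    rewrite Rmult_assoc. apply Rmult_le_compat_l; [easy|].
    unfold n. rewrite pow_mult, <- Rpow_mult_distr. apply pow_incr. unfold wnorm; simpl.
    assert (Cmod w ^ k <= (1 + Cmod w) ^ k)%R by (apply pow_incr; lra).
    assert (1 <= (1 + Cmod w) ^ k)%R by (apply pow_R1_Rle; lra).
    assert (0 <= e * Cmod z)%R by nra.
    split; nra. }
  assert (HA : exists A : nat -> C -> C, forall w, w <> RtoC 0 -> forall z, h (z, w) = peval (fun j => A j w) n z).
  { exists (fun j w => epsilon (inhabits (fun _ : nat => RtoC 0)) (fun c => forall z, h (z, w) = peval c n z) j).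
    intros w Hw0. exact (epsilon_spec (inhabits (fun _ : nat => RtoC 0)) (fun c => forall z, h (z, w) = peval c n z) (Sz w Hw0)). }
  destruct HA as [A HA].
  (* The coefficient A_j(w) is a linear combination of values h(z, w) at nonzero z, each a
     polynomial in w. *)
  assert (HAp : forall j, (j <= n)%nat -> exists c, forall w, w <> RtoC 0 -> A j w = peval c n w).
  { apply (peval_coefficients (fun u => exists c, forall w, w <> RtoC 0 -> u w = peval c n w)).
    - intros f g [c Hc] [c' Hc']. exists (fun j => c j + c' j); intros w Hw0.
      now rewrite peval_plus, Hc, Hc'.
    - intros x f [c Hc]. exists (fun j => x * c j); intros w Hw0. now rewrite peval_scal, Hc.
    - intros z Hz0. destruct (Sw z Hz0) as [c Hc]. exists c; intros w Hw0. now rewrite <- HA, Hc. }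
  assert (Hc : exists c : nat -> nat -> C, forall j, (j <= n)%nat -> forall w, w <> RtoC 0 -> A j w = peval (c j) n w).
  { exists (fun j => epsilon (inhabits (fun _ : nat => RtoC 0)) (fun c => forall w, w <> RtoC 0 -> A j w = peval c n w)).
    intros j Hj. exact (epsilon_spec (inhabits (fun _ : nat => RtoC 0)) (fun c => forall w, w <> RtoC 0 -> A j w = peval c n w) (HAp j Hj)). }
  destruct Hc as [c Hc].
  exists n, c; split; [lia|].
  assert (Hne : forall z w, w <> RtoC 0 -> h (z, w) = poly2 c n (z, w)).
  { intros z w Hw0. rewrite (HA w Hw0). apply peval_ext. intros j Hj; simpl; auto. }
  intros [z w] Wp.
  (* At a point (z, 0) both sides are polynomials in w on the line through it, and they agree for w
     <> 0. *)
  destruct (excluded_middle_informative (w = 0)) as [E|Hw0]; [|now apply Hne].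
  assert (Hz0 : z <> RtoC 0) by (intros ->; apply Wp; now rewrite E).
  destruct (Sw z Hz0) as [c1 Hc1].
  assert (P2 : exists c2, forall w, poly2 c n (z, w) = peval c2 n w).
  { refine (peval_closed (fun u => exists c2, forall w, u w = peval c2 n w) _ _ n (fun j w => peval (c j) n w) z _).
    - intros f g [x Hx] [y Hy]. exists (fun j => x j + y j); intros u. now rewrite peval_plus, Hx, Hy.
    - intros x f [y Hy]. exists (fun j => x * y j); intros u. now rewrite peval_scal, Hy.
    - intros j _. now exists (c j). }
  destruct P2 as [c2 Hc2].
  rewrite Hc1, Hc2. apply peval_ext.
  apply peval_unique. intros u Hu. rewrite <- Hc1, <- Hc2. now apply Hne.
Qed.

(** * Slices and continuity of holomorphic maps *)

Local Notation C2_NM := (prod_NormedModule C_AbsRing C_NormedModule C_NormedModule).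

Local Notation C1_NM := (AbsRing_NormedModule C_AbsRing).

(** [C] occurs as a ring over itself, with discs as balls, and as [C_NormedModule], with squares as
    balls. The norm is the same, so the identity is linear and bounded both ways and carries
    differentiability across. *)
Lemma is_linear_to_C : @is_linear C_AbsRing (AbsRing_NormedModule C_AbsRing) C_NormedModule (fun z => z).
Proof.
  constructor; try easy. exists 1%R; split; [lra|]; intros z. rewrite Rmult_1_l. apply Rle_refl.
Qed.

Lemma is_linear_from_C : @is_linear C_AbsRing C_NormedModule (AbsRing_NormedModule C_AbsRing) (fun z => z).
Proof.
  constructor; try easy. exists 1%R; split; [lra|]; intros z. rewrite Rmult_1_l. apply Rle_refl.
Qed.

Lemma ex_filterdiff_Cderiv (g : C -> C) (a : C) :
  @ex_filterdiff C_AbsRing (AbsRing_NormedModule C_AbsRing) (AbsRing_NormedModule C_AbsRing) g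
    (locally (T := AbsRing_UniformSpace C_AbsRing) a) ->
  exists l, Cderiv g a l.
Proof.
  intros H.
  destruct (proj2 (ex_derive_filterdiff (V := AbsRing_NormedModule C_AbsRing) g a) H) as [l Hl].
  exists l; now apply Cderiv_is_derive.
Qed.

Lemma ex_filterdiff_slice_z (g : C2 -> C) (z w : C) :
  @ex_filterdiff C_AbsRing C2_NM C_NormedModule g (locally (z, w)) ->
  exists l, Cderiv (fun z => g (z, w)) z l.
Proof.
  intros H. apply ex_filterdiff_Cderiv.
  apply (ex_filterdiff_comp' (U := C1_NM) (V := C_NormedModule) (W := C1_NM) (fun z => g (z, w)) (fun y => y));
    [|apply ex_filterdiff_linear, is_linear_from_C].
  apply (ex_filterdiff_comp' (U := C1_NM) (V := C2_NM) (W := C_NormedModule) (fun z => (z, w) : C2) g); [|exact H].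
  apply (ex_filterdiff_ext (U := C1_NM) (V := C2_NM) (fun z => plus ((z, RtoC 0) : C2) ((RtoC 0, w) : C2))).
  { intros y. unfold plus; simpl; unfold prod_plus, plus; simpl. f_equal; ring. }
  apply (ex_filterdiff_plus_fct (U := C1_NM) (V := C2_NM)); [|apply ex_filterdiff_const].
  apply ex_filterdiff_linear.
  apply (is_linear_prod (T := C1_NM) (U := C_NormedModule) (V := C_NormedModule)); [apply is_linear_to_C|apply (is_linear_zero (U := C1_NM) (V := C_NormedModule))].
Qed.

Lemma ex_filterdiff_slice_w (g : C2 -> C) (z w : C) :
  @ex_filterdiff C_AbsRing C2_NM C_NormedModule g (locally (z, w)) ->
  exists l, Cderiv (fun w => g (z, w)) w l.
Proof.
  intros H. apply ex_filterdiff_Cderiv.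
  apply (ex_filterdiff_comp' (U := C1_NM) (V := C_NormedModule) (W := C1_NM) (fun w => g (z, w)) (fun y => y));
    [|apply ex_filterdiff_linear, is_linear_from_C].
  apply (ex_filterdiff_comp' (U := C1_NM) (V := C2_NM) (W := C_NormedModule) (fun w => (z, w) : C2) g); [|exact H].
  apply (ex_filterdiff_ext (U := C1_NM) (V := C2_NM) (fun w => plus ((RtoC 0, w) : C2) ((z, RtoC 0) : C2))).
  { intros y. unfold plus; simpl; unfold prod_plus, plus; simpl. f_equal; ring. }
  apply (ex_filterdiff_plus_fct (U := C1_NM) (V := C2_NM)); [|apply ex_filterdiff_const].
  apply ex_filterdiff_linear.
  apply (is_linear_prod (T := C1_NM) (U := C_NormedModule) (V := C_NormedModule)); [apply (is_linear_zero (U := C1_NM) (V := C_NormedModule))|apply is_linear_to_C].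
Qed.

Lemma continuous_on_W_of_ex_filterdiff (g : C2 -> C) :
  (forall p, inW p -> @ex_filterdiff C_AbsRing C2_NM C_NormedModule g (locally p)) ->
  continuous_on_W g.
Proof.
  intros H p Wp eps He.
  pose proof (filterdiff_continuous _ _ (H p Wp)) as Hc.
  assert (He2 : (0 < eps / 2)%R) by lra.
  destruct (Hc (ball (M := C_UniformSpace) (g p) (mkposreal _ He2)) (ex_intro _ (mkposreal _ He2) (fun y Hy => Hy))) as [d Hd].
  exists d; split; [apply cond_pos|]. intros q H1 H2.
  assert (Hb : ball (M := C_UniformSpace) (g p) (eps / 2) (g q)).
  { apply (Hd q). split; split.
    - exact (Rle_lt_trans _ _ _ (re_le_Cmod (fst q - fst p)) H1).
    - exact (Rle_lt_trans _ _ _ (Im_le_Cmod (fst q - fst p)) H1).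
    - exact (Rle_lt_trans _ _ _ (re_le_Cmod (snd q - snd p)) H2).
    - exact (Rle_lt_trans _ _ _ (Im_le_Cmod (snd q - snd p)) H2). }
  destruct Hb as [B1 B2].
  eapply Rle_lt_trans; [apply Cmod_le_Rabs|].
  change (Rabs (Re (g q) - Re (g p)) < eps / 2)%R in B1.
  change (Rabs (Im (g q) - Im (g p)) < eps / 2)%R in B2.
  simpl; unfold Rminus, Re, Im in *; lra.
Qed.

Lemma holomorphic_components (g : C2 -> C2) : holomorphic_on inW g ->
  (forall p, inW p -> @ex_filterdiff C_AbsRing C2_NM C_NormedModule (fun p => fst (g p)) (locally p)) /\
  (forall p, inW p -> @ex_filterdiff C_AbsRing C2_NM C_NormedModule (fun p => snd (g p)) (locally p)).
Proof.
  intros H; split; intros p Wp.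
  - apply (ex_filterdiff_comp' (U := C2_NM) (V := C2_NM) (W := C_NormedModule) g (fun q => fst q)); [now apply H|].
    apply ex_filterdiff_linear, (is_linear_fst (U := C_NormedModule) (V := C_NormedModule)).
  - apply (ex_filterdiff_comp' (U := C2_NM) (V := C2_NM) (W := C_NormedModule) g (fun q => snd q)); [now apply H|].
    apply ex_filterdiff_linear, (is_linear_snd (U := C_NormedModule) (V := C_NormedModule)).
Qed.

Lemma quasi_invariant_holomorphic_is_polynomial (a b d : C) (k m0 : nat) (h : C2 -> C) (L C0 : R) :
  (0 < Cmod a < 1)%R -> (0 < Cmod d < 1)%R -> (1 <= k)%nat ->
  (forall p, inW p -> @ex_filterdiff C_AbsRing C2_NM C_NormedModule h (locally p)) ->
  (0 <= L)%R -> (0 <= C0)%R ->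
  (forall p, inW p -> (Cmod (h p) <= L * Cmod (h (tri a b k d p)) + C0 * Cmod (snd p) ^ k)%R) ->
  exists n c, (m0 <= n)%nat /\ forall p, inW p -> h p = poly2 c n p.
Proof.
  intros Ha Hd Hk H HL HC Hq.
  apply (quasi_invariant_is_polynomial a b d k m0 h L C0); try easy.
  - now apply continuous_on_W_of_ex_filterdiff.
  - intros w Hw z. apply ex_filterdiff_slice_z, H. intros E; now injection E.
  - intros z Hz w. apply ex_filterdiff_slice_w, H. intros E; now injection E.
Qed.

(** * Normal forms of anti-holomorphic square roots of a contraction *)

(** A linear diagonal part plus one pure power in each component, the only terms that the weights
    allow. Square roots are such maps after [conj_c], and the conjugating automorphisms are such
    maps themselves. *)
Definition pmap (A B : C) (l : nat) (G : C) (j : nat) (D : C) (p : C2) : C2 :=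
  (A * fst p + B * snd p ^ l, G * fst p ^ j + D * snd p).

Definition amap (A B : C) (l : nat) (G : C) (j : nat) (D : C) (p : C2) : C2 :=
  pmap A B l G j D (conj_c p).

Lemma pow_inj_lt_1 (r : R) (x y : nat) : (0 < r < 1)%R -> (r ^ x = r ^ y)%R -> x = y.
Proof.
  intros Hr.
  assert (G : forall x y, (x < y)%nat -> (r ^ y < r ^ x)%R).
  { intros u v Huv. replace v with (u + S (v - S u))%nat by lia. rewrite pow_add.
    assert (0 < r ^ u)%R by (apply pow_lt; lra).
    assert (r ^ S (v - S u) < 1)%R.
    { apply Rle_lt_trans with r; [|lra]. simpl.
      assert (r ^ (v - S u) <= 1)%R by (rewrite <- (pow1 (v - S u)); apply pow_incr; lra). nra. }
    nra. }
  intros E. destruct (Nat.lt_trichotomy x y) as [L|[L|L]]; [|easy|]; apply G in L; lra.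
Qed.

Lemma Cmod_pos_neq_0 (a : C) : (0 < Cmod a)%R -> a <> 0.
Proof. intros H; now apply Cmod_gt_0. Qed.

Lemma tri_inW (a b : C) (k : nat) (d : C) (p : C2) : a <> 0 -> d <> 0 -> (1 <= k)%nat ->
  inW p -> inW (tri a b k d p).
Proof.
  intros Ha Hd Hk Hp; apply inW_alt in Hp; apply inW_alt; unfold tri; simpl.
  destruct (excluded_middle_informative (snd p = 0)) as [E|E].
  - left. rewrite E. destruct Hp as [Hp|Hp]; [|easy].
    destruct k as [|k]; [lia|].
    replace (a * fst p + b * RtoC 0 ^ S k) with (a * fst p) by (simpl; ring).
    now apply Cmult_neq_0.
  - right. now apply Cmult_neq_0.
Qed.

(** The exponent [l0] may exceed [n]; then the polynomial is zero and [B = 0]. *)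
Lemma peval_sparse (c : nat -> C) (n l0 : nat) :
  (forall l, (l <= n)%nat -> l <> l0 -> c l = 0) ->
  exists B, (forall w, peval c n w = B * w ^ l0) /\ (B <> 0 -> (l0 <= n)%nat /\ c l0 = B).
Proof.
  intros H. destruct (Nat.le_gt_cases l0 n) as [L|L].
  - exists (c l0); split; [|easy]. intros w.
    rewrite <- (peval_monomial (c l0) l0 n w L). apply peval_ext. intros l Hl.
    destruct (Nat.eqb_spec l l0) as [ ->|E]; auto.
  - exists 0; split; [|easy]. intros w.
    rewrite (peval_ext c (fun _ => 0 * 0)) by (intros l Hl; rewrite H by lia; ring).
    rewrite peval_scal; ring.
Qed.

(** The substitution comes from the shear, with [b] a multiple of w^k; only the leading coefficient
    is tracked, which suffices to bound the degree in z. *)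
Lemma peval_affine (x : nat -> C) (a b : C) (n : nat) :
  exists e, (forall z, peval x n (a * z + b) = peval e n z) /\ e n = x n * a ^ n.
Proof.
  assert (Hpow : forall m, exists e, (forall z, (a * z + b) ^ m = peval e m z) /\ e m = a ^ m).
  { induction m as [|m [e [He Em]]].
    - exists (fun _ => 1); split; [intros; simpl; ring|simpl; ring].
    - exists (fun i => b * (if (i <=? m)%nat then e i else 0) + a * match i with O => 0 | S i' => e i' end).
      split.
      + intros z. rewrite Cpow_S, He.
        rewrite peval_plus, !peval_scal.
        rewrite (peval_high_zero (fun i => if (i <=? m)%nat then e i else 0) m (S m)).
        2: lia.
        2:{ intros i Hi. destruct (Nat.leb_spec i m); [lia|easy]. }
        rewrite (peval_ext (fun i => if (i <=? m)%nat then e i else 0) e).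
        2:{ intros i Hi. destruct (Nat.leb_spec i m); [easy|lia]. }
        assert (Hs : forall q, peval (fun i => match i with O => 0 | S i' => e i' end) (S q) z = z * peval e q z).
        { induction q as [|q IHq]; [simpl; ring|].
          cbn [peval] in IHq |- *. rewrite IHq. simpl; ring. }
        rewrite Hs; ring.
      + destruct (Nat.leb_spec (S m) m); [lia|]. rewrite Em; simpl; ring. }
  induction n as [|n [e [He En]]].
  - exists x; split; [easy|simpl; ring].
  - destruct (Hpow (S n)) as [q [Hq Eq]].
    exists (fun i => (if (i <=? n)%nat then e i else 0) + x (S n) * q i). split.
    + intros z. change (peval x (S n) (a * z + b)) with (peval x n (a * z + b) + x (S n) * (a * z + b) ^ S n).
      rewrite Hq, He, peval_plus, peval_scal. f_equal.
      rewrite (peval_high_zero (fun i => if (i <=? n)%nat then e i else 0) n (S n)).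
      * apply peval_ext. intros i Hi. destruct (Nat.leb_spec i n); [easy|lia].
      * lia.
      * intros i Hi. destruct (Nat.leb_spec i n); [lia|easy].
    + destruct (Nat.leb_spec (S n) n); [lia|]. rewrite Eq; ring.
Qed.

(** A monomial z^j w^l occurs only if a^j d^l = lam. As |lam| = |a|, taking moduli leaves (1, 0) or
    j = 0, and in the latter case |d|^l = |a| determines l. *)
Lemma equivariant_diag (a d lam : C) (h : C2 -> C) :
  (0 < Cmod a < 1)%R -> (0 < Cmod d < 1)%R -> Cmod lam = Cmod a ->
  (forall p, inW p -> @ex_filterdiff C_AbsRing C2_NM C_NormedModule h (locally p)) ->
  (forall p, inW p -> h (a * fst p, d * snd p) = lam * h p) ->
  exists A B l, (1 <= l)%nat /\ (forall p, inW p -> h p = A * fst p + B * snd p ^ l) /\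
    (A <> 0 -> a = lam) /\ (B <> 0 -> d ^ l = lam).
Proof.
  intros Ha Hd Hl Hh He.
  assert (Na : a <> 0) by (apply Cmod_pos_neq_0; lra).
  assert (Nd : d <> 0) by (apply Cmod_pos_neq_0; lra).
  assert (Nl : (0 < Cmod lam)%R) by lra.
  destruct (quasi_invariant_holomorphic_is_polynomial a 0 d 1 1 h (/ Cmod lam) 0 Ha Hd (le_n 1) Hh) as (n & c & Hn & Hc).
  { left; now apply Rinv_0_lt_compat. }
  { lra. }
  { intros p Wp. replace (tri a 0 1 d p) with ((a * fst p, d * snd p) : C2) by (unfold tri; f_equal; ring).
    rewrite He by easy. rewrite Cmod_mult, <- Rmult_assoc, Rinv_l by lra. lra. }
  assert (Hco : forall j l, (j <= n)%nat -> (l <= n)%nat -> c j l <> 0 -> a ^ j * d ^ l = lam).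
  { intros j l Hj Hl' Hne.
    (* Coefficients are compared in z for each fixed nonzero w, and then in w. *)
    assert (R1 : forall w, w <> RtoC 0 -> forall i, (i <= n)%nat -> peval (c i) n (d * w) * a ^ i = lam * peval (c i) n w).
    { intros w Hw. apply (peval_unique (fun i => peval (c i) n (d * w) * a ^ i) (fun i => lam * peval (c i) n w)).
      intros z Hz. rewrite peval_scal, <- peval_dilate.
      assert (Wp : inW (z, w)) by (apply inW_alt; now right).
      assert (Wp' : inW (a * z, d * w)) by (apply inW_alt; right; now apply Cmult_neq_0).
      pose proof (He _ Wp) as E. simpl in E. rewrite !Hc in E by easy. exact E. }
    assert (R2 : forall i, (i <= n)%nat -> c j i * d ^ i * a ^ j = lam * c j i).
    { intros i Hi. rewrite (Cmult_comm _ (a ^ j)).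
      apply (peval_unique (fun i => a ^ j * (c j i * d ^ i)) (fun i => lam * c j i) n); [|easy].
      intros w Hw. rewrite !peval_scal, <- peval_dilate, <- (R1 w Hw j Hj). ring. }
    specialize (R2 l Hl').
    transitivity (c j l * d ^ l * a ^ j * / c j l); [field; easy|].
    rewrite R2; field; easy. }
  assert (Hmod : forall j l, a ^ j * d ^ l = lam -> (j = 1 /\ l = 0)%nat \/ (j = 0 /\ 1 <= l)%nat).
  { intros j l E. apply (f_equal Cmod) in E. rewrite Cmod_mult, !Cmod_pow, Hl in E.
    set (x := Cmod a) in *. set (y := Cmod d) in *.
    assert (Hyl : (0 < y ^ l <= 1)%R) by (split; [apply pow_lt; lra|rewrite <- (pow1 l); apply pow_incr; lra]).
    destruct j as [|[|j]].
    - right; split; [easy|]. destruct l; [simpl in E; lra|lia].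
    - left; split; [easy|]. destruct l as [|l]; [easy|]. exfalso.
      assert (y ^ l <= 1)%R by (rewrite <- (pow1 l); apply pow_incr; lra).
      assert (0 < y ^ l)%R by (apply pow_lt; lra). simpl in E.
      assert (y * y ^ l < 1)%R by nra.
      assert (x * (y * y ^ l) < x * 1)%R by (apply Rmult_lt_compat_l; lra). lra.
    - exfalso. simpl in E.
      assert (0 < x ^ j <= 1)%R by (split; [apply pow_lt; lra|rewrite <- (pow1 j); apply pow_incr; lra]).
      assert (x * x ^ j * y ^ l = 1)%R.
      { apply Rmult_eq_reg_l with x; [|apply Rgt_not_eq; easy]. transitivity (x * (x * x ^ j) * y ^ l)%R; [ring|rewrite E; ring]. }
      assert (x * x ^ j < 1)%R by nra. nra. }
  assert (R0 : exists B l, (1 <= l)%nat /\ (forall w, peval (c O) n w = B * w ^ l) /\ (B <> 0 -> d ^ l = lam)).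
  { destruct (excluded_middle_informative (exists l, (l <= n)%nat /\ c O l <> 0)) as [[l [Hln Hcl]]|Hno].
    - assert (El := Hco O l ltac:(lia) Hln Hcl).
      destruct (peval_sparse (c O) n l) as [B [HB _]].
      + intros i Hi Hne. apply NNPP; intros Hci. specialize (Hco O i ltac:(lia) Hi Hci).
        apply Hne. rewrite <- El in Hco. apply (f_equal Cmod) in Hco.
        rewrite !Cmod_mult, !Cmod_pow in Hco. simpl in Hco. rewrite !Rmult_1_l in Hco.
        now apply pow_inj_lt_1 in Hco.
      + exists B, l. split; [|split; [easy|intros _; rewrite <- El; simpl; ring]].
        destruct (Hmod O l El); lia.
    (* No pure power of w occurs; the exponent 1 is a default. *)
    - exists 0, 1%nat. split; [lia|]. split; [|easy].
      intros w. rewrite (peval_ext (c O) (fun _ => 0 * 0)).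
      + rewrite peval_scal; ring.
      + intros l Hl'. replace (RtoC 0 * 0) with (RtoC 0) by ring. apply NNPP; intros H; apply Hno; eauto. }
  destruct R0 as (B & l & Hl1 & HB & HBl).
  destruct (peval_sparse (c 1%nat) n 0) as [A [HA HA']].
  { intros i Hi Hne. apply NNPP; intros Hci. destruct (Hmod 1%nat i (Hco 1%nat i Hn Hi Hci)); lia. }
  exists A, B, l. split; [easy|]. split; [|split; [|easy]].
  - intros p Wp. rewrite Hc by easy. unfold poly2.
    rewrite (peval_high_zero _ 1 n (fst p) Hn).
    2:{ intros j Hj.
        rewrite (peval_ext (c j) (fun _ => 0 * 0)); [rewrite peval_scal; ring|].
        intros i Hi; replace (RtoC 0 * 0) with (RtoC 0) by ring.
        apply NNPP; intros Hci; destruct (Hmod j i (Hco j i ltac:(lia) Hi Hci)); lia. }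
    simpl. rewrite HA, HB. simpl; ring.
  - intros HA0. destruct (HA' HA0) as [_ HA1].
    rewrite <- (Hco 1%nat 0%nat Hn ltac:(lia)); [simpl; ring|]. now rewrite HA1.
Qed.

(** With weights k for z and 1 for w, the leading coefficient in z, of degree J, satisfies an
    equation without shear and inhomogeneity: its monomial w^l needs l + k J = i <= k. Hence J <= 1,
    and J = 1 forces l = 0 and i = k. The last clause is what remains for the terms free of z. *)
Lemma equivariant_tri (b d lam beta : C) (k i : nat) (h : C2 -> C) :
  (0 < Cmod d < 1)%R -> (1 <= k)%nat -> (1 <= i <= k)%nat -> Cmod lam = (Cmod d ^ i)%R ->
  (forall p, inW p -> @ex_filterdiff C_AbsRing C2_NM C_NormedModule h (locally p)) ->
  (forall p, inW p -> h (tri (d ^ k) b k d p) = lam * h p + beta * snd p ^ k) ->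
  exists c n r, (k <= n)%nat /\ (forall p, inW p -> h p = c * fst p + peval r n (snd p)) /\
    (c <> 0 -> i = k /\ lam = d ^ k) /\
    (forall l, (l <= n)%nat -> r l * (d ^ l - lam) = if (l =? k)%nat then beta - c * b else 0).
Proof.
  intros Hd Hk Hi Hl Hh He.
  assert (Nd : d <> 0) by (apply Cmod_pos_neq_0; lra).
  assert (Hdk : (0 < Cmod (d ^ k) < 1)%R).
  { rewrite Cmod_pow. split; [apply pow_lt; lra|].
    destruct k as [|k]; [lia|]. simpl.
    assert (0 < Cmod d ^ k <= 1)%R by (split; [apply pow_lt; lra|rewrite <- (pow1 k); apply pow_incr; lra]). nra. }
  assert (Ndk : d ^ k <> 0) by now apply Cpow_nz.
  assert (Nl : (0 < Cmod lam)%R) by (rewrite Hl; apply pow_lt; lra).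
  destruct (quasi_invariant_holomorphic_is_polynomial (d ^ k) b d k k h (/ Cmod lam) (/ Cmod lam * Cmod beta)
     Hdk Hd Hk Hh) as (n & c & Hn & Hc).
  { left; now apply Rinv_0_lt_compat. }
  { apply Rmult_le_pos; [left; now apply Rinv_0_lt_compat|apply Cmod_ge_0]. }
  { intros p Wp. rewrite He by easy.
    rewrite Rmult_assoc, <- Rmult_plus_distr_l.
    apply Rmult_le_reg_l with (Cmod lam); [easy|].
    rewrite <- Rmult_assoc, Rinv_r, Rmult_1_l by lra.
    rewrite <- Cmod_mult, <- Cmod_pow, <- Cmod_mult.
    replace (lam * h p) with ((lam * h p + beta * snd p ^ k) + - (beta * snd p ^ k)) at 1 by ring.
    eapply Rle_trans; [apply Cmod_triangle|]. rewrite Cmod_opp. apply Rle_refl. }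
  set (R := fun w j => peval (c j) n w).
  assert (Id : forall w, w <> RtoC 0 -> forall z,
     peval (R (d * w)) n (d ^ k * z + b * w ^ k) = lam * peval (R w) n z + beta * w ^ k).
  { intros w Hw z.
    assert (Wp : inW (z, w)) by (apply inW_alt; now right).
    pose proof (He _ Wp) as E. rewrite !Hc in E by (try easy; now apply tri_inW). exact E. }
  assert (Top : forall J, (1 <= J <= n)%nat -> (forall j, (J < j <= n)%nat -> forall w, R w j = 0) ->
     forall l, (l <= n)%nat -> c J l * d ^ (l + k * J) = lam * c J l).
  { intros J HJ Hhigh.
    assert (R1 : forall w, w <> RtoC 0 -> R (d * w) J * (d ^ k) ^ J = lam * R w J).
    { intros w Hw. destruct (peval_affine (R (d * w)) (d ^ k) (b * w ^ k) J) as [e [E1 E2]].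
      rewrite <- E2.
      transitivity (lam * R w J + (if (J =? 0)%nat then beta * w ^ k else 0)).
      - apply (peval_unique e (fun j => lam * R w j + (if (j =? 0)%nat then beta * w ^ k else 0)) J); [|easy].
        intros z _. rewrite <- E1, <- (peval_high_zero (R (d * w)) J n) by (try lia; auto).
        rewrite Id, peval_plus, peval_scal, (peval_high_zero (R w) J n) by (try easy; try lia; auto).
        rewrite peval_monomial by lia. simpl; ring.
      - destruct (Nat.eqb_spec J 0); [lia|ring]. }
    intros l Hl'.
    replace (c J l * d ^ (l + k * J)) with ((d ^ k) ^ J * (c J l * d ^ l)) by (rewrite Cpow_add_r, Cpow_mult_r; ring).
    apply (peval_unique (fun l => (d ^ k) ^ J * (c J l * d ^ l)) (fun l => lam * c J l) n); [|easy].
    intros w Hw. rewrite !peval_scal, <- peval_dilate.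
    pose proof (R1 w Hw) as E. unfold R in E. rewrite <- E. ring. }
  assert (Hpow : forall x y, d ^ x * y = lam * y -> y <> 0 -> x = i).
  { intros x y E Hy. assert (E' : d ^ x = lam).
    { transitivity (d ^ x * y * / y); [field; easy|]. rewrite E; field; easy. }
    apply (f_equal Cmod) in E'. rewrite Cmod_pow, Hl in E'. now apply pow_inj_lt_1 in E'. }
  (* Descending induction on the degree in z: once all higher coefficients vanish, [Top] applies to
     the next one. *)
  assert (High : forall m J, (J + m = n)%nat -> (1 <= J)%nat -> forall j, (J < j <= n)%nat -> forall w, R w j = 0).
  { induction m as [|m IH]; intros J HJ HJ1 j Hj w; [lia|].
    specialize (IH (S J) ltac:(lia) ltac:(lia)).
    destruct (Nat.eq_dec j (S J)) as [ ->|Hne]; [|apply IH; lia].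
    unfold R. rewrite (peval_ext (c (S J)) (fun _ => 0 * 0)); [rewrite peval_scal; ring|].
    intros l Hl'. replace (RtoC 0 * 0) with (RtoC 0) by ring.
    apply NNPP; intros Hne. pose proof (Top (S J) ltac:(lia) IH l Hl') as E.
    rewrite Cmult_comm in E. apply Hpow in E; [|easy]. nia. }
  assert (High1 : forall j, (1 < j <= n)%nat -> forall w, R w j = 0) by (apply (High (n - 1)%nat); lia).
  assert (Top1 := Top 1%nat ltac:(lia) High1).
  destruct (peval_sparse (c 1%nat) n 0) as [c1 [Hc1 Hc1']].
  { intros l Hl' Hne. apply NNPP; intros Hcl. specialize (Top1 l Hl').
    rewrite Cmult_comm in Top1. apply Hpow in Top1; [|easy]. lia. }
  exists c1, n, (c O). split; [easy|]. split; [|split].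
  - intros p Wp. rewrite Hc by easy. unfold poly2.
    rewrite (peval_high_zero _ 1 n) by (try lia; intros j Hj; apply (High1 j Hj)).
    simpl. rewrite Hc1. simpl; ring.
  - intros Hne. destruct (Hc1' Hne) as [_ E]. specialize (Top1 0%nat ltac:(lia)).
    rewrite E in Top1. replace (0 + k * 1)%nat with k in Top1 by lia. rewrite Cmult_comm in Top1.
    split; [symmetry; now apply (Hpow k c1)|].
    transitivity (lam * c1 * / c1); [field; easy|]. rewrite <- Top1. field; easy.
  - intros l Hl'.
    assert (E : d ^ l * c O l + c1 * b * (if (l =? k)%nat then 1 else 0) = lam * c O l + beta * (if (l =? k)%nat then 1 else 0)).
    { rewrite (Cmult_comm (d ^ l)).
      apply (peval_unique (fun l => c O l * d ^ l + c1 * b * (if (l =? k)%nat then 1 else 0))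
        (fun l => lam * c O l + beta * (if (l =? k)%nat then 1 else 0)) n); [|easy].
      intros w Hw. pose proof (Id w Hw 0) as E.
      rewrite !(peval_high_zero _ 1 n) in E by (try lia; intros j Hj; apply (High1 j Hj)).
      simpl in E. unfold R in E. rewrite !Hc1 in E.
      rewrite !peval_plus, !peval_scal, <- peval_dilate, peval_monomial by easy.
      simpl in E. rewrite !Cmult_1_r in E.
      replace (peval (c O) n (d * w) + c1 * b * (1 * w ^ k)) with
        (peval (c O) n (d * w) + c1 * (1 * (d ^ k * 0 + b * w ^ k))) by ring.
      replace (lam * peval (c O) n w + beta * (1 * w ^ k)) with (lam * (peval (c O) n w + c1 * (1 * 0)) + beta * w ^ k) by ring.
      rewrite !Cmult_1_l. rewrite <- E. ring. }
    replace (c O l * (d ^ l - lam)) with (d ^ l * c O l - lam * c O l) by ring.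
    destruct (l =? k)%nat.
    + replace (d ^ l * c O l) with (d ^ l * c O l + c1 * b * 1 - c1 * b) by ring. rewrite E; ring.
    + replace (d ^ l * c O l) with (d ^ l * c O l + c1 * b * 0) by ring. rewrite E; ring.
Qed.

Lemma square_root_commutes_on_W (f phi : C2 -> C2) :
  (forall p, inW p -> inW (phi p)) -> (forall p, inW p -> phi (phi p) = f p) ->
  forall p, inW p -> phi (f p) = f (phi p).
Proof.
  intros HW Hs p Wp. rewrite <- !Hs by auto. reflexivity.
Qed.

Lemma conj_c_components (phi : C2 -> C2) : antiholomorphic_on inW phi ->
  (forall p, inW p -> @ex_filterdiff C_AbsRing C2_NM C_NormedModule (fun p => Cconj (fst (phi p))) (locally p)) /\
  (forall p, inW p -> @ex_filterdiff C_AbsRing C2_NM C_NormedModule (fun p => Cconj (snd (phi p))) (locally p)).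
Proof. exact (holomorphic_components (fun p => conj_c (phi p))). Qed.

Definition swap (p : C2) : C2 := (snd p, fst p).

(** Since phi commutes with f, the components of conj o phi are multiplied under f by conj a and
    conj d. The second one is treated by [equivariant_diag] after exchanging the coordinates. *)
Lemma diag_normal_form (a d : C) (phi : C2 -> C2) :
  (0 < Cmod a < 1)%R -> (0 < Cmod d < 1)%R ->
  antiholomorphic_on inW phi -> (forall p, inW p -> inW (phi p)) ->
  (forall p, inW p -> phi (phi p) = (a * fst p, d * snd p)) ->
  exists A B l G j D, (1 <= l)%nat /\ (1 <= j)%nat /\
    (forall p, inW p -> phi p = amap A B l G j D p) /\
    (A <> 0 -> a = Cconj a) /\ (B <> 0 -> d ^ l = Cconj a) /\
    (G <> 0 -> a ^ j = Cconj d) /\ (D <> 0 -> d = Cconj d).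
Proof.
  intros Ha Hd Hh HW Hs.
  pose proof (square_root_commutes_on_W (fun p => (a * fst p, d * snd p)) phi HW Hs) as Hcm.
  destruct (conj_c_components phi Hh) as [H1 H2].
  destruct (equivariant_diag a d (Cconj a) (fun p => Cconj (fst (phi p))) Ha Hd (Cmod_conj a) H1) as (A & B & l & Hl & E1 & HA & HB).
  { intros p Wp. rewrite (Hcm p Wp). simpl. apply Cmult_conj. }
  destruct (equivariant_diag d a (Cconj d) (fun p => Cconj (snd (phi (swap p)))) Hd Ha (Cmod_conj d)) as (D & G & j & Hj & E2 & HD & HG).
  { intros p Wp.
    apply (ex_filterdiff_comp' (U := C2_NM) (V := C2_NM) (W := C_NormedModule) swap (fun p => Cconj (snd (phi p)))).
    - apply ex_filterdiff_linear.
      apply (is_linear_prod (T := C2_NM) (U := C_NormedModule) (V := C_NormedModule));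
      [apply (is_linear_snd (U := C_NormedModule) (V := C_NormedModule))|apply (is_linear_fst (U := C_NormedModule) (V := C_NormedModule))].
    - apply H2. apply inW_alt in Wp. apply inW_alt. unfold swap; simpl; tauto. }
  { intros p Wp. unfold swap; simpl.
    assert (Wq : inW (snd p, fst p)) by (apply inW_alt in Wp; apply inW_alt; simpl; tauto).
    pose proof (Hcm (snd p, fst p) Wq) as E. simpl in E. rewrite E. simpl. apply Cmult_conj. }
  exists (Cconj A), (Cconj B), l, (Cconj G), j, (Cconj D).
  assert (Hz : forall x, Cconj x <> 0 -> x <> 0).
  { intros x Hx ->; apply Hx. apply injective_projections; simpl; ring. }
  repeat split; auto.
  intros p Wp.
  assert (Wq : inW (swap p)) by (apply inW_alt in Wp; apply inW_alt; unfold swap; simpl; tauto).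
  specialize (E1 p Wp). specialize (E2 (swap p) Wq). unfold swap in E2; simpl in E2.
  rewrite <- (surjective_pairing p) in E2.
  apply (f_equal Cconj) in E1, E2. rewrite Cconj_conj, Cplus_conj, !Cmult_conj, Cpow_conj in E1, E2.
  unfold amap, pmap, conj_c; simpl. apply injective_projections; simpl; [easy|].
  rewrite E2; ring.
Qed.

(** The shear w^k is resonant: where d^l - lam vanishes at l = k in the last clause of
    [equivariant_tri], the right-hand side must vanish too. This excludes z from the second
    component and ties the coefficient of z in the first one to [D ^ k]. *)
Lemma tri_normal_form (d : C) (k : nat) (phi : C2 -> C2) :
  (0 < Cmod d < 1)%R -> (1 <= k)%nat ->
  antiholomorphic_on inW phi -> (forall p, inW p -> inW (phi p)) ->
  (forall p, inW p -> phi (phi p) = tri (d ^ k) 1 k d p) ->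
  exists B D, d = Cconj d /\ forall p, inW p -> phi p = amap (D ^ k) B k 0 1 D p.
Proof.
  intros Hd Hk Hh HW Hs.
  pose proof (square_root_commutes_on_W (tri (d ^ k) 1 k d) phi HW Hs) as Hcm.
  destruct (conj_c_components phi Hh) as [H1 H2].
  assert (Nd : d <> 0) by (apply Cmod_pos_neq_0; lra).
  destruct (equivariant_tri 1 d (Cconj d) 0 k 1 (fun p => Cconj (snd (phi p))) Hd Hk ltac:(lia)
     ltac:(rewrite Cmod_conj; ring) H2) as (c & n & r & Hn & E2 & Hc & Hr).
  { intros p Wp. rewrite (Hcm p Wp). unfold tri; simpl. rewrite Cmult_conj; ring. }
  assert (Hc0 : c = 0).
  (* A nonzero [c] needs k = 1 and conj d = d; then the relation at l = 1 reads 0 = - c. *)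
  { apply NNPP; intros Hne. destruct (Hc Hne) as [<- E]. specialize (Hr 1%nat Hn). simpl in Hr.
    rewrite E in Hr. simpl in Hr. apply Hne.
    replace c with (- (0 - c * 1)) by ring. rewrite <- Hr. ring. }
  subst c.
  assert (Hr' : forall l, (l <= n)%nat -> r l <> 0 -> d ^ l = Cconj d).
  { intros l Hl Hrl. specialize (Hr l Hl).
    replace (if (l =? k)%nat then 0 - 0 * 1 else 0) with (RtoC 0) in Hr by (destruct (l =? k)%nat; ring).
    replace (d ^ l) with (r l * (d ^ l - Cconj d) * / r l + Cconj d) by (field; easy).
    rewrite Hr. ring. }
  destruct (peval_sparse r n 1) as [D [HD HD']].
  { intros l Hl Hne. apply NNPP; intros Hrl. apply Hne.
    pose proof (Hr' l Hl Hrl) as E. apply (f_equal Cmod) in E. rewrite Cmod_pow, Cmod_conj in E.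
    rewrite <- (pow_1 (Cmod d)) in E at 2. now apply pow_inj_lt_1 in E. }
  assert (E2' : forall p, inW p -> Cconj (snd (phi p)) = D * snd p).
  { intros p Wp. rewrite (E2 p Wp), HD. simpl; ring. }
  assert (ND : D <> 0).
  { intros HD0. assert (W1 : inW (RtoC 0, RtoC 1)) by (apply inW_alt; right; simpl; intros E; apply RtoC_inj in E; lra).
    pose proof (Hs _ W1) as E. apply (f_equal snd) in E. unfold tri in E; simpl in E.
    pose proof (E2' _ (HW _ W1)) as E'. rewrite E, HD0 in E'.
    apply Nd. rewrite Cmult_1_r in E'. rewrite <- (Cconj_conj d), E'.
    apply injective_projections; simpl; ring. }
  destruct (HD' ND) as [Hn1 HD1].
  assert (Hreal : d = Cconj d).
  { rewrite <- (Hr' 1%nat Hn1) by now rewrite HD1. ring. }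
  destruct (equivariant_tri 1 d (d ^ k) (D ^ k) k k (fun p => Cconj (fst (phi p))) Hd Hk ltac:(lia)
     ltac:(now rewrite Cmod_pow) H1) as (c & m & q & Hm & E1 & _ & Hq).
  { intros p Wp. rewrite (Hcm p Wp). unfold tri; simpl.
    rewrite Cplus_conj, !Cmult_conj, !Cpow_conj, (E2' p Wp), <- Hreal, Cpow_mult_l.
    replace (Cconj 1) with (RtoC 1) by (apply injective_projections; simpl; ring). ring. }
  (* At l = k the left-hand side is zero, so the inhomogeneity [D ^ k] must equal [c]. *)
  assert (Hck : c = D ^ k).
  { specialize (Hq k Hm). rewrite Nat.eqb_refl in Hq.
    replace c with (D ^ k - (D ^ k - c * 1)) by ring. rewrite <- Hq. ring. }
  destruct (peval_sparse q m k) as [B [HB _]].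
  { intros l Hl Hne. apply NNPP; intros Hql. apply Hne. specialize (Hq l Hl).
    destruct (Nat.eqb_spec l k) as [?|_]; [easy|].
    assert (E : d ^ l = d ^ k).
    { replace (d ^ l) with (q l * (d ^ l - d ^ k) * / q l + d ^ k) by (field; easy). rewrite Hq. ring. }
    apply (f_equal Cmod) in E. rewrite !Cmod_pow in E. now apply pow_inj_lt_1 in E. }
  exists (Cconj B), (Cconj D). split; [easy|].
  intros p Wp. specialize (E1 p Wp). specialize (E2' p Wp). rewrite HB, Hck in E1.
  apply (f_equal Cconj) in E1, E2'. rewrite Cconj_conj in E1, E2'.
  rewrite Cplus_conj, !Cmult_conj, !Cpow_conj in E1. rewrite Cmult_conj in E2'.
  unfold amap, pmap, conj_c; simpl. apply injective_projections; simpl; [easy|].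
  rewrite E2'; ring.
Qed.

Local Notation C2_US := (prod_UniformSpace C_UniformSpace C_UniformSpace).

(** * Orbits *)

Record contracting (f : C2 -> C2) : Prop := {
  contracting_injective : forall p q, f p = f q -> p = q;
  contracting_inW : forall p, inW (f p) <-> inW p;
  contracting_norm : exists (e rho : R) (k : nat), (0 < e)%R /\ (0 < rho < 1)%R /\
    (1 <= k)%nat /\ forall p, (wnorm e k (f p) <= rho * wnorm e k p)%R }.

Lemma tri_inv (a b : C) (k : nat) (d : C) : a <> 0 -> d <> 0 ->
  let g := tri (/ a) (- b * / a * / d ^ k) k (/ d) in
  (forall p, g (tri a b k d p) = p) /\ (forall p, tri a b k d (g p) = p).
Proof.
  intros Ha Hd. assert (Hdk : d ^ k <> 0) by now apply Cpow_nz.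
  split; intros [z w]; unfold tri; simpl; apply injective_projections; simpl;
  rewrite ?Cpow_mult_l, ?Cpow_inv by easy; field; auto.
Qed.

Lemma tri_contracting (f : C2 -> C2) (a b : C) (k : nat) (d : C) :
  (forall p, f p = tri a b k d p) ->
  (0 < Cmod a < 1)%R -> (0 < Cmod d < 1)%R -> (1 <= k)%nat -> contracting f.
Proof.
  intros Hf Ha Hd Hk.
  assert (Na : a <> 0) by (apply Cmod_pos_neq_0; lra).
  assert (Nd : d <> 0) by (apply Cmod_pos_neq_0; lra).
  destruct (tri_inv a b k d Na Nd) as [I1 I2].
  constructor.
  - intros p q E. rewrite !Hf in E. rewrite <- (I1 p), <- (I1 q), E. easy.
  - intros p; rewrite Hf; split; [|now apply tri_inW].
    intros H E. rewrite E in H. apply H. unfold tri; simpl.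
    destruct k; [lia|]. apply injective_projections; simpl; ring.
  - destruct (tri_contracts a b k d Ha Hd Hk) as (e & rho & rho' & He & Hr & _ & H).
    exists e, rho, k. repeat split; try easy. intros p; rewrite Hf; apply H.
Qed.

Section Hopf_surface.

Variable f : C2 -> C2.
Hypothesis Hf : contracting f.

Lemma iter_inW (n : nat) (p : C2) : inW (Nat.iter n f p) <-> inW p.
Proof.
  induction n as [|n IH]; simpl; [easy|]. now rewrite (contracting_inW f Hf).
Qed.

Lemma iter_injective (n : nat) (p q : C2) : Nat.iter n f p = Nat.iter n f q -> p = q.
Proof.
  induction n as [|n IH]; simpl; [easy|]. intros E; now apply IH, (contracting_injective f Hf).
Qed.

Lemma orbit_refl (p : C2) : orbit f p p.
Proof. exists O; now left. Qed.

Lemma orbit_sym (p q : C2) : orbit f p q -> orbit f q p.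
Proof. intros [n [H|H]]; exists n; [now right|now left]. Qed.

(** Common iterates are cancelled by injectivity, so that orbits are handled with forward iterates
    alone. *)
Lemma orbit_iter (p : C2) (m n : nat) (q : C2) :
  Nat.iter m f p = Nat.iter n f q -> orbit f p q.
Proof.
  intros E. destruct (Nat.le_ge_cases m n) as [L|L].
  - exists (n - m)%nat; right. apply (iter_injective m).
    rewrite E, <- Nat.iter_add. f_equal; lia.
  - exists (m - n)%nat; left. apply (iter_injective n).
    rewrite <- E, <- Nat.iter_add. f_equal; lia.
Qed.

Lemma orbit_trans (p q r : C2) : orbit f p q -> orbit f q r -> orbit f p r.
Proof.
  intros [n [E|E]] [m [F|F]].
  - subst; rewrite <- Nat.iter_add. eexists; left; reflexivity.
  - apply (orbit_iter p n m r); now rewrite <- E.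
  - apply (orbit_iter p m n r). rewrite E, F, <- !Nat.iter_add. f_equal; lia.
  - subst; rewrite <- Nat.iter_add. eexists; right; reflexivity.
Qed.

Lemma mem_inW (X : Hopf f) (p : C2) : mem X p -> inW p.
Proof.
  destruct X as [X [p0 [Wp ->]]]; unfold mem; simpl; intros [n [->| ->]].
  - now apply iter_inW.
  - now apply iter_inW in Wp.
Qed.

Lemma mem_exists (X : Hopf f) : exists p, mem X p.
Proof. destruct X as [X [p [Wp ->]]]; exists p; apply orbit_refl. Qed.

Lemma mem_orbit (X : Hopf f) (p q : C2) : mem X p -> (mem X q <-> orbit f p q).
Proof.
  destruct X as [X [p0 [Wp ->]]]; unfold mem; simpl; intros H; split; intros H'.
  - apply orbit_trans with p0; [now apply orbit_sym|easy].
  - now apply orbit_trans with p.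
Qed.

Lemma mem_image (X : Hopf f) (p : C2) : mem X p -> mem X (f p).
Proof. intros H; apply (mem_orbit X p); [easy|]; exists 1%nat; now left. Qed.

Lemma mem_unique (X Y : Hopf f) (p : C2) : mem X p -> mem Y p -> X = Y.
Proof.
  intros HX HY.
  assert (E : proj1_sig X = proj1_sig Y).
  { apply functional_extensionality; intros q; apply propositional_extensionality.
    change (mem X q <-> mem Y q). rewrite (mem_orbit X p q HX), (mem_orbit Y p q HY). easy. }
  destruct X as [X PX], Y as [Y PY]; simpl in E; subst Y. f_equal; apply proof_irrelevance.
Qed.

(** * Charts and lifts *)

Lemma wnorm_continuous (e : R) (k : nat) (p : C2) : (0 < e)%R ->
  forall eps, (0 < eps)%R -> exists del, (0 < del)%R /\
    forall q, (Cmod (fst q - fst p) < del)%R -> (Cmod (snd q - snd p) < del)%R ->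
    (Rabs (wnorm e k q - wnorm e k p) < eps)%R.
Proof.
  intros He eps Heps.
  assert (Hc : continuity_pt (fun x => x ^ k)%R (Cmod (snd p))) by apply derivable_continuous_pt, derivable_pt_pow.
  destruct (Hc (eps / 2)%R ltac:(lra)) as [d [Hd Hd']].
  assert (Hlip : forall x y, (Rabs (Cmod x - Cmod y) <= Cmod (x - y))%R).
  { intros x y. pose proof (Cmod_triangle_minus x y). pose proof (Cmod_triangle_minus y x) as T.
    rewrite Cmod_minus_sym in T. apply Rabs_le; lra. }
  exists (Rmin d (eps / (2 * e))); split.
  { apply Rmin_pos; [easy|apply Rdiv_lt_0_compat; lra]. }
  intros q H1 H2.
  pose proof (Hlip (fst q) (fst p)) as L1. pose proof (Hlip (snd q) (snd p)) as L2.
  pose proof (Rmin_l d (eps / (2 * e))). pose proof (Rmin_r d (eps / (2 * e))).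
  assert (P2 : (Rabs (Cmod (snd q) ^ k - Cmod (snd p) ^ k) < eps / 2)%R).
  { destruct (Req_dec (Cmod (snd p)) (Cmod (snd q))) as [E|E].
    - rewrite E, Rminus_diag, Rabs_R0; lra.
    - apply (Hd' (Cmod (snd q))). split; [split; [exact I|exact E]|].
      simpl; unfold R_dist. lra. }
  unfold wnorm.
  replace (e * Cmod (fst q) + Cmod (snd q) ^ k - (e * Cmod (fst p) + Cmod (snd p) ^ k))%R
    with (e * (Cmod (fst q) - Cmod (fst p)) + (Cmod (snd q) ^ k - Cmod (snd p) ^ k))%R by ring.
  eapply Rle_lt_trans; [apply Rabs_triang|]. rewrite Rabs_mult, (Rabs_pos_eq e) by lra.
  assert (eps / 2 = e * (eps / (2 * e)))%R by (field; lra). nra.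
Qed.

Lemma locally_C2 (p : C2) (P : C2 -> Prop) (del : R) : (0 < del)%R ->
  (forall q, (Cmod (fst q - fst p) < del)%R -> (Cmod (snd q - snd p) < del)%R -> P q) ->
  @locally C2_US p P.
Proof.
  intros Hd H. assert (Hd2 : (0 < del / 2)%R) by lra.
  exists (mkposreal _ Hd2). intros q [[B1 B2] [B3 B4]].
  change (Rabs (Re (fst q) - Re (fst p)) < del / 2)%R in B1.
  change (Rabs (Im (fst q) - Im (fst p)) < del / 2)%R in B2.
  change (Rabs (Re (snd q) - Re (snd p)) < del / 2)%R in B3.
  change (Rabs (Im (snd q) - Im (snd p)) < del / 2)%R in B4.
  apply H; (eapply Rle_lt_trans; [apply Cmod_le_Rabs|]); replace del with (del / 2 + del / 2)%R by field.
  - exact (Rplus_lt_compat _ _ _ _ B1 B2).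
  - exact (Rplus_lt_compat _ _ _ _ B3 B4).
Qed.

(** The annulus [c < N < c / rho] for a norm [N] contracted by the factor [rho]. *)
Lemma chart_domain_exists (p : C2) : inW p -> exists U, chart_domain f U /\ U p.
Proof.
  intros Wp. destruct (contracting_norm f Hf) as (e & rho & k & He & Hr & Hk & HN).
  pose proof (wnorm_pos e k p He Wp) as Np.
  (* The midpoint of rho N(p) and N(p), which places [p] inside the annulus. *)
  set (c := (wnorm e k p * (1 + rho) / 2)%R).
  assert (N1 : (0 < wnorm e k p * rho)%R) by (apply Rmult_lt_0_compat; lra).
  assert (N2 : (wnorm e k p * rho < wnorm e k p * 1)%R) by (apply Rmult_lt_compat_l; lra).
  assert (Hc : (0 < c < wnorm e k p)%R) by (unfold c; split; lra).
  assert (Hc2 : (rho * wnorm e k p < c)%R) by (unfold c; lra).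
  exists (fun q => (c < wnorm e k q)%R /\ (rho * wnorm e k q < c)%R). split; [|lra].
  split; [|split].
  - intros q [H1 H2].
    destruct (wnorm_continuous e k q He (Rmin (wnorm e k q - c) (c - rho * wnorm e k q)))%R as [d [Hd Hd']].
    { apply Rmin_pos; lra. }
    apply (locally_C2 q _ d Hd). intros r R1 R2. specialize (Hd' r R1 R2).
    apply Rabs_def2 in Hd'.
    pose proof (Rmin_l (wnorm e k q - c) (c - rho * wnorm e k q)).
    pose proof (Rmin_r (wnorm e k q - c) (c - rho * wnorm e k q)).
    set (m := Rmin (wnorm e k q - c) (c - rho * wnorm e k q)) in *.
    assert (0 < m)%R by (apply Rmin_pos; lra). split; nra.
  - intros q [H1 _]. apply (wnorm_inW e k); [easy|lra].
  - assert (G : forall n q, (c < wnorm e k q)%R -> (rho * wnorm e k q < c)%R ->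
        (c < wnorm e k (Nat.iter n f q))%R -> n = O).
    { intros n q Q1 Q2 Q3. destruct n as [|n]; [easy|exfalso].
      assert (B : (wnorm e k (Nat.iter (S n) f q) <= rho * wnorm e k q)%R); [|lra].
      clear Q3. induction n as [|n IH]; [apply HN|].
      eapply Rle_trans; [apply HN|].
      assert (H : (0 <= wnorm e k (Nat.iter (S n) f q))%R).
      { unfold wnorm. pose proof (Cmod_ge_0 (fst (Nat.iter (S n) f q))).
        pose proof (pow_le _ k (Cmod_ge_0 (snd (Nat.iter (S n) f q)))).
        apply Rplus_le_le_0_compat; [apply Rmult_le_pos; lra|easy]. }
      pose proof (Rmult_le_compat_r _ rho 1 H ltac:(lra)) as G.
      rewrite Rmult_1_l in G. exact (Rle_trans _ _ _ G IH). }
    intros q r [Q1 Q2] [R1 R2] [n [E|E]]; subst.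
    + now rewrite (G n q Q1 Q2 R1).
    + now rewrite (G n r R1 R2 Q1).
Qed.

(** The source chart is cut down to the preimage under [phi] of a chart around [phi p], open by
    continuity. *)
Lemma chart_of_lift (s : Hopf f -> Hopf f) (phi : C2 -> C2) (X : Hopf f) (p : C2) :
  lifts phi s -> (forall p, inW p -> inW (phi p)) ->
  (forall p, inW p -> @continuous C2_US C2_US phi p) -> mem X p ->
  exists U V, chart_domain f U /\ chart_domain f V /\ U p /\ chart_expression s U V phi.
Proof.
  intros Hl HW Hc Hp. pose proof (mem_inW X p Hp) as Wp.
  destruct (chart_domain_exists p Wp) as [U0 [[O0 [W0 I0]] Up]].
  destruct (chart_domain_exists (phi p) (HW p Wp)) as [V [[OV [WV IV]] Vp]].
  exists (fun q => U0 q /\ V (phi q)), V. split; [|split; [easy|split; [easy|]]].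
  - split; [|split].
    + intros q [Q1 Q2]. apply filter_and; [now apply O0|].
      apply (Hc q (W0 q Q1) V). now apply OV.
    + intros q [Q1 _]; auto.
    + intros q r [Q1 _] [R1 _]; auto.
  - intros q [Q1 Q2]; split; [easy|]. intros Y HY; now apply Hl.
Qed.

Lemma conj_c_invol (p : C2) : conj_c (conj_c p) = p.
Proof. destruct p; unfold conj_c; simpl; now rewrite !Cconj_conj. Qed.

Lemma conj_c_continuous (p : C2) : @continuous C2_US C2_US conj_c p.
Proof.
  intros P [d Hd]. exists d. intros q [[B1 B2] [B3 B4]]. apply Hd.
  assert (G : forall x y, (Rabs (- x - - y) = Rabs (x - y))%R).
  { intros x y. replace (- x - - y)%R with (- (x - y))%R by ring. apply Rabs_Ropp. }
  repeat split; try easy.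
  - change (Rabs (- Im (fst q) - - Im (fst p)) < d)%R. rewrite G; exact B2.
  - change (Rabs (- Im (snd q) - - Im (snd p)) < d)%R. rewrite G; exact B4.
Qed.

Lemma holomorphic_continuous (g : C2 -> C2) : holomorphic_on inW g ->
  forall p, inW p -> @continuous C2_US C2_US g p.
Proof.
  intros H p Wp. exact (filterdiff_continuous (U := C2_NM) (V := C2_NM) g p (H p Wp)).
Qed.

Lemma antiholomorphic_continuous (g : C2 -> C2) : antiholomorphic_on inW g ->
  forall p, inW p -> @continuous C2_US C2_US g p.
Proof.
  intros H p Wp.
  apply (continuous_ext (fun p => conj_c (conj_c (g p)))); [intros; apply conj_c_invol|].
  apply (continuous_comp (U := C2_US) (V := C2_US) (W := C2_US) (fun p => conj_c (g p)) conj_c).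
  - now apply (holomorphic_continuous (fun p => conj_c (g p))).
  - apply conj_c_continuous.
Qed.

Lemma lift_holomorphic_map (s : Hopf f -> Hopf f) (phi : C2 -> C2) :
  lifts phi s -> (forall p, inW p -> inW (phi p)) -> holomorphic_on inW phi ->
  holomorphic_map s.
Proof.
  intros Hl HW Hh X p Hp.
  destruct (chart_of_lift s phi X p Hl HW (holomorphic_continuous phi Hh) Hp) as (U & V & CU & CV & Up & E).
  exists U, V, phi. repeat (split; [easy|]). intros q Uq. apply Hh. now apply CU.
Qed.

Lemma lift_antiholomorphic_map (s : Hopf f -> Hopf f) (phi : C2 -> C2) :
  lifts phi s -> (forall p, inW p -> inW (phi p)) -> antiholomorphic_on inW phi ->
  antiholomorphic_map s.
Proof.
  intros Hl HW Hh X p Hp.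
  destruct (chart_of_lift s phi X p Hl HW (antiholomorphic_continuous phi Hh) Hp) as (U & V & CU & CV & Up & E).
  exists U, V, phi. repeat (split; [easy|]). intros q Uq. apply Hh. now apply CU.
Qed.

Lemma lifts_unique (s s' : Hopf f -> Hopf f) (phi phi' : C2 -> C2) :
  lifts phi s -> lifts phi' s' -> (forall p, inW p -> phi p = phi' p) ->
  forall X, s X = s' X.
Proof.
  intros H H' E X. destruct (mem_exists X) as [p Hp].
  apply (mem_unique _ _ (phi p)); [now apply H|].
  rewrite E by now apply (mem_inW X). now apply H'.
Qed.

Lemma lifts_id : lifts (fun p => p) (fun X : Hopf f => X).
Proof. easy. Qed.

Lemma lifts_comp (s s' : Hopf f -> Hopf f) (phi phi' : C2 -> C2) :
  lifts phi s -> lifts phi' s' -> lifts (fun p => phi (phi' p)) (fun X => s (s' X)).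
Proof. intros H H' X p Hp. now apply H, H'. Qed.

(** The relation phi o phi = f gives an involution of the quotient because [f] acts trivially there;
    it also gives the inverse of [phi] as phi o g, where [g] is the inverse of [f]. *)
Lemma induced_odd_real_structure (phi g : C2 -> C2) :
  (forall p, inW p -> inW (phi p)) -> antiholomorphic_on inW phi ->
  (forall p, phi (f p) = f (phi p)) -> (forall p, phi (phi p) = f p) ->
  (forall p, g (f p) = p) -> (forall p, f (g p) = p) -> holomorphic_on inW g ->
  odd_real_structure (induced f phi).
Proof.
  intros HW Ha Hc Hs G1 G2 Hg.
  pose proof (induced_lifts f phi HW Hc) as Hl.
  assert (Wg : forall p, inW p -> inW (g p)).
  { intros p Wp. apply (contracting_inW f Hf). now rewrite G2. }
  split; [split|].
  - exact (lift_antiholomorphic_map _ phi Hl HW Ha).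
  - intros X. destruct (mem_exists X) as [p Hp].
    apply (mem_unique _ _ (f p)); [|now apply mem_image].
    rewrite <- Hs. now apply Hl, Hl.
  - exists phi; split; [|split; [easy|auto]].
    exists (fun p => phi (g p)). split; [|split; [|split; [easy|]]].
    + intros p Wp; auto.
    + intros p Wp. rewrite !Hs, G2. split; [|easy].
      rewrite <- (G1 (phi (g (phi p)))), <- Hc, G2, Hs. apply G1.
    + intros p Wp.
      apply (ex_filterdiff_comp' (U := C2_NM) (V := C2_NM) (W := C2_NM) g (fun q => conj_c (phi q))).
      * now apply Hg.
      * apply Ha; auto.
Qed.

(** An automorphism commuting with [f] descends to H_f, and identities between lifts become
    identities between the induced maps. Bijectivity and the fixed origin make [th] preserve W. *)
Lemma conjugate_equivalent (s : Hopf f -> Hopf f) (phi phi' th th' : C2 -> C2) :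
  lifts phi s ->
  (forall p, inW p -> inW (phi' p)) -> (forall p, phi' (f p) = f (phi' p)) ->
  (forall p, th' (th p) = p) -> (forall p, th (th' p) = p) ->
  th (RtoC 0, RtoC 0) = (RtoC 0, RtoC 0) ->
  (forall p, th (f p) = f (th p)) ->
  holomorphic_on inW th -> holomorphic_on inW th' ->
  (forall p, inW p -> th (phi p) = phi' (th p)) ->
  equivalent s (induced f phi').
Proof.
  intros Hl HW' Hc' T1 T2 T0 Tc Th Th' Hconj.
  assert (T0' : th' (RtoC 0, RtoC 0) = (RtoC 0, RtoC 0)) by (rewrite <- T0 at 1; apply T1).
  assert (Wt : forall p, inW p -> inW (th p)).
  { intros p Wp E. apply Wp. now rewrite <- (T1 p), E. }
  assert (Wt' : forall p, inW p -> inW (th' p)).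
  { intros p Wp E. apply Wp. now rewrite <- (T2 p), E. }
  assert (Tc' : forall p, th' (f p) = f (th' p)).
  { intros p. rewrite <- (T2 p) at 1. rewrite <- Tc. apply T1. }
  pose proof (induced_lifts f th Wt Tc) as L1.
  pose proof (induced_lifts f th' Wt' Tc') as L2.
  pose proof (induced_lifts f phi' HW' Hc') as L3.
  exists (induced f th), (induced f th'). split; [|split; [|split; [|split]]].
  - exact (lift_holomorphic_map _ th L1 Wt Th).
  - exact (lift_holomorphic_map _ th' L2 Wt' Th').
  - apply (lifts_unique (fun X => induced f th' (induced f th X)) (fun X => X) (fun p => th' (th p)) (fun p => p));
      [now apply lifts_comp|apply lifts_id|intros; apply T1].
  - apply (lifts_unique (fun X => induced f th (induced f th' X)) (fun X => X) (fun p => th (th' p)) (fun p => p));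
      [now apply lifts_comp|apply lifts_id|intros; apply T2].
  - apply (lifts_unique (induced f phi') (fun X => induced f th (s (induced f th' X))) phi' (fun p => th (phi (th' p)))).
    + easy.
    + apply (lifts_comp (induced f th) (fun X => s (induced f th' X)) th (fun p => phi (th' p))); [easy|].
      now apply lifts_comp.
    + intros p Wp. rewrite Hconj by auto. now rewrite T2.
Qed.

End Hopf_surface.

(** * Polynomial maps *)

Lemma holomorphic_of_components (g1 g2 : C2 -> C) (p : C2) :
  @ex_filterdiff C_AbsRing C2_NM C_NormedModule g1 (locally p) ->
  @ex_filterdiff C_AbsRing C2_NM C_NormedModule g2 (locally p) ->
  @ex_filterdiff C_AbsRing C2_NM C2_NM (fun q => (g1 q, g2 q)) (locally p).
Proof.
  intros H1 H2.
  apply (ex_filterdiff_ext (U := C2_NM) (V := C2_NM)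
    (fun q => plus ((g1 q, RtoC 0) : C2) ((RtoC 0, g2 q) : C2))).
  { intros q. unfold plus; simpl; unfold prod_plus, plus; simpl. f_equal; ring. }
  apply (ex_filterdiff_plus_fct (U := C2_NM) (V := C2_NM)).
  - apply (ex_filterdiff_comp' (U := C2_NM) (V := C_NormedModule) (W := C2_NM) g1 (fun z => (z, RtoC 0) : C2)); [easy|].
    apply ex_filterdiff_linear.
    apply (is_linear_prod (T := C_NormedModule) (U := C_NormedModule) (V := C_NormedModule));
      [apply (is_linear_id (V := C_NormedModule))|apply (is_linear_zero (U := C_NormedModule) (V := C_NormedModule))].
  - apply (ex_filterdiff_comp' (U := C2_NM) (V := C_NormedModule) (W := C2_NM) g2 (fun z => (RtoC 0, z) : C2)); [easy|].
    apply ex_filterdiff_linear.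
    apply (is_linear_prod (T := C_NormedModule) (U := C_NormedModule) (V := C_NormedModule));
      [apply (is_linear_zero (U := C_NormedModule) (V := C_NormedModule))|apply (is_linear_id (V := C_NormedModule))].
Qed.

Lemma ex_filterdiff_scal_pow (c : C) (l : nat) (g : C2 -> C) (p : C2) :
  @ex_filterdiff C_AbsRing C2_NM C_NormedModule g (locally p) ->
  @ex_filterdiff C_AbsRing C2_NM C_NormedModule (fun q => c * g q ^ l) (locally p).
Proof.
  intros H.
  apply (ex_filterdiff_comp' (U := C2_NM) (V := AbsRing_NormedModule C_AbsRing) (W := C_NormedModule)
    (fun q => c * g q ^ l) (fun z => z)); [|apply ex_filterdiff_linear, is_linear_to_C].
  assert (H' : @ex_filterdiff C_AbsRing C2_NM (AbsRing_NormedModule C_AbsRing) g (locally p)).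
  { apply (ex_filterdiff_comp' (U := C2_NM) (V := C_NormedModule) (W := AbsRing_NormedModule C_AbsRing) g (fun z => z));
      [easy|apply ex_filterdiff_linear, is_linear_from_C]. }
  assert (Hpow : @ex_filterdiff C_AbsRing C2_NM (AbsRing_NormedModule C_AbsRing) (fun q => g q ^ l) (locally p)).
  { induction l as [|l IH].
    - exact (ex_filterdiff_const (U := C2_NM) (V := AbsRing_NormedModule C_AbsRing) (RtoC 1)).
    - exact (ex_filterdiff_mult_fct (U := C2_NM) g (fun q => g q ^ l) p Cmult_comm H' IH). }
  apply (ex_filterdiff_mult_fct (U := C2_NM) (fun _ => c) (fun q => g q ^ l) p Cmult_comm); [|exact Hpow].
  apply (ex_filterdiff_const (U := C2_NM) (V := AbsRing_NormedModule C_AbsRing)).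
Qed.

Lemma pmap_holomorphic (A B : C) (l : nat) (G : C) (j : nat) (D : C) :
  holomorphic_on inW (pmap A B l G j D).
Proof.
  intros p _.
  assert (H1 : @ex_filterdiff C_AbsRing C2_NM C_NormedModule (fun q => fst q) (locally p))
    by (apply ex_filterdiff_linear, (is_linear_fst (U := C_NormedModule) (V := C_NormedModule))).
  assert (H2 : @ex_filterdiff C_AbsRing C2_NM C_NormedModule (fun q => snd q) (locally p))
    by (apply ex_filterdiff_linear, (is_linear_snd (U := C_NormedModule) (V := C_NormedModule))).
  assert (H1' := ex_filterdiff_scal_pow A 1 _ p H1). assert (H2' := ex_filterdiff_scal_pow D 1 _ p H2).
  apply (ex_filterdiff_ext (U := C2_NM) (V := C2_NM)
    (fun q => (A * fst q ^ 1 + B * snd q ^ l, G * fst q ^ j + D * snd q ^ 1))).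
  { intros q; now rewrite !Cpow_1_r. }
  apply holomorphic_of_components.
  - apply (ex_filterdiff_plus_fct (U := C2_NM) (V := C_NormedModule) (fun q => A * fst q ^ 1) (fun q => B * snd q ^ l)); [easy|].
    now apply ex_filterdiff_scal_pow.
  - apply (ex_filterdiff_plus_fct (U := C2_NM) (V := C_NormedModule) (fun q => G * fst q ^ j) (fun q => D * snd q ^ 1)); [|easy].
    now apply ex_filterdiff_scal_pow.
Qed.

Lemma holomorphic_on_ext (U : C2 -> Prop) (g h : C2 -> C2) :
  (forall p, g p = h p) -> holomorphic_on U g -> holomorphic_on U h.
Proof.
  intros E H p Up. exact (ex_filterdiff_ext (U := C2_NM) (V := C2_NM) g h E (H p Up)).
Qed.

Lemma tri_pmap (a b : C) (k : nat) (d : C) (p : C2) : tri a b k d p = pmap a b k 0 1 d p.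
Proof. unfold tri, pmap; f_equal; ring. Qed.

Lemma conj_c_amap (A B : C) (l : nat) (G : C) (j : nat) (D : C) (p : C2) :
  conj_c (amap A B l G j D p) = pmap (Cconj A) (Cconj B) l (Cconj G) j (Cconj D) p.
Proof.
  unfold amap, pmap, conj_c; simpl.
  rewrite !Cplus_conj, !Cmult_conj, !Cpow_conj, !Cconj_conj. easy.
Qed.

Lemma amap_antiholomorphic (A B : C) (l : nat) (G : C) (j : nat) (D : C) :
  antiholomorphic_on inW (amap A B l G j D).
Proof.
  unfold antiholomorphic_on.
  apply holomorphic_on_ext with (pmap (Cconj A) (Cconj B) l (Cconj G) j (Cconj D)).
  - intros p; now rewrite conj_c_amap.
  - apply pmap_holomorphic.
Qed.

(** * Conjugation of the normal forms *)

Lemma Cconj_RtoC (x : R) : Cconj (RtoC x) = RtoC x.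
Proof. apply injective_projections; simpl; ring. Qed.

Lemma RtoC_neq_0 (x : R) : (0 < x)%R -> RtoC x <> 0.
Proof. intros H E; apply RtoC_inj in E; lra. Qed.

Lemma Cconj_neq_0 (z : C) : z <> 0 -> Cconj z <> 0.
Proof.
  intros H E; apply H. rewrite <- (Cconj_conj z), E. apply Cconj_RtoC.
Qed.

(** Hilbert 90 in dimension one: s = x + conj A works unless it vanishes, and then A = - x, for
    which s = i works. *)
Lemma rotate_to_positive (A : C) (x : R) : (0 < x)%R -> A * Cconj A = RtoC x * RtoC x ->
  exists s : C, s <> 0 /\ s * A = RtoC x * Cconj s.
Proof.
  intros Hx E.
  destruct (excluded_middle_informative (RtoC x + Cconj A = 0)) as [H|H].
  - exists Ci. split.
    + intros H0. apply (f_equal Im) in H0. simpl in H0. lra.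
    + assert (HA : A = - RtoC x).
      { rewrite <- (Cconj_conj A). replace (Cconj A) with ((RtoC x + Cconj A) - RtoC x) by ring.
        rewrite H. apply injective_projections; simpl; ring. }
      rewrite HA. apply injective_projections; simpl; ring.
  - exists (RtoC x + Cconj A). split; [easy|].
    rewrite Cplus_conj, Cconj_conj, Cconj_RtoC.
    replace ((RtoC x + Cconj A) * A) with (RtoC x * A + A * Cconj A) by ring. rewrite E; ring.
Qed.

(** Solves [theta o phi = phi0 o theta] for [theta (z, w) = (s z + t w^k, u w)],
    where [phi0] is the standard square root. With [v = t / u^k] and
    [Y = s B / conj u^k] the condition on [t] is
    [x (conj v - v) = Y - b / (2 x)], which is solvable because the right-hand
    side is purely imaginary. *)
Lemma conjugating_coefficients (A B D b : C) (k : nat) (x y : R) :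
  (0 < x)%R -> (0 < y)%R ->
  A * Cconj A = RtoC x * RtoC x -> D * Cconj D = RtoC y * RtoC y ->
  A * Cconj B + B * Cconj D ^ k = b ->
  b = 0 \/ (b = 1 /\ A = D ^ k) ->
  (B = 0 /\ b = 0) \/ RtoC x = RtoC y ^ k ->
  exists s u t : C, s <> 0 /\ u <> 0 /\ s * A = RtoC x * Cconj s /\ u * D = RtoC y * Cconj u /\
    s * B + t * D ^ k = RtoC x * Cconj t + b / (2 * RtoC x) * Cconj u ^ k /\
    s * b = b * u ^ k /\ ((RtoC y * RtoC y) ^ k * t = RtoC x * RtoC x * t).
Proof.
  intros Hx Hy EA ED EB Hb Hk.
  assert (Nx := RtoC_neq_0 x Hx). assert (N2 := RtoC_neq_0 2 ltac:(lra)).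
  destruct (rotate_to_positive D y Hy ED) as [u [Nu Hu]].
  destruct Hk as [[-> ->]|Hk].
  (* Without off-diagonal terms the two coordinates are rotated independently and [t = 0]. *)
  { destruct (rotate_to_positive A x Hx EA) as [s [Ns Hs]].
    exists s, u, 0. repeat (split; [easy|]).
    rewrite Cconj_RtoC. repeat split; try (field; easy); ring. }
  assert (HU : u ^ k * D ^ k = RtoC x * Cconj u ^ k) by (rewrite <- Cpow_mult_l, Hu, Cpow_mult_l, Hk; easy).
  (* For b = 1, commuting with the contraction dictates s = u^k, and A = D^k makes this choice
     compatible with the twisted equation. *)
  assert (Hs : exists s : C, s <> 0 /\ s * A = RtoC x * Cconj s /\ s * b = b * u ^ k).
  { destruct Hb as [ ->|[-> HA]].
    - destruct (rotate_to_positive A x Hx EA) as [s [Ns Hs]]. exists s; repeat split; try easy; ring.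
    - exists (u ^ k). split; [now apply Cpow_nz|]. split; [|ring].
      now rewrite HA, Cpow_conj. }
  destruct Hs as (s & Ns & Hs & Hsb).
  set (U := u ^ k) in *. set (V := Cconj u ^ k) in *. set (P := D ^ k) in *.
  assert (NU : U <> 0) by now apply Cpow_nz.
  assert (NV : V <> 0) by now apply Cpow_nz, Cconj_neq_0.
  assert (HV : Cconj U = V) by (unfold U, V; now rewrite Cpow_conj).
  assert (HV' : Cconj V = U) by (rewrite <- HV; apply Cconj_conj).
  assert (HP : V * Cconj P = RtoC x * U).
  { apply (f_equal Cconj) in HU. rewrite !Cmult_conj, HV, HV', Cconj_RtoC in HU. exact HU. }
  assert (EB' : A * Cconj B + B * Cconj P = b) by (unfold P; rewrite Cpow_conj; exact EB).
  assert (Hb' : Cconj b = b) by (destruct Hb as [ ->|[-> _]]; apply Cconj_RtoC).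
  set (Y := s * B / V). set (Y' := Cconj s * Cconj B / U).
  assert (HY : Cconj Y = Y').
  { unfold Y, Y', Cdiv. rewrite !Cmult_conj, <- HV'. f_equal.
    apply Cinv_conj; easy. }
  (* The relation A conj B + B conj D^k = b multiplied by s / u^k; it says that b / (2 x) is the
     real part of Y. *)
  assert (S1 : RtoC x * (Y + Y') = b).
  { transitivity (s * (A * Cconj B + B * Cconj P) / U).
    - transitivity (s * B * (RtoC x * U) / (V * U) + (RtoC x * Cconj s) * Cconj B / U).
      + unfold Y, Y'; field; repeat split; easy.
      + rewrite <- HP, <- Hs. field; repeat split; easy.
    - rewrite EB'. replace (s * b / U) with (b * U / U) by (rewrite <- Hsb; easy). field; easy. }
  set (t := - U * (Y - b / (2 * RtoC x)) / (2 * RtoC x)).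
  assert (Ht : Cconj t = - V * (Y' - b / (2 * RtoC x)) / (2 * RtoC x)).
  { unfold t, Cdiv. rewrite !Cmult_conj, Copp_conj, HV. unfold Cminus. rewrite Cplus_conj, Copp_conj, HY, Cmult_conj, Hb'.
    rewrite !Cinv_conj by (now apply Cmult_neq_0).
    rewrite Cmult_conj, !Cconj_RtoC. easy. }
  exists s, u, t. repeat (split; [easy|]).
  split; [|split; [exact Hsb|]].
  - fold U V P. rewrite Ht.
    assert (HtP : t * P = - (RtoC x * V) * (Y - b / (2 * RtoC x)) / (2 * RtoC x)).
    { rewrite <- HU. unfold t. field; repeat split; easy. }
    rewrite HtP, <- S1.
    replace (s * B) with (Y * V) by (unfold Y; field; easy).
    field; repeat split; easy.
  - rewrite Cpow_mult_l, <- Hk. ring.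
Qed.

Lemma pmap_upper (A B : C) (l : nat) (D : C) (p : C2) :
  pmap A B l 0 1 D p = (A * fst p + B * snd p ^ l, D * snd p).
Proof. unfold pmap; f_equal; ring. Qed.

Lemma amap_upper (A B : C) (l : nat) (D : C) (p : C2) :
  amap A B l 0 1 D p = (A * Cconj (fst p) + B * Cconj (snd p) ^ l, D * Cconj (snd p)).
Proof. unfold amap; now rewrite pmap_upper. Qed.

Lemma amap_zero (A B : C) (l : nat) (G : C) (j : nat) (D : C) : (1 <= l)%nat -> (1 <= j)%nat ->
  amap A B l G j D (RtoC 0, RtoC 0) = (RtoC 0, RtoC 0).
Proof.
  intros Hl Hj. destruct l as [|l]; [lia|]. destruct j as [|j]; [lia|].
  unfold amap, pmap, conj_c; simpl. rewrite Cconj_RtoC. f_equal; ring.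
Qed.

Lemma square_root_inW (f phi : C2 -> C2) : contracting f ->
  (forall p, phi (phi p) = f p) -> phi (RtoC 0, RtoC 0) = (RtoC 0, RtoC 0) ->
  forall p, inW p -> inW (phi p).
Proof.
  intros Hf Hs H0 p Wp E. apply (contracting_inW f Hf) in Wp. apply Wp.
  rewrite <- Hs, E; exact H0.
Qed.

Lemma square_root_commutes (f phi : C2 -> C2) :
  (forall p, phi (phi p) = f p) -> forall p, phi (f p) = f (phi p).
Proof. intros H p; now rewrite <- !H. Qed.

Lemma square_root_odd (f phi : C2 -> C2) (a b : C) (k : nat) (d : C) :
  (forall p, f p = tri a b k d p) ->
  (0 < Cmod a < 1)%R -> (0 < Cmod d < 1)%R -> (1 <= k)%nat ->
  antiholomorphic_on inW phi -> (forall p, phi (phi p) = f p) ->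
  phi (RtoC 0, RtoC 0) = (RtoC 0, RtoC 0) ->
  odd_real_structure (induced f phi).
Proof.
  intros Hf Ha Hd Hk Hh Hs H0.
  pose proof (tri_contracting f a b k d Hf Ha Hd Hk) as Hc.
  destruct (tri_inv a b k d (Cmod_pos_neq_0 a ltac:(lra)) (Cmod_pos_neq_0 d ltac:(lra))) as [I1 I2].
  apply (induced_odd_real_structure f Hc phi (tri (/ a) (- b * / a * / d ^ k) k (/ d))); try easy.
  - now apply (square_root_inW f).
  - now apply square_root_commutes.
  - intros p; now rewrite Hf.
  - intros p; now rewrite Hf.
  - eapply holomorphic_on_ext; [intros p; symmetry; apply tri_pmap|apply pmap_holomorphic].
Qed.

(** The coefficients are read off at [(1, 0)] and [(0, 1)]. *)
Lemma square_coefficients (phi : C2 -> C2) (A B G D a b d : C) (l j k : nat) :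
  (1 <= l)%nat -> (1 <= j)%nat -> (1 <= k)%nat ->
  (forall p, inW p -> phi p = amap A B l G j D p) ->
  (forall p, inW p -> inW (phi p)) -> (forall p, inW p -> phi (phi p) = tri a b k d p) ->
  A * Cconj A + B * Cconj G ^ l = a /\ G * Cconj A ^ j + D * Cconj G = 0 /\
  A * Cconj B + B * Cconj D ^ l = b /\ G * Cconj B ^ j + D * Cconj D = d.
Proof.
  intros Hl Hj Hk Hphi HW Hs.
  assert (N1 := RtoC_neq_0 1 ltac:(lra)).
  assert (Z : forall n, (1 <= n)%nat -> RtoC 0 ^ n = 0) by (intros [|n] Hn; [lia|simpl; ring]).
  assert (W1 : inW (RtoC 1, RtoC 0)) by (apply inW_alt; now left).
  assert (W2 : inW (RtoC 0, RtoC 1)) by (apply inW_alt; now right).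
  assert (E1 : phi (RtoC 1, RtoC 0) = (A, G)).
  { rewrite Hphi by easy. unfold amap, pmap, conj_c; simpl. rewrite !Cconj_RtoC, Z, Cpow_1_l by easy. f_equal; ring. }
  assert (E2 : phi (RtoC 0, RtoC 1) = (B, D)).
  { rewrite Hphi by easy. unfold amap, pmap, conj_c; simpl. rewrite !Cconj_RtoC, Z, Cpow_1_l by easy. f_equal; ring. }
  pose proof (Hs _ W1) as F1. rewrite E1, Hphi in F1 by (rewrite <- E1; auto).
  pose proof (Hs _ W2) as F2. rewrite E2, Hphi in F2 by (rewrite <- E2; auto).
  unfold amap, pmap, conj_c, tri in F1, F2; cbn [fst snd] in F1, F2.
  rewrite Z in F1 by easy. rewrite Cpow_1_l in F2.
  pose proof (f_equal fst F1) as E11. pose proof (f_equal snd F1) as E12.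
  pose proof (f_equal fst F2) as E21. pose proof (f_equal snd F2) as E22.
  cbn [fst snd] in E11, E12, E21, E22.
  repeat split; [rewrite E11|rewrite E12|rewrite E21|rewrite E22]; ring.
Qed.

Lemma odd_lift (f : C2 -> C2) (s : Hopf f -> Hopf f) : odd_real_structure s ->
  exists phi, lifts phi s /\ antiholomorphic_on inW phi /\
    (forall p, inW p -> inW (phi p)) /\ (forall p, inW p -> phi (phi p) = f p).
Proof.
  intros [_ [phi [[psi [H1 [_ [H2 _]]]] [H3 H4]]]].
  exists phi; repeat split; try easy. intros p Wp; now apply H1.
Qed.

(** Each of the two cross terms contributes b / 2 to the coefficient of w^k, since y^k = x when b is
    nonzero. *)
Lemma upper_standard_square (b : C) (k : nat) (x y : R) : (0 < x)%R ->
  b = 0 \/ (b = 1 /\ RtoC x = RtoC y ^ k) ->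
  forall p, amap (RtoC x) (b / (2 * RtoC x)) k 0 1 (RtoC y) (amap (RtoC x) (b / (2 * RtoC x)) k 0 1 (RtoC y) p) =
    tri (RtoC x * RtoC x) b k (RtoC y * RtoC y) p.
Proof.
  intros Hx Hb p.
  assert (Nx := RtoC_neq_0 x Hx). assert (N2 := RtoC_neq_0 2 ltac:(lra)).
  unfold amap at 1. rewrite conj_c_amap. unfold pmap, tri; simpl.
  unfold Cdiv. rewrite Cmult_conj, Cinv_conj, Cmult_conj by (now apply Cmult_neq_0).
  rewrite !Cconj_RtoC.
  apply injective_projections; simpl; [|ring].
  destruct Hb as [ ->|[-> E]].
  - rewrite Cconj_RtoC. field; easy.
  - rewrite Cconj_RtoC.
    replace ((0 * (fst p * 1) + RtoC y * snd p) ^ k) with (RtoC x * snd p ^ k)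
      by (rewrite E, <- Cpow_mult_l; f_equal; ring).
    field; easy.
Qed.

Lemma Cmod_pow_lt_1 (d : C) (k : nat) : (0 < Cmod d < 1)%R -> (1 <= k)%nat ->
  (0 < Cmod (d ^ k) < 1)%R.
Proof.
  intros Hd Hk. rewrite Cmod_pow. split; [apply pow_lt; lra|].
  destruct k as [|m]; [lia|]. simpl.
  assert (0 < Cmod d ^ m)%R by (apply pow_lt; lra).
  assert (Cmod d ^ m <= 1)%R by (rewrite <- (pow1 m); apply pow_incr; lra).
  nra.
Qed.

(** * Types III, II_a and II_b: the contractions (d^k z + b w^k, d w) *)

Section Upper_triangular.

Variables (f : C2 -> C2) (b d : C) (k : nat).
Hypothesis Hd : (0 < Cmod d < 1)%R.
Hypothesis Hk : (1 <= k)%nat.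
Hypothesis Hb : (b = 0 /\ (2 <= k)%nat) \/ b = 1.
Hypothesis Hf : forall p, f p = tri (d ^ k) b k d p.

(** For b = 0 the diagonal normal form applies: a term G z^j would need |d|^(k j) = |d|, impossible
    for k >= 2, and a term B w^l needs l = k. The value k = 1 with b = 0 is a homothety and belongs
    to type IV. *)
Lemma upper_classification (phi : C2 -> C2) :
  antiholomorphic_on inW phi -> (forall p, inW p -> inW (phi p)) ->
  (forall p, inW p -> phi (phi p) = f p) ->
  exists A B D, (forall p, inW p -> phi p = amap A B k 0 1 D p) /\
    A * Cconj A = d ^ k /\ D * Cconj D = d /\ A * Cconj B + B * Cconj D ^ k = b /\
    (b = 0 \/ (b = 1 /\ A = D ^ k)).
Proof.
  intros Hh HW Hs.
  assert (Hs' : forall p, inW p -> phi (phi p) = tri (d ^ k) b k d p) by (intros; rewrite Hs, Hf; easy).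
  assert (Nd : d <> 0) by (apply Cmod_pos_neq_0; lra).
  destruct Hb as [[-> Hk2]| ->].
  - destruct (diag_normal_form (d ^ k) d phi (Cmod_pow_lt_1 d k Hd Hk) Hd Hh HW) as (A & B & l & G & j & D & Hl & Hj & Hphi & HA & HB & HG & HD).
    { intros p Wp. rewrite Hs' by easy. unfold tri; f_equal; ring. }
    assert (G0 : G = 0).
    { apply NNPP; intros H. specialize (HG H). apply (f_equal Cmod) in HG.
      rewrite Cmod_conj, !Cmod_pow, <- pow_mult in HG. rewrite <- (pow_1 (Cmod d)) in HG at 2.
      apply pow_inj_lt_1 in HG; [nia|easy]. }
    subst G.
    assert (Hphi' : forall p, inW p -> phi p = amap A B k 0 1 D p).
    { intros p Wp. rewrite Hphi by easy. unfold amap, pmap; f_equal; [|ring].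
      destruct (excluded_middle_informative (B = 0)) as [ ->|NB]; [ring|].
      specialize (HB NB). apply (f_equal Cmod) in HB.
      rewrite Cmod_conj, !Cmod_pow in HB. apply pow_inj_lt_1 in HB; [now subst|easy]. }
    destruct (square_coefficients phi A B 0 D (d ^ k) 0 d k 1 k Hk (le_n 1) Hk Hphi' HW Hs') as (E1 & E2 & E3 & E4).
    exists A, B, D. split; [easy|].
    assert (Z : Cconj 0 ^ k = 0) by (rewrite Cconj_RtoC; destruct k; [lia|simpl; ring]).
    rewrite Z in E1. split; [rewrite <- E1; ring|]. split; [rewrite <- E4; ring|]. auto.
  - destruct (tri_normal_form d k phi Hd Hk Hh HW Hs') as (B & D & _ & Hphi).
    destruct (square_coefficients phi (D ^ k) B 0 D (d ^ k) 1 d k 1 k Hk (le_n 1) Hk Hphi HW Hs') as (E1 & E2 & E3 & E4).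
    exists (D ^ k), B, D. split; [easy|].
    assert (Z : Cconj 0 ^ k = 0) by (rewrite Cconj_RtoC; destruct k; [lia|simpl; ring]).
    rewrite Z in E1. split; [rewrite <- E1; ring|]. split; [rewrite <- E4; ring|]. auto.
Qed.

(** The second coordinate of phi o phi = f gives d = D conj D, a squared modulus. *)
Lemma upper_positive (s : Hopf f -> Hopf f) : odd_real_structure s -> Cpositive d.
Proof.
  intros Ho. destruct (odd_lift f s Ho) as (phi & _ & Hh & HW & Hs).
  destruct (upper_classification phi Hh HW Hs) as (A & B & D & _ & _ & ED & _).
  rewrite <- Cmod2_conj in ED.
  assert (Nd : d <> 0) by (apply Cmod_pos_neq_0; lra).
  rewrite <- ED. split; simpl; [easy|].
  assert (D <> 0).
  { intros ->. apply Nd. rewrite <- ED, Cmod_0. simpl. f_equal; ring. }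
  apply Cmod_gt_0 in H. nra.
Qed.

Variable y : R.
Hypothesis Hy : (0 < y)%R.
Hypothesis Hyd : d = RtoC y * RtoC y.
Variable phi0 : C2 -> C2.
Hypothesis Hphi0 : forall p,
  phi0 p = amap (RtoC y ^ k) (b / (2 * RtoC y ^ k)) k 0 1 (RtoC y) p.

Lemma upper_standard : (forall p, phi0 (phi0 p) = f p) /\
  phi0 (RtoC 0, RtoC 0) = (RtoC 0, RtoC 0) /\ antiholomorphic_on inW phi0.
Proof.
  assert (Hx : (0 < y ^ k)%R) by now apply pow_lt.
  split; [|split].
  - intros p. rewrite !Hphi0, Hf, Hyd, Cpow_mult_l, <- RtoC_pow.
    apply upper_standard_square; [easy|]. destruct Hb as [[-> _]| ->]; [now left|right].
    now rewrite RtoC_pow.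
  - rewrite Hphi0. now apply amap_zero.
  - replace phi0 with (amap (RtoC y ^ k) (b / (2 * RtoC y ^ k)) k 0 1 (RtoC y))
      by (apply functional_extensionality; intros; now rewrite Hphi0).
    apply amap_antiholomorphic.
Qed.

Lemma upper_exists : odd_real_structure (induced f phi0).
Proof.
  destruct upper_standard as (H1 & H2 & H3).
  now apply (square_root_odd f phi0 (d ^ k) b k d Hf (Cmod_pow_lt_1 d k Hd Hk) Hd Hk).
Qed.

Lemma upper_equivalent (s : Hopf f -> Hopf f) : odd_real_structure s ->
  equivalent s (induced f phi0).
Proof.
  intros Ho. destruct (odd_lift f s Ho) as (phi & Hl & Hh & HW & Hs).
  destruct (upper_classification phi Hh HW Hs) as (A & B & D & Hphi & EA & ED & EB & Hb2).
  destruct upper_standard as (S1 & S2 & S3).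
  assert (Hx : (0 < y ^ k)%R) by now apply pow_lt.
  pose proof (tri_contracting f _ _ _ _ Hf (Cmod_pow_lt_1 d k Hd Hk) Hd Hk) as Hc.
  destruct (conjugating_coefficients A B D b k (y ^ k) y Hx Hy) as (u1 & u & t & N1 & Nu & E1 & E2 & E3 & E4 & E5).
  { rewrite EA, Hyd, Cpow_mult_l, RtoC_pow. easy. }
  { now rewrite ED. }
  { easy. }
  { easy. }
  { right; apply RtoC_pow. }
  rewrite RtoC_pow, <- Cpow_mult_l, <- Hyd in *.
  assert (Nuk : u ^ k <> 0) by now apply Cpow_nz.
  apply (conjugate_equivalent f Hc s phi phi0 (pmap u1 t k 0 1 u)
    (pmap (/ u1) (- t * / u1 * / u ^ k) k 0 1 (/ u))); try easy.
  - now apply (square_root_inW f).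
  - now apply square_root_commutes.
  - intros [z w]; rewrite !pmap_upper; cbn [fst snd]. rewrite Cpow_mult_l.
    apply injective_projections; cbn [fst snd]; field; easy.
  - intros [z w]; rewrite !pmap_upper; cbn [fst snd]. rewrite Cpow_mult_l, Cpow_inv by easy.
    apply injective_projections; cbn [fst snd]; field; easy.
  - rewrite pmap_upper; cbn [fst snd]. destruct k; [lia|]. f_equal; simpl; ring.
  - intros p. rewrite !Hf, !pmap_upper. unfold tri; cbn [fst snd]. rewrite !Cpow_mult_l.
    apply injective_projections; cbn [fst snd]; [|ring].
    transitivity (u1 * d ^ k * fst p + (u1 * b + d ^ k * t) * snd p ^ k); [ring|].
    rewrite E4. ring.
  - apply pmap_holomorphic.
  - apply pmap_holomorphic.
  - intros p Wp. rewrite Hphi, Hphi0 by easy.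
    rewrite !amap_upper, !pmap_upper; cbn [fst snd].
    rewrite !Cplus_conj, !Cmult_conj, !Cpow_conj, !Cpow_mult_l.
    set (z := Cconj (fst p)). set (w := Cconj (snd p)).
    apply injective_projections; cbn [fst snd].
    + transitivity (u1 * A * z + (u1 * B + t * D ^ k) * w ^ k); [ring|].
      rewrite E1, E3. ring.
    + transitivity (u * D * w); [ring|]. rewrite E2. ring.
Qed.

End Upper_triangular.

(** * Diagonal contractions *)

Lemma pmap_lower (A G : C) (j : nat) (D : C) (p : C2) :
  pmap A 0 1 G j D p = (A * fst p, G * fst p ^ j + D * snd p).
Proof. unfold pmap; f_equal; ring. Qed.

Lemma amap_lower (A G : C) (j : nat) (D : C) (p : C2) :
  amap A 0 1 G j D p = (A * Cconj (fst p), G * Cconj (fst p) ^ j + D * Cconj (snd p)).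
Proof. unfold amap; now rewrite pmap_lower. Qed.

Lemma pmap_linear (A B G D : C) (p : C2) :
  pmap A B 1 G 1 D p = (A * fst p + B * snd p, G * fst p + D * snd p).
Proof. unfold pmap; now rewrite !Cpow_1_r. Qed.

Lemma amap_linear (A B G D : C) (p : C2) :
  amap A B 1 G 1 D p =
  (A * Cconj (fst p) + B * Cconj (snd p), G * Cconj (fst p) + D * Cconj (snd p)).
Proof. unfold amap; now rewrite pmap_linear. Qed.

Lemma Cinv_neq_0 (z : C) : z <> 0 -> / z <> 0.
Proof.
  intros Hz E. apply (RtoC_neq_0 1 ltac:(lra)).
  rewrite <- (Cinv_r z Hz), E. ring.
Qed.

Lemma mult_conj_positive (A a : C) : a <> 0 -> A * Cconj A = a -> Cpositive a.
Proof.
  intros Na E. rewrite <- Cmod2_conj in E. rewrite <- E. split; simpl; [easy|].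
  assert (NA : A <> 0).
  { intros ->. apply Na. rewrite <- E, Cmod_0. simpl. f_equal; ring. }
  apply Cmod_gt_0 in NA. nra.
Qed.

Lemma Cpositive_sqrt (a : C) : Cpositive a ->
  (0 < sqrt (Re a))%R /\ a = RtoC (sqrt (Re a)) * RtoC (sqrt (Re a)).
Proof.
  intros [Hi Hr]. split; [now apply sqrt_lt_R0|].
  rewrite <- RtoC_mult, sqrt_sqrt by lra. destruct a as [x y]; simpl in *; now subst y.
Qed.

Section Diagonal.

Variables (f : C2 -> C2) (a d : C).
Hypothesis Ha : (0 < Cmod a < 1)%R.
Hypothesis Hd : (0 < Cmod d < 1)%R.
Hypothesis Hf : forall p, f p = (a * fst p, d * snd p).

Lemma diag_tri (p : C2) : f p = tri a 0 1 d p.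
Proof. rewrite Hf; unfold tri; f_equal; ring. Qed.

Lemma diag_contracting : contracting f.
Proof. exact (tri_contracting f a 0 1 d diag_tri Ha Hd (le_n 1)). Qed.

Lemma linear_square_root_odd (A B G D : C) (phi0 : C2 -> C2) :
  (forall p, phi0 p = amap A B 1 G 1 D p) -> (forall p, phi0 (phi0 p) = f p) ->
  odd_real_structure (induced f phi0).
Proof.
  intros H0 Hs.
  apply (square_root_odd f phi0 a 0 1 d diag_tri Ha Hd (le_n 1)); [|easy|].
  - replace phi0 with (amap A B 1 G 1 D) by (apply functional_extensionality; intros; now rewrite H0).
    apply amap_antiholomorphic.
  - rewrite H0. now apply amap_zero.
Qed.

(** In matrix terms the last four equations are P M = M0 conj P, where P has rows (p, q) and (r, t);
    the two equations before them say that P commutes with diag(a, d). The inverse of P is its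
    adjugate divided by the determinant. *)
Lemma linear_equivalent (A B G D A0 B0 G0 D0 p q r t : C) (phi phi0 : C2 -> C2)
    (s : Hopf f -> Hopf f) :
  lifts phi s -> (forall v, inW v -> phi v = amap A B 1 G 1 D v) ->
  (forall v, phi0 v = amap A0 B0 1 G0 1 D0 v) -> (forall v, phi0 (phi0 v) = f v) ->
  p * t - q * r <> 0 -> q * d = a * q -> r * a = d * r ->
  p * A + q * G = A0 * Cconj p + B0 * Cconj r ->
  p * B + q * D = A0 * Cconj q + B0 * Cconj t ->
  r * A + t * G = G0 * Cconj p + D0 * Cconj r ->
  r * B + t * D = G0 * Cconj q + D0 * Cconj t ->
  equivalent s (induced f phi0).
Proof.
  intros Hl Hphi H0 Hs Ndet Eq Er E1 E2 E3 E4.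
  set (det := p * t - q * r) in *.
  apply (conjugate_equivalent f diag_contracting s phi phi0 (pmap p q 1 r 1 t)
    (pmap (t / det) (- q / det) 1 (- r / det) 1 (p / det))); try easy.
  - apply (square_root_inW f); [apply diag_contracting|easy|].
    rewrite H0; now apply amap_zero.
  - now apply square_root_commutes.
  - intros [z w]; rewrite !pmap_linear; cbn [fst snd].
    apply injective_projections; cbn [fst snd]; unfold det; field; exact Ndet.
  - intros [z w]; rewrite !pmap_linear; cbn [fst snd].
    apply injective_projections; cbn [fst snd]; unfold det; field; exact Ndet.
  - rewrite pmap_linear; cbn [fst snd]. f_equal; ring.
  - intros v. rewrite !Hf, !pmap_linear; cbn [fst snd]. apply injective_projections; cbn [fst snd].
    + transitivity (a * p * fst v + (q * d) * snd v); [ring|]. rewrite Eq; ring.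
    + transitivity ((r * a) * fst v + d * t * snd v); [ring|]. rewrite Er; ring.
  - apply pmap_holomorphic.
  - apply pmap_holomorphic.
  - intros v Wv. rewrite Hphi, H0 by easy. rewrite !amap_linear, !pmap_linear; cbn [fst snd].
    rewrite !Cplus_conj, !Cmult_conj.
    set (z := Cconj (fst v)). set (w := Cconj (snd v)).
    apply injective_projections; cbn [fst snd].
    + transitivity ((p * A + q * G) * z + (p * B + q * D) * w); [ring|]. rewrite E1, E2; ring.
    + transitivity ((r * A + t * G) * z + (r * B + t * D) * w); [ring|]. rewrite E3, E4; ring.
Qed.

(** The mirror image of the upper triangular case: the possible resonance is a^j = d, so
    [conjugating_coefficients] is called with the coordinates exchanged and b = 0. *)
Lemma lower_equivalent (A G D : C) (j : nat) (x y : R) (phi phi0 : C2 -> C2)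
    (s : Hopf f -> Hopf f) :
  (1 <= j)%nat -> (0 < x)%R -> (0 < y)%R ->
  a = RtoC x * RtoC x -> d = RtoC y * RtoC y ->
  lifts phi s -> (forall p, inW p -> phi p = amap A 0 1 G j D p) ->
  A * Cconj A = a -> D * Cconj D = d -> D * Cconj G + G * Cconj A ^ j = 0 ->
  G = 0 \/ RtoC y = RtoC x ^ j ->
  (forall p, phi0 p = amap (RtoC x) 0 1 0 1 (RtoC y) p) ->
  equivalent s (induced f phi0).
Proof.
  intros Hj Hx Hy Exa Eyd Hl Hphi EA ED EG Hyx H0.
  assert (Hs : forall p, phi0 (phi0 p) = f p).
  { intros p. rewrite !H0, Hf, !amap_lower; cbn [fst snd].
    rewrite !Cplus_conj, !Cmult_conj, !Cpow_conj, !Cconj_conj, !Cconj_RtoC, Exa, Eyd.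
    apply injective_projections; cbn [fst snd]; ring. }
  destruct (conjugating_coefficients D G A 0 j y x Hy Hx) as (u & s1 & t & Nu & Ns & E1 & E2 & E3 & _ & E5).
  { now rewrite ED. }
  { now rewrite EA. }
  { easy. }
  { now left. }
  { destruct Hyx as [HG|HG]; [now left|now right]. }
  assert (Nsj : s1 ^ j <> 0) by now apply Cpow_nz.
  assert (Ny := RtoC_neq_0 y Hy). assert (N2 := RtoC_neq_0 2 ltac:(lra)).
  replace (0 / (2 * RtoC y)) with (RtoC 0) in E3 by (field; easy).
  rewrite <- Exa, <- Eyd in E5.
  apply (conjugate_equivalent f diag_contracting s phi phi0 (pmap s1 0 1 t j u)
    (pmap (/ s1) 0 1 (- t * / u * / s1 ^ j) j (/ u))); try easy.
  - apply (square_root_inW f); [apply diag_contracting|easy|].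
    rewrite H0; now apply amap_zero.
  - now apply square_root_commutes.
  - intros [z w]; rewrite !pmap_lower; cbn [fst snd]. rewrite Cpow_mult_l.
    apply injective_projections; cbn [fst snd]; field; easy.
  - intros [z w]; rewrite !pmap_lower; cbn [fst snd]. rewrite Cpow_mult_l, Cpow_inv by easy.
    apply injective_projections; cbn [fst snd]; field; easy.
  - rewrite pmap_lower; cbn [fst snd]. destruct j; [lia|]. f_equal; simpl; ring.
  - intros p. rewrite !Hf, !pmap_lower; cbn [fst snd]. rewrite Cpow_mult_l.
    apply injective_projections; cbn [fst snd]; [ring|].
    transitivity ((a ^ j * t) * fst p ^ j + u * (d * snd p)); [ring|]. rewrite E5; ring.
  - apply pmap_holomorphic.
  - apply pmap_holomorphic.
  - intros p Wp. rewrite Hphi, H0 by easy.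
    rewrite !amap_lower, !pmap_lower; cbn [fst snd].
    rewrite !Cplus_conj, !Cmult_conj, !Cpow_conj, !Cpow_mult_l.
    set (z := Cconj (fst p)). set (w := Cconj (snd p)).
    apply injective_projections; cbn [fst snd].
    + transitivity (s1 * A * z); [ring|]. rewrite E2; ring.
    + transitivity ((u * G + t * A ^ j) * z ^ j + u * D * w); [ring|].
      rewrite E1, E3. ring.
Qed.

(** B <> 0 gives d^l = conj a. If G = 0, then a = A conj A is real, so a = d^l, which is excluded.
    If G <> 0, then also a^j = conj d, and comparing moduli gives l = j = 1 and d = conj a; now a
    cannot be real, which removes the diagonal terms. *)
Lemma diag_classification (phi : C2 -> C2) : (forall r, a <> d ^ r) ->
  antiholomorphic_on inW phi -> (forall p, inW p -> inW (phi p)) ->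
  (forall p, inW p -> phi (phi p) = f p) ->
  (exists A G j D, (1 <= j)%nat /\ (forall p, inW p -> phi p = amap A 0 1 G j D p) /\
     A * Cconj A = a /\ D * Cconj D = d /\ D * Cconj G + G * Cconj A ^ j = 0 /\
     (G = 0 \/ a ^ j = d)) \/
  (exists B G, (forall p, inW p -> phi p = amap 0 B 1 G 1 0 p) /\
     d = Cconj a /\ Im a <> 0%R /\ B * Cconj G = a).
Proof.
  intros Hr Hh HW Hs.
  assert (Na : a <> 0) by (apply Cmod_pos_neq_0; lra).
  assert (Nd : d <> 0) by (apply Cmod_pos_neq_0; lra).
  assert (Hs' : forall p, inW p -> phi (phi p) = tri a 0 1 d p) by (intros; rewrite Hs, diag_tri; easy).
  destruct (diag_normal_form a d phi Ha Hd Hh HW) as (A & B & l & G & j & D & Hl & Hj & Hphi & HA & HB & HG & HD).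
  { intros p Wp. now rewrite Hs, Hf. }
  destruct (square_coefficients phi A B G D a 0 d l j 1 Hl Hj (le_n 1) Hphi HW Hs') as (E1 & E2 & E3 & E4).
  assert (Z : forall n, (1 <= n)%nat -> Cconj 0 ^ n = 0) by (intros [|n] Hn; [lia|rewrite Cconj_RtoC; simpl; ring]).
  destruct (excluded_middle_informative (B = 0)) as [B0|NB].
  - left. subst B. rewrite Z in E4 by easy.
    exists A, G, j, D. split; [easy|]. split.
    { intros p Wp. rewrite Hphi by easy. unfold amap, pmap; f_equal; ring. }
    assert (ED : D * Cconj D = d) by (rewrite <- E4; ring).
    split; [rewrite <- E1; ring|]. split; [easy|]. split; [rewrite <- E2; ring|].
    destruct (excluded_middle_informative (G = 0)) as [G0|NG]; [now left|right].
    rewrite (HG NG), <- ED, Cmult_conj, Cconj_conj; ring.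
  - destruct (excluded_middle_informative (G = 0)) as [G0|NG].
    { exfalso. subst G. rewrite Z in E1 by easy.
      apply (Hr l). rewrite (HB NB), <- E1, Cplus_conj, !Cmult_conj, Cconj_conj, Cconj_RtoC. ring. }
    right. specialize (HB NB). specialize (HG NG).
    assert (Hlj : l = 1%nat /\ j = 1%nat).
    { assert (E : (Cmod d ^ (l * j) = Cmod d ^ 1)%R).
      { rewrite pow_mult, pow_1, <- Cmod_pow, HB, Cmod_conj, <- Cmod_pow, HG. apply Cmod_conj. }
      apply pow_inj_lt_1 in E; [|easy]. nia. }
    destruct Hlj as [-> ->]. rewrite Cpow_1_r in HB, HG.
    assert (Hne : a <> Cconj a) by (intros E; apply (Hr 1%nat); rewrite Cpow_1_r, HB; exact E).
    assert (A0 : A = 0) by (apply NNPP; intros H; now apply Hne, HA).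
    assert (D0 : D = 0).
    { apply NNPP; intros H. apply Hne. specialize (HD H). rewrite HB, Cconj_conj in HD. symmetry; exact HD. }
    subst A D. exists B, G. split; [exact Hphi|]. split; [easy|]. split.
    + intros Hi. apply Hne. destruct a as [x y]; simpl in Hi; subst y. apply injective_projections; simpl; ring.
    + rewrite <- E1, Cpow_1_r. ring.
Qed.

Lemma diag_positive_exists (x y : R) (phi0 : C2 -> C2) :
  a = RtoC x * RtoC x -> d = RtoC y * RtoC y ->
  (forall p, phi0 p = amap (RtoC x) 0 1 0 1 (RtoC y) p) ->
  odd_real_structure (induced f phi0).
Proof.
  intros Ex Ey H0. apply (linear_square_root_odd (RtoC x) 0 0 (RtoC y)); [easy|].
  intros p. rewrite !H0, !amap_linear, Hf; cbn [fst snd].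
  rewrite !Cplus_conj, !Cmult_conj, !Cconj_conj, !Cconj_RtoC, Ex, Ey.
  apply injective_projections; cbn [fst snd]; ring.
Qed.

End Diagonal.

(** * Types II_c', IV *)

Section Conjugate_pair.

Variables (f : C2 -> C2) (a beta : C) (phi0 : C2 -> C2).
Hypothesis Ha : (0 < Cmod a < 1)%R.
Hypothesis Hf : forall p, f p = (a * fst p, Cconj a * snd p).
Hypothesis Hbeta : beta * beta = a.
Hypothesis Hphi0 : forall p, phi0 p = amap 0 beta 1 (Cconj beta) 1 0 p.

Lemma conjugate_pair_square (p : C2) : phi0 (phi0 p) = f p.
Proof.
  rewrite !Hphi0, !amap_linear, Hf; cbn [fst snd].
  rewrite !Cplus_conj, !Cmult_conj, !Cconj_conj, !Cconj_RtoC, <- Hbeta, Cmult_conj.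
  apply injective_projections; cbn [fst snd]; ring.
Qed.

Lemma conjugate_pair_Cmod : (0 < Cmod (Cconj a) < 1)%R.
Proof. now rewrite Cmod_conj. Qed.

Lemma conjugate_pair_exists : odd_real_structure (induced f phi0).
Proof.
  apply (linear_square_root_odd f a (Cconj a) Ha conjugate_pair_Cmod Hf 0 beta (Cconj beta) 0);
  [easy|exact conjugate_pair_square].
Qed.

(** Scaling the first coordinate by beta / B turns B into beta; then B conj G = beta^2 turns G into
    conj beta. *)
Lemma conjugate_pair_equivalent (B G : C) (phi : C2 -> C2) (s : Hopf f -> Hopf f) :
  lifts phi s -> (forall p, inW p -> phi p = amap 0 B 1 G 1 0 p) -> B * Cconj G = a ->
  equivalent s (induced f phi0).
Proof.
  intros Hl Hphi EB.
  assert (Na : a <> 0) by (apply Cmod_pos_neq_0; lra).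
  assert (NB : B <> 0) by (intros ->; apply Na; rewrite <- EB; ring).
  assert (Nb : beta <> 0) by (intros ->; apply Na; rewrite <- Hbeta; ring).
  assert (N1 := RtoC_neq_0 1 ltac:(lra)).
  apply (linear_equivalent f a (Cconj a) Ha conjugate_pair_Cmod Hf 0 B G 0 0 beta (Cconj beta) 0
    (beta / B) 0 0 1 phi phi0 s Hl Hphi Hphi0 conjugate_pair_square).
  - replace (beta / B * 1 - 0 * 0) with (beta / B) by ring.
    unfold Cdiv. apply Cmult_neq_0; [easy|]. now apply Cinv_neq_0.
  - ring.
  - ring.
  - rewrite Cconj_RtoC; ring.
  - rewrite !Cconj_RtoC. field; easy.
  - unfold Cdiv. rewrite Cmult_conj, Cinv_conj, Cconj_RtoC by easy.
    assert (EG : G = Cconj beta * Cconj beta / Cconj B).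
    { rewrite <- Cmult_conj, Hbeta, <- EB, Cmult_conj, Cconj_conj. field. now apply Cconj_neq_0. }
    rewrite EG. field. now apply Cconj_neq_0.
  - rewrite !Cconj_RtoC. ring.
Qed.

End Conjugate_pair.

(** * Type IV: homotheties *)

Section Homothety.

Variables (f : C2 -> C2) (a : C).
Hypothesis Ha : (0 < Cmod a < 1)%R.
Hypothesis Hf : forall p, f p = (a * fst p, a * snd p).

(** Equal moduli force both exponents to be 1, so phi is antilinear on W. Its first row is not zero,
    because a is not, and a nonzero entry of it already requires a = conj a. *)
Lemma homothety_classification (phi : C2 -> C2) :
  antiholomorphic_on inW phi -> (forall p, inW p -> inW (phi p)) ->
  (forall p, inW p -> phi (phi p) = f p) ->
  exists A B G D, (forall p, inW p -> phi p = amap A B 1 G 1 D p) /\ a = Cconj a /\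
    A * Cconj A + B * Cconj G = a /\ G * Cconj A + D * Cconj G = 0 /\
    A * Cconj B + B * Cconj D = 0 /\ G * Cconj B + D * Cconj D = a.
Proof.
  intros Hh HW Hs.
  assert (Na : a <> 0) by (apply Cmod_pos_neq_0; lra).
  assert (Hs' : forall p, inW p -> phi (phi p) = tri a 0 1 a p) by (intros; rewrite Hs, (diag_tri f a a Hf); easy).
  destruct (diag_normal_form a a phi Ha Ha Hh HW) as (A & B & l & G & j & D & Hl & Hj & Hphi & HA & HB & HG & HD).
  { intros p Wp. now rewrite Hs, Hf. }
  assert (Hone : forall n, a ^ n = Cconj a -> n = 1%nat).
  { intros n E. apply (f_equal Cmod) in E. rewrite Cmod_conj, Cmod_pow in E.
    rewrite <- (pow_1 (Cmod a)) in E at 2. now apply pow_inj_lt_1 in E. }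
  assert (Hlin : forall p, inW p -> phi p = amap A B 1 G 1 D p).
  { intros p Wp. rewrite Hphi by easy. unfold amap, pmap; f_equal.
    - destruct (excluded_middle_informative (B = 0)) as [->|NB]; [ring|]. now rewrite (Hone l (HB NB)).
    - destruct (excluded_middle_informative (G = 0)) as [->|NG]; [ring|]. now rewrite (Hone j (HG NG)). }
  destruct (square_coefficients phi A B G D a 0 a 1 1 1 (le_n 1) (le_n 1) (le_n 1) Hlin HW Hs') as (E1 & E2 & E3 & E4).
  rewrite !Cpow_1_r in *.
  exists A, B, G, D. split; [easy|]. split; [|easy].
  destruct (excluded_middle_informative (A = 0)) as [A0|NA]; [|now apply HA].
  destruct (excluded_middle_informative (B = 0)) as [B0|NB].
  - exfalso. apply Na. rewrite <- E1, A0, B0. ring.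
  - pose proof (HB NB) as E. rewrite (Hone l E), Cpow_1_r in E. exact E.
Qed.

(** Hilbert 90: [P = x kappa + conj kappa conj M] satisfies [P M = x conj P], and
    its determinant cannot vanish for all of [kappa = 1, i, 1 + i]. *)
Lemma homothety_positive_equivalent (x : R) (phi0 : C2 -> C2) (s : Hopf f -> Hopf f) :
  (0 < x)%R -> a = RtoC x * RtoC x ->
  (forall p, phi0 p = amap (RtoC x) 0 1 0 1 (RtoC x) p) ->
  odd_real_structure s -> equivalent s (induced f phi0).
Proof.
  intros Hx Exa H0 Ho. destruct (odd_lift f s Ho) as (phi & Hl & Hh & HW & Hs).
  destruct (homothety_classification phi Hh HW Hs) as (A & B & G & D & Hphi & _ & E1 & E2 & E3 & E4).
  assert (Nx := RtoC_neq_0 x Hx).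
  set (X := RtoC x) in *.
  assert (HX : Cconj X = X) by apply Cconj_RtoC.
  assert (Hs0 : forall p, phi0 (phi0 p) = f p).
  { intros p. rewrite !H0, !amap_linear, Hf; cbn [fst snd].
    rewrite !Cplus_conj, !Cmult_conj, !Cconj_conj, !Cconj_RtoC, HX, Exa.
    apply injective_projections; cbn [fst snd]; ring. }
  assert (F1 := f_equal Cconj E1). assert (F2 := f_equal Cconj E2).
  assert (F3 := f_equal Cconj E3). assert (F4 := f_equal Cconj E4).
  rewrite Exa in F1, F4.
  rewrite ?Cplus_conj, ?Cmult_conj, ?Cconj_conj, ?HX, ?Cconj_RtoC in F1, F2, F3, F4.
  rewrite (Cmult_conj X X), HX in F1, F4. rewrite (Cconj_RtoC 0) in F2, F3.
  set (A' := Cconj A) in *. set (B' := Cconj B) in *. set (G' := Cconj G) in *. set (D' := Cconj D) in *.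
  assert (HA : Cconj A' = A) by apply Cconj_conj. assert (HB : Cconj B' = B) by apply Cconj_conj.
  assert (HG : Cconj G' = G) by apply Cconj_conj. assert (HD : Cconj D' = D) by apply Cconj_conj.
  assert (Hk : exists kap : C, (X * kap + Cconj kap * A') * (X * kap + Cconj kap * D') - (Cconj kap * B') * (Cconj kap * G') <> 0).
  { apply NNPP; intros Hno.
    assert (Hall : forall kap : C, (X * kap + Cconj kap * A') * (X * kap + Cconj kap * D') - (Cconj kap * B') * (Cconj kap * G') = 0).
    { intros kap. apply NNPP; intros H; apply Hno; now exists kap. }
    (* The determinant as a quadratic form in kappa and conj kappa. The combination of its three
       values used below cancels the last two coefficients and leaves 4 x^2 i. *)
    set (Q := fun kap c => X * X * (kap * kap) + X * (A' + D') * (kap * c) + (A' * D' - B' * G') * (c * c)).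
    assert (HQ : forall kap, Q kap (Cconj kap) = 0) by (intros kap; rewrite <- (Hall kap); unfold Q; ring).
    pose proof (HQ 1) as Q1. pose proof (HQ Ci) as Q2. pose proof (HQ (1 + Ci)) as Q3.
    assert (Ei : Cconj Ci = - Ci) by (apply injective_projections; simpl; ring).
    assert (Eii : Ci * Ci = - (1)) by (apply injective_projections; simpl; ring).
    rewrite Cplus_conj, Ei, Cconj_RtoC in Q3. rewrite Ei in Q2. rewrite Cconj_RtoC in Q1.
    assert (S : 4 * (X * X) * Ci = 0).
    { transitivity (Q (1 + Ci) (1 + - Ci) + (Ci - 1) * Q 1 1 - (Ci + 1) * Q Ci (- Ci)); [|rewrite Q1, Q2, Q3; ring].
      unfold Q.
      replace ((1 + Ci) * (1 + Ci)) with (2 * Ci) by (transitivity (1 + 2 * Ci + Ci * Ci); [rewrite Eii; ring|ring]).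
      replace ((1 + Ci) * (1 + - Ci)) with (RtoC 2) by (transitivity (1 - Ci * Ci); [rewrite Eii; ring|ring]).
      replace ((1 + - Ci) * (1 + - Ci)) with (- (2 * Ci)) by (transitivity (1 - 2 * Ci + Ci * Ci); [rewrite Eii; ring|ring]).
      replace (Ci * - Ci) with (RtoC 1) by (transitivity (- (Ci * Ci)); [rewrite Eii; ring|ring]).
      replace (- Ci * - Ci) with (- (1)) by (transitivity (Ci * Ci); [rewrite Eii; ring|ring]).
      rewrite Eii. generalize (A' + D') (A' * D' - B' * G') X Ci; intros; ring. }
    assert (N4 := RtoC_neq_0 4 ltac:(lra)).
    apply (Cmult_neq_0 (4 * (X * X)) Ci); [| |exact S].
    - now repeat apply Cmult_neq_0.
    - intros E. apply (f_equal Im) in E. simpl in E. lra. }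
  destruct Hk as [kap Hdet].
  set (K := Cconj kap) in *. assert (HK : Cconj K = kap) by apply Cconj_conj.
  apply (linear_equivalent f a a Ha Ha Hf A B G D X 0 0 X
    (X * kap + K * A') (K * B') (K * G') (X * kap + K * D') phi phi0 s Hl Hphi H0 Hs0); [|ring|ring| | | |].
  - exact Hdet.
  - rewrite ?Cplus_conj, ?Cmult_conj, ?HX, ?HK, ?HA, ?HG, ?HD. fold K.
    transitivity (X * kap * A + K * (A' * A + B' * G)); [ring|].
    rewrite F1. ring.
  - rewrite ?Cplus_conj, ?Cmult_conj, ?HX, ?HK, ?HB, ?HD. fold K.
    transitivity (X * kap * B + K * (A' * B + B' * D)); [ring|].
    rewrite F3. ring.
  - rewrite ?Cplus_conj, ?Cmult_conj, ?HX, ?HK, ?HA, ?HG. fold K.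
    transitivity (X * kap * G + K * (G' * A + D' * G)); [ring|].
    rewrite F2. ring.
  - rewrite ?Cplus_conj, ?Cmult_conj, ?HX, ?HK, ?HD, ?HB. fold K.
    transitivity (X * kap * D + K * (G' * B + D' * D)); [ring|].
    rewrite F4. ring.
Qed.

Lemma homothety_negative_square (beta : C) (phi0 : C2 -> C2) :
  Cconj beta = - beta -> beta * beta = a ->
  (forall p, phi0 p = amap 0 beta 1 (- beta) 1 0 p) -> forall p, phi0 (phi0 p) = f p.
Proof.
  intros Hb Ea H0 p. rewrite !H0, !amap_linear, Hf; cbn [fst snd].
  rewrite !Cplus_conj, !Cmult_conj, !Copp_conj, !Cconj_conj, !Cconj_RtoC, Hb, <- Ea.
  apply injective_projections; cbn [fst snd]; ring.
Qed.

(** A quaternionic structure: the first row (1, 0) of the conjugating matrix may be chosen, and P M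
    = M0 conj P then dictates the second row, (- conj A / beta, - conj B / beta). It is invertible
    because B = 0 would make a = A conj A positive. *)
Lemma homothety_negative_equivalent (beta : C) (phi0 : C2 -> C2) (s : Hopf f -> Hopf f) :
  (Re a < 0)%R -> Cconj beta = - beta -> beta * beta = a ->
  (forall p, phi0 p = amap 0 beta 1 (- beta) 1 0 p) ->
  odd_real_structure s -> equivalent s (induced f phi0).
Proof.
  intros Hneg Hb Ea H0 Ho. destruct (odd_lift f s Ho) as (phi & Hl & Hh & HW & Hs).
  destruct (homothety_classification phi Hh HW Hs) as (A & B & G & D & Hphi & Hreal & E1 & E2 & E3 & E4).
  assert (Na : a <> 0) by (apply Cmod_pos_neq_0; lra).
  assert (Nb : beta <> 0) by (intros ->; apply Na; rewrite <- Ea; ring).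
  assert (NB : B <> 0).
  { intros ->. assert (E : A * Cconj A = a) by (rewrite <- E1; ring).
    destruct (mult_conj_positive A a Na E) as [_ H]. lra. }
  assert (F1 := f_equal Cconj E1). assert (F3 := f_equal Cconj E3).
  rewrite <- Hreal, Cplus_conj, !Cmult_conj, !Cconj_conj in F1.
  rewrite Cplus_conj, !Cmult_conj, !Cconj_conj, Cconj_RtoC in F3.
  apply (linear_equivalent f a a Ha Ha Hf A B G D 0 beta (- beta) 0
    1 0 (- Cconj A / beta) (- Cconj B / beta) phi phi0 s Hl Hphi H0
    (homothety_negative_square beta phi0 Hb Ea H0)); [|ring|ring| | | |].
  - replace (1 * (- Cconj B / beta) - 0 * (- Cconj A / beta)) with (- (1) * Cconj B * / beta) by (field; easy).
    assert (N1 := RtoC_neq_0 1 ltac:(lra)).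
    repeat apply Cmult_neq_0; [|now apply Cconj_neq_0|now apply Cinv_neq_0].
    intros E. apply (f_equal Re) in E. simpl in E. lra.
  - unfold Cdiv. rewrite Cmult_conj, Cinv_conj, Copp_conj, Cconj_conj, Hb, Cconj_RtoC by easy. field; easy.
  - unfold Cdiv. rewrite Cmult_conj, Cinv_conj, Copp_conj, Cconj_conj, Hb, Cconj_RtoC by easy. field; easy.
  - rewrite Cconj_RtoC. transitivity (- (Cconj A * A + Cconj B * G) / beta); [field; easy|].
    rewrite F1, <- Ea. field; easy.
  - rewrite Cconj_RtoC. transitivity (- (Cconj A * B + Cconj B * D) / beta); [field; easy|].
    rewrite F3. field; easy.
Qed.

End Homothety.

(** * The classification *)

Lemma Cpositive_pow (d : C) (k : nat) : Cpositive d -> Cpositive (d ^ k).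
Proof.
  intros [Hi Hr]. replace d with (RtoC (Re d)) by (destruct d as [x y]; simpl in *; now subst y).
  rewrite <- RtoC_pow. split; simpl; [easy|now apply pow_lt].
Qed.

(** The half-angle formula: the real part is sqrt((|a| + Re a) / 2), nonzero because a is not a
    negative real. *)
Lemma nonreal_sqrt_exists (a : C) : Im a <> 0%R -> exists beta, beta * beta = a.
Proof.
  intros Hi. destruct a as [u v]; simpl in Hi.
  set (m := Cmod (u, v)).
  assert (Hm : (m * m = u * u + v * v)%R).
  { unfold m, Cmod; simpl. rewrite sqrt_sqrt; [ring|]. nra. }
  assert (Hm0 : (0 <= m)%R) by apply Cmod_ge_0.
  assert (Hv : (0 < v * v)%R) by (destruct (Rtotal_order v 0) as [|[|]]; [nra|easy|nra]).
  assert (Hp : (0 < (m + u) / 2)%R).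
  { apply Rdiv_lt_0_compat; [|lra]. apply Rnot_le_lt; intros H. nra. }
  set (x := sqrt ((m + u) / 2)).
  assert (Hx : (0 < x)%R) by now apply sqrt_lt_R0.
  assert (Hxx : (x * x = (m + u) / 2)%R) by (apply sqrt_sqrt; lra).
  exists (x, v / (2 * x))%R.
  apply injective_projections; simpl; [|field; lra].
  apply Rmult_eq_reg_r with (4 * (x * x))%R; [|nra].
  replace ((x * x - v / (2 * x) * (v / (2 * x))) * (4 * (x * x)))%R with (4 * (x * x) * (x * x) - v * v)%R by (field; lra).
  rewrite Hxx. nra.
Qed.

Lemma negative_sqrt_conj (a beta : C) : Im a = 0%R -> (Re a < 0)%R -> beta * beta = a ->
  Cconj beta = - beta.
Proof.
  intros Hi Hr <-. destruct beta as [u v]; simpl in *.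
  assert (Hu : u = 0%R).
  { destruct (Req_dec u 0) as [Hu|Hu]; [easy|exfalso].
    assert (v = 0)%R by (apply Rmult_eq_reg_l with u; [nra|easy]). subst v. nra. }
  subst u. apply injective_projections; simpl; ring.
Qed.

Lemma upper_theorem (f : contraction) (b d : C) (k : nat) :
  (0 < Cmod d < 1)%R -> (1 <= k)%nat -> (b = 0 /\ (2 <= k)%nat) \/ b = 1 ->
  (forall p, map_of f p = tri (d ^ k) b k d p) -> diagonal_coefficients f = (d ^ k, d) ->
  (Cpositive d -> forall p, conj_c (half f p) =
     amap (pos_sqrt d ^ k) (b / (2 * pos_sqrt d ^ k)) k 0 1 (pos_sqrt d) p) ->
  ((exists s : Hopf (map_of f) -> Hopf (map_of f), odd_real_structure s) <->
     has_real_coefficients f /\ has_positive_diagonal f) /\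
  (has_real_coefficients f /\ has_positive_diagonal f ->
      forall s : Hopf (map_of f) -> Hopf (map_of f),
        odd_real_structure s -> equivalent s (sigma_f f)).
Proof.
  intros Hd Hk Hb Hf Hdiag Hhalf.
  assert (Hpos : has_real_coefficients f /\ has_positive_diagonal f <-> Cpositive d).
  { unfold has_real_coefficients, has_positive_diagonal; rewrite Hdiag; simpl. split; [tauto|].
    intros H. pose proof (Cpositive_pow d k H) as H'.
    destruct H as [H1 H2], H' as [H3 H4]; repeat split; easy. }
  rewrite Hpos. split; [split|].
  - intros [s Hs]. exact (upper_positive (map_of f) b d k Hd Hk Hb Hf s Hs).
  - intros H. destruct (Cpositive_sqrt d H) as [Hy Ey]. exists (sigma_f f).
    exact (upper_exists (map_of f) b d k Hd Hk Hb Hf (sqrt (Re d)) Hy Ey _ (Hhalf H)).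
  - intros H s Hs. destruct (Cpositive_sqrt d H) as [Hy Ey].
    exact (upper_equivalent (map_of f) b d k Hd Hk Hb Hf (sqrt (Re d)) Hy Ey _ (Hhalf H) s Hs).
Qed.

Lemma half_upper (d b : C) (k : nat) (q : C2 -> C2) : b = 0 \/ b = 1 ->
  (Cpositive d -> forall z w,
     q (z, w) = (pos_sqrt d ^ k * z + b / (2 * pos_sqrt d ^ k) * w ^ k, pos_sqrt d * w)) ->
  Cpositive d -> forall p, conj_c (q p) =
    amap (pos_sqrt d ^ k) (b / (2 * pos_sqrt d ^ k)) k 0 1 (pos_sqrt d) p.
Proof.
  intros Hb H Hd [z w]. rewrite (H Hd), amap_upper. unfold conj_c; cbn [fst snd].
  destruct (Cpositive_sqrt d Hd) as [Hy _]. unfold pos_sqrt. set (y := sqrt (Re d)) in *.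
  assert (Ny : RtoC y ^ k <> 0) by now apply Cpow_nz, RtoC_neq_0.
  assert (N2 := RtoC_neq_0 2 ltac:(lra)).
  assert (Eb : Cconj b = b) by (destruct Hb as [-> | ->]; apply Cconj_RtoC).
  unfold Cdiv.
  rewrite Cplus_conj, !Cmult_conj, Cinv_conj, Cmult_conj, !Cpow_conj, !Cconj_RtoC, Eb
    by now apply Cmult_neq_0.
  easy.
Qed.

Lemma half_diag (x y : R) (p : C2) :
  conj_c (RtoC x * fst p, RtoC y * snd p) = amap (RtoC x) 0 1 0 1 (RtoC y) p.
Proof.
  rewrite amap_lower. unfold conj_c; cbn [fst snd].
  rewrite !Cmult_conj, !Cconj_RtoC. f_equal; ring.
Qed.

Lemma pos_root_unique (x y : R) (j : nat) : (0 < x)%R -> (0 < y)%R ->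
  (RtoC x * RtoC x) ^ j = RtoC y * RtoC y -> RtoC y = RtoC x ^ j.
Proof.
  intros Hx Hy E. rewrite Cpow_mult_l, <- !RtoC_pow, <- !RtoC_mult in E. apply RtoC_inj in E.
  rewrite <- RtoC_pow. f_equal. pose proof (pow_lt x j Hx). nra.
Qed.

Lemma IIc_theorem (alpha delta : C) : admissible (IIc alpha delta) ->
  let f := IIc alpha delta in
  ((exists s : Hopf (map_of f) -> Hopf (map_of f), odd_real_structure s) <->
     (has_real_coefficients f /\ has_positive_diagonal f) \/ in_IIc' f) /\
  (has_real_coefficients f /\ has_positive_diagonal f ->
      forall s : Hopf (map_of f) -> Hopf (map_of f),
        odd_real_structure s -> equivalent s (sigma_f f)).
Proof.
  intros (Ha & Hd & Hr) f.
  assert (Na : alpha <> 0) by (apply Cmod_pos_neq_0; lra).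
  assert (Nd : delta <> 0) by (apply Cmod_pos_neq_0; lra).
  assert (Hf : forall p, map_of f p = (alpha * fst p, delta * snd p)) by (intros [z w]; easy).
  assert (Hhalf : forall p, conj_c (half f p) =
    amap (RtoC (sqrt (Re alpha))) 0 1 0 1 (RtoC (sqrt (Re delta))) p).
  { intros [z w]. rewrite <- half_diag. easy. }
  split; [split|].
  - intros [s Hs]. destruct (odd_lift _ s Hs) as (phi & _ & Hh & HW & Hsq).
    destruct (diag_classification (map_of f) alpha delta Ha Hd Hf phi Hr Hh HW Hsq)
      as [(A & G & j & D & _ & _ & EA & ED & _)|(B & G & _ & E & Hi & _)].
    + left. pose proof (mult_conj_positive A alpha Na EA) as [P1 P2].
      pose proof (mult_conj_positive D delta Nd ED) as [P3 P4]. repeat split; easy.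
    + right. exists alpha. subst delta. easy.
  - intros [[_ [Pa Pd]]|[a [E Hi]]].
    + destruct (Cpositive_sqrt alpha Pa) as [_ Ex]. destruct (Cpositive_sqrt delta Pd) as [_ Ey].
      exists (sigma_f f).
      exact (diag_positive_exists (map_of f) alpha delta Ha Hd Hf _ _ _ Ex Ey Hhalf).
    + injection E as E1 E2. subst a.
      destruct (nonreal_sqrt_exists alpha Hi) as [beta Hb].
      exists (induced (map_of f) (amap 0 beta 1 (Cconj beta) 1 0)).
      apply (conjugate_pair_exists (map_of f) alpha beta); try easy.
      intros p; now rewrite <- E2.
  - intros [_ [Pa Pd]] s Hs. destruct (odd_lift _ s Hs) as (phi & Hl & Hh & HW & Hsq).
    destruct (Cpositive_sqrt alpha Pa) as [Hx Ex]. destruct (Cpositive_sqrt delta Pd) as [Hy Ey].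
    destruct (diag_classification (map_of f) alpha delta Ha Hd Hf phi Hr Hh HW Hsq)
      as [(A & G & j & D & Hj & Hphi & EA & ED & EG & HG)|(B & G & _ & E & Hi & _)].
    + apply (lower_equivalent (map_of f) alpha delta Ha Hd Hf A G D j _ _ phi _ s Hj Hx Hy Ex Ey
        Hl Hphi EA ED EG); [|exact Hhalf].
      destruct HG as [HG|HG]; [now left|right].
      apply pos_root_unique; [easy|easy|]. now rewrite <- Ex, <- Ey.
    + destruct Pa; contradiction.
Qed.

Lemma IIc'_equivalent (alpha beta : C) : admissible (IIc alpha (Cconj alpha)) ->
  Im alpha <> 0%R -> beta * beta = alpha ->
  let f := IIc alpha (Cconj alpha) in
  forall s : Hopf (map_of f) -> Hopf (map_of f),
    odd_real_structure s -> equivalent s (sigma_f' f beta).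
Proof.
  intros (Ha & Hd & Hr) Hi Hb f s Hs.
  assert (Na : alpha <> 0) by (apply Cmod_pos_neq_0; lra).
  assert (Hf : forall p, map_of f p = (alpha * fst p, Cconj alpha * snd p)) by (intros [z w]; easy).
  destruct (odd_lift _ s Hs) as (phi & Hl & Hh & HW & Hsq).
  destruct (diag_classification (map_of f) alpha (Cconj alpha) Ha Hd Hf phi Hr Hh HW Hsq)
      as [(A & G & j & D & _ & _ & EA & _)|(B & G & Hphi & _ & _ & EB)].
  (* The triangular alternative would make alpha = A conj A real. *)
  - destruct (mult_conj_positive A alpha Na EA); contradiction.
  - apply (conjugate_pair_equivalent (map_of f) alpha beta _ Ha Hf Hb) with B G phi; try easy.
    intros p. rewrite amap_linear. unfold conj_c'; cbn [fst snd].
    rewrite !Cmult_conj, Cconj_conj. f_equal; ring.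
Qed.

Lemma IV_theorem (alpha : C) : (0 < Cmod alpha < 1)%R ->
     ((exists s : Hopf (map_of (IV alpha)) -> Hopf (map_of (IV alpha)),
         odd_real_structure s) <-> Im alpha = 0%R) /\
     (Im alpha = 0%R /\ (0 < Re alpha < 1)%R ->
      forall s : Hopf (map_of (IV alpha)) -> Hopf (map_of (IV alpha)),
        odd_real_structure s -> equivalent s (sigma_f (IV alpha))) /\
     (Im alpha = 0%R /\ (-1 < Re alpha < 0)%R ->
      forall beta : C, beta * beta = alpha ->
      forall s : Hopf (map_of (IV alpha)) -> Hopf (map_of (IV alpha)),
        odd_real_structure s -> equivalent s (frak_s_f (IV alpha) beta)).
Proof.
  intros Ha.
  assert (Na : alpha <> 0) by (apply Cmod_pos_neq_0; lra).
  assert (Hf : forall p, map_of (IV alpha) p = (alpha * fst p, alpha * snd p)) by (intros [z w]; easy).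
  assert (Hhalf : forall p, conj_c (half (IV alpha) p) =
    amap (RtoC (sqrt (Re alpha))) 0 1 0 1 (RtoC (sqrt (Re alpha))) p).
  { intros [z w]. rewrite <- half_diag. easy. }
  split; [split|split].
  - intros [s Hs]. destruct (odd_lift _ s Hs) as (phi & _ & Hh & HW & Hsq).
    destruct (homothety_classification _ alpha Ha Hf phi Hh HW Hsq) as (_ & _ & _ & _ & _ & E & _).
    apply (f_equal Im) in E. simpl in E. unfold Im in *. lra.
  - intros Hi. destruct (Rtotal_order (Re alpha) 0) as [Hr|[Hr|Hr]].
    + assert (Hb : (Ci * RtoC (sqrt (- Re alpha))) * (Ci * RtoC (sqrt (- Re alpha))) = alpha).
      { pose proof (sqrt_sqrt (- Re alpha) ltac:(lra)) as E.
        destruct alpha as [x y]; simpl in *. subst y. apply injective_projections; simpl; [|ring].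
        transitivity (- (sqrt (- x) * sqrt (- x)))%R; [ring|]. rewrite E; ring. }
      set (beta := Ci * RtoC (sqrt (- Re alpha))) in *.
      exists (induced (map_of (IV alpha)) (amap 0 beta 1 (- beta) 1 0)).
      apply (linear_square_root_odd _ alpha alpha Ha Ha Hf 0 beta (- beta) 0); [easy|].
      apply (homothety_negative_square _ alpha Hf beta); try easy.
      now apply (negative_sqrt_conj alpha).
    + exfalso. apply Na. now apply injective_projections.
    + destruct (Cpositive_sqrt alpha (conj Hi Hr)) as [_ Ex].
      exists (sigma_f (IV alpha)).
      exact (diag_positive_exists _ alpha alpha Ha Ha Hf _ _ _ Ex Ex Hhalf).
  - intros [Hi [Hr _]] s Hs. destruct (Cpositive_sqrt alpha (conj Hi Hr)) as [Hx Ex].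
    exact (homothety_positive_equivalent _ alpha Ha Hf _ _ s Hx Ex Hhalf Hs).
  - intros [Hi [_ Hr]] beta Hb s Hs.
    pose proof (negative_sqrt_conj alpha beta Hi Hr Hb) as Hc.
    apply (homothety_negative_equivalent _ alpha Ha Hf beta _ s Hr Hc Hb); [|easy].
    intros p. rewrite amap_linear. unfold conj_J; cbn [fst snd].
    rewrite !Cmult_conj, Hc. f_equal; ring.
Qed.

Theorem theorem3p15 :
  (forall f : contraction, admissible f -> ~ in_IV f ->
     ((exists s : Hopf (map_of f) -> Hopf (map_of f), odd_real_structure s) <->
      ((has_real_coefficients f /\ has_positive_diagonal f) \/ in_IIc' f)) /\
     (has_real_coefficients f /\ has_positive_diagonal f ->
      forall s : Hopf (map_of f) -> Hopf (map_of f),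
        odd_real_structure s -> equivalent s (sigma_f f)) /\
     (forall alpha : C, f = IIc alpha (Cconj alpha) -> Im alpha <> 0%R ->
      forall beta : C, beta * beta = alpha ->
      forall s : Hopf (map_of f) -> Hopf (map_of f),
        odd_real_structure s -> equivalent s (sigma_f' f beta))) /\
  (forall alpha : C, (0 < Cmod alpha < 1)%R ->
     ((exists s : Hopf (map_of (IV alpha)) -> Hopf (map_of (IV alpha)),
         odd_real_structure s) <-> Im alpha = 0%R) /\
     (Im alpha = 0%R /\ (0 < Re alpha < 1)%R ->
      forall s : Hopf (map_of (IV alpha)) -> Hopf (map_of (IV alpha)),
        odd_real_structure s -> equivalent s (sigma_f (IV alpha))) /\
     (Im alpha = 0%R /\ (-1 < Re alpha < 0)%R ->
      forall beta : C, beta * beta = alpha ->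
      forall s : Hopf (map_of (IV alpha)) -> Hopf (map_of (IV alpha)),
        odd_real_structure s -> equivalent s (frak_s_f (IV alpha) beta))).
Proof.
  split; [|exact IV_theorem].
  assert (N2 := RtoC_neq_0 2 ltac:(lra)).
  assert (Npos : forall d k, Cpositive d -> pos_sqrt d ^ k <> 0).
  { intros d k H. apply Cpow_nz, RtoC_neq_0. now apply Cpositive_sqrt. }
  (* Types III, II_a and II_b at once; for them the alternative II'_c and the clause about it are
     vacuous. *)
  assert (Upper : forall f b d k,
    (forall a d, f <> IIc a d) -> (0 < Cmod d < 1)%R -> (1 <= k)%nat ->
    (b = RtoC 0 /\ (2 <= k)%nat) \/ b = RtoC 1 ->
    (forall z w, map_of f (z, w) = (d ^ k * z + b * w ^ k, d * w)) ->
    diagonal_coefficients f = (d ^ k, d) ->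
    (Cpositive d -> forall z w,
      half f (z, w) = (pos_sqrt d ^ k * z + b / (2 * pos_sqrt d ^ k) * w ^ k, pos_sqrt d * w)) ->
    ((exists s : Hopf (map_of f) -> Hopf (map_of f), odd_real_structure s) <->
      ((has_real_coefficients f /\ has_positive_diagonal f) \/ in_IIc' f)) /\
     (has_real_coefficients f /\ has_positive_diagonal f ->
      forall s : Hopf (map_of f) -> Hopf (map_of f),
        odd_real_structure s -> equivalent s (sigma_f f)) /\
     (forall alpha : C, f = IIc alpha (Cconj alpha) -> Im alpha <> 0%R ->
      forall beta : C, beta * beta = alpha ->
      forall s : Hopf (map_of f) -> Hopf (map_of f),
        odd_real_structure s -> equivalent s (sigma_f' f beta))).
  { intros f b d k Hne Hd Hk Hb Hf Hdiag Hhalf.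
    destruct (upper_theorem f b d k Hd Hk Hb) as [H1 H2]; try easy.
    - intros [z w]. rewrite Hf. easy.
    - apply half_upper; [|easy]. destruct Hb as [[Hb _]|Hb]; auto.
    - split; [|split; [exact H2|]].
      + rewrite H1. split; [now left|]. intros [H|[a [E _]]]; [easy|now apply Hne in E].
      + intros a E. now apply Hne in E. }
  intros f Hadm HIV. destruct f as [alpha|r delta|r delta|alpha|alpha delta].
  - exfalso; apply HIV; now exists alpha.
  - destruct Hadm as [Hr Hd]. apply (Upper _ 0 delta r); try easy; [lia|now left| |].
    + intros z w; simpl; f_equal; ring.
    + intros H z w; simpl; f_equal. field. repeat split; auto.
  - destruct Hadm as [Hr Hd]. apply (Upper _ 1 delta r); try easy; [lia|now right| |].
    + intros z w; simpl; f_equal; ring.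
    + intros H z w; simpl; f_equal. field. repeat split; auto.
  (* Type II_b is the member k = 1 of the family with shear coefficient 1. *)
  - apply (Upper _ 1 alpha 1%nat); try easy; [now right| | |].
    + intros z w; simpl; f_equal; ring.
    + simpl; f_equal; ring.
    + intros H z w. pose proof (Npos alpha 1%nat H) as Np. rewrite Cpow_1_r in Np.
      cbn [half]. rewrite !Cpow_1_r. f_equal. field. easy.
  - destruct (IIc_theorem alpha delta Hadm) as [H1 H2]. split; [exact H1|split; [exact H2|]].
    intros a E Hi beta Hb. injection E as -> ->. now apply IIc'_equivalent.
Qed.
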